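(* Let $(\mathcal{P},\mathcal{N})$ be a Beurling generalized number system with $\theta$-well-behaved integers. For every $\varepsilon>0$ and $\delta>0$, there exists a constant $T_{0} = T_{0}(\varepsilon, \delta)$, such that uniformly for $T \ge T_{0}$, $\mu \ge 2/3 + \delta$ we have \[ N(\alpha,T) = N\bigl((1-\mu)\theta + \mu, T\bigr) \ll T^{(c(\mu)+\varepsilon)(1-\mu)}(\log T)^{9}, \] where $c(\mu) = \frac{4\mu}{2\mu^{2}-3\mu+2}$ and the implicit constant does not depend on $\varepsilon$ or $\delta$.
   Context: A Beurling generalized prime number system $(\mathcal{P},\mathcal{N})$ consists of generalized primes $1<p_1\le p_2\le\dots$, $p_k\to\infty$, and the generalized integers $1=n_0<n_1\le n_2\le\dots$ forming the multiplicative semigroup generated by the primes (counted with multiplicity of factorization). Set $N(x)=\sum_{n_k\le x}1$ and $\zeta(s)=\sum_k n_k^{-s}$. The integers are $\theta$-well-behaved ($\theta\in[0,1)$) if $N(x)=Ax+O(x^\theta)$ for some $A>0$. For the zeta function, $N(\alpha,T)=\#\{\rho=\beta+\mathrm{i}\gamma:\zeta(\rho)=0,\ \beta\ge\alpha,\ |\gamma|\le T\}$. Here $\alpha=(1-\mu)\theta+\mu$. Implicit constants may depend on $\theta$, $A$ and the $O$-constant in $N(x)=Ax+O(x^\theta)$. *)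

(* Defs.v *)
From HB Require Import structures.
From mathcomp Require Import all_boot all_order all_algebra finmap.
From mathcomp Require Import all_classical all_reals all_analysis.
From mathcomp.real_closed Require Import complex.

Set Implicit Arguments.
Unset Strict Implicit.
Unset Printing Implicit Defensive.

Import Order.TTheory GRing.Theory Num.Theory.
Import numFieldNormedType.Exports.

Local Open Scope classical_set_scope.
Local Open Scope ring_scope.
Local Open Scope complex_scope.

(* The generalized integers are indexed by factorizations, i.e. by finitely
   supported exponent sequences nu (standing for \prod_j p_j ^ nu_j), so that a
   real number with several factorizations is repeated in bint accordingly. *)
Record beurling (R : realType) := Beurling {
  bprime : nat -> R;
  bint : nat -> R;
  bprime_gt1 : 1 < bprime 0%N;
  bprime_nondecreasing : {homo bprime : j k / (j <= k)%N >-> j <= k};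
  bprime_cvg : bprime k @[k --> \oo] --> +oo;
  bint0 : bint 0%N = 1;
  bint1_gt1 : 1 < bint 1%N;
  bint_nondecreasing : {homo bint : j k / (j <= k)%N >-> j <= k};
  bint_factor : exists2 nu : nat -> {fsfun nat -> nat with 0%N}, bijective nu &
    forall k, bint k = \prod_(j <- finsupp (nu k)) bprime j ^+ nu k j
}.

Definition bcount (R : realType) (B : beurling R) (x : R) : R :=
  \sum_(k \in [set k | bint B k <= x]) (1 : R).

Definition well_behaved (R : realType) (theta A K : R) (B : beurling R) :=
  forall x : R, 1 <= x -> `|bcount B x - A * x| <= K * x `^ theta.

(* x ^ s = exp (s log x), for x > 0 *)
Definition cpow (R : realType) (x : R) (s : R[i]) : R[i] :=
  (x `^ complex.Re s * cos (complex.Im s * ln x)) +i*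
  (x `^ complex.Re s * sin (complex.Im s * ln x)).

(* R[i]^o is R[i] seen as a normed space over itself: derivable is complex
   differentiability. *)
Definition cderivable (R : realType) (f : R[i] -> R[i]) (s : R[i]) :=
  derivable (f : R[i]^o -> R[i]^o) s 1.

Definition zeta_continuation (R : realType) (theta : R) (B : beurling R)
    (Z : R[i] -> R[i]) :=
  (forall s : R[i], 1 < complex.Re s ->
     (\sum_(0 <= k < m) cpow (bint B k) (- s) : R[i]^o) @[m --> \oo]
       --> (Z s : R[i]^o)) /\
  (forall s : R[i], theta < complex.Re s -> s != 1 -> cderivable Z s).

(* The analytic continuation of \sum_k n_k ^ (- s) to the half-plane
   Re s > theta punctured at 1. For theta-well-behaved integers it exists (with a
   simple pole at 1), and it is unique there by the identity theorem; its values
   at 1 and on Re s <= theta are irrelevant. *)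
Definition bzeta (R : realType) (theta : R) (B : beurling R) : R[i] -> R[i] :=
  xget (fun=> 0) [set Z | zeta_continuation theta B Z].

(* The supremum of the m such that f = (s - rho) ^ m * g near rho with g
   holomorphic near rho. *)
Definition vanishing_order (R : realType) (f : R[i] -> R[i]) (rho : R[i]) :
    \bar R :=
  ereal_sup [set m%:R%:E | m in [set m : nat | exists g : R[i] -> R[i],
    \forall s \near (rho : R[i]^o),
      cderivable g s /\ f s = (s - rho) ^+ m * g s]].

(* Zeros are counted with multiplicity; the pole 1, where bzeta has a
   meaningless value, is excluded. *)
Definition zero_count (R : realType) (theta : R) (B : beurling R)
    (alpha T : R) : \bar R :=
  \esum_(rho in [set rho : R[i] | [/\ bzeta theta B rho = 0, rho != 1,
      alpha <= complex.Re rho & `|complex.Im rho| <= T]])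
    vanishing_order (bzeta theta B) rho.

Definition cmu (R : realType) (mu : R) : R :=
  4 * mu / (2 * mu ^+ 2 - 3 * mu + 2).

(* Main.v *)
Require Import Defs.
From HB Require Import structures.
From mathcomp Require Import all_boot all_order all_algebra finmap.
From mathcomp Require Import all_classical all_reals all_analysis.
From mathcomp Require Import ring lra.
From mathcomp.real_closed Require Import complex.

Set Implicit Arguments.
Unset Strict Implicit.
Unset Printing Implicit Defensive.

Import Order.TTheory GRing.Theory Num.Theory.
Import numFieldNormedType.Exports.

Local Open Scope classical_set_scope.
Local Open Scope ring_scope.
Local Open Scope complex_scope.

Local Notation cn := Normc.normc.

(* Zeros are detected with a Moebius mollifier and counted with Jensen's inequality.
   Let [D] be the sum of the first [m] terms of the zeta series, [M] the mollifier with
   [x] terms, [F = D M - 1] and [Q = 1 + (zeta - D) M]. As [zeta M = Q + F], the function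
   [1 - (F / Q) ^ 2] vanishes at the zeros of zeta, and [Q] is within [1/2] of [1] at
   heights between about [(m x) ^ (1 - alpha)] and [T] as soon as
   [T m ^ (theta - alpha) x ^ (1 - alpha) ln T] is small. Jensen's inequality is applied,
   by the maximum modulus principle alone, to the product of these functions over discs
   centred at the points [3 + i t] with [t] running over a grid of step about [1 / ln T].
   The logarithm of that product is at most a multiple of a sum of [|F| ^ 2] over shifted
   grid points, and [F] is a Dirichlet polynomial supported on [n_j] with [j >= x], so a
   discrete mean value estimate applies; its off-diagonal terms are controlled by the
   number of generalized integers in short intervals. The few discs near the real axis are
   handled with [(s - 1) zeta] and trivial bounds. Optimizing [x] and [m] as powers of [T]
   gives the exponent [c(mu)]. *)

(** * Complex differentiability *)

(** The square in [1 - (F / Q) ^ 2] makes the logarithm of its modulus quadratic in [F], which is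
    what a mean value bound controls; a single product over all discs lets that bound enter as a sum
    over the grid, with no selection of large values. At the centres [F] is at most 1/8 in modulus,
    so the product is bounded below there by a sum of the same kind. The discs overshoot the line
    [al] by at most [3 / ln T]; since the lengths [m] and [x] are polynomial in [T], this costs only
    constants. The two radii in Jensen's inequality differ by [1 / ln T], so each zero contributes
    at least a multiple of [1 / ln T] and the count loses one logarithm. Everything must be uniform
    in the system, so constants are fixed before [B], from [theta], [A] and [K] alone. The margin
    delta makes [x] exceed a constant, and eps pays for a logarithm and a constant in the condition
    that keeps [Q] near 1; both affect only how large [T] must be, so the implicit constant is free
    of them. The power of [ln T] obtained in this way is 6. *)

Lemma eq_ler (R : numDomainType) (x y : R) : x = y -> x <= y.
Proof. by move=> ->. Qed.

Section ComplexNorm.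
Variable R : realType.
Implicit Types z w s : R[i].

Lemma cn_ge0 z : 0 <= cn z.
Proof. by case: z => a b /=; rewrite sqrtr_ge0. Qed.

Lemma normr_cn z : `|z| = (cn z)%:C.
Proof. by case: z. Qed.

Lemma cnM z w : cn (z * w) = cn z * cn w.
Proof. exact: Normc.normcM. Qed.

Lemma cnV z : cn z^-1 = (cn z)^-1.
Proof. exact: Normc.normcV. Qed.

Lemma cnN z : cn (- z) = cn z.
Proof. exact: normcN. Qed.

Lemma cnD z w : cn (z + w) <= cn z + cn w.
Proof. exact: le_normcD. Qed.

Lemma cnB z w : cn (z - w) <= cn z + cn w.
Proof. by rewrite -(cnN w) cnD. Qed.

Lemma cn0 : cn (0 : R[i]) = 0.
Proof. exact: Normc.normc0. Qed.

Lemma cn1 : cn (1 : R[i]) = 1.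
Proof. exact: Normc.normc1. Qed.

Lemma cn_sym z w : cn (z - w) = cn (w - z).
Proof. by rewrite -cnN opprB. Qed.

Lemma cn_eq0 z : (cn z == 0) = (z == 0).
Proof.
by apply/eqP/eqP => [/Normc.eq0_normc//|->]; rewrite cn0.
Qed.

Lemma cn_gt0 z : (0 < cn z) = (z != 0).
Proof. by rewrite lt_def cn_ge0 andbT cn_eq0. Qed.

Lemma cnBl z w : cn z - cn w <= cn (z - w).
Proof. by rewrite lerBlDr; have := cnD (z - w) w; rewrite subrK. Qed.

Lemma cnDl z w : cn z - cn w <= cn (z + w).
Proof. by have := cnBl z (- w); rewrite cnN opprK. Qed.

Lemma cn_real (x : R) : cn x%:C = `|x|.
Proof. by rewrite /= expr0n /= addr0 sqrtr_sqr. Qed.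

Lemma cnX z n : cn (z ^+ n) = cn z ^+ n.
Proof. by elim: n => [|n IH]; rewrite ?expr0 ?cn1// !exprS cnM IH. Qed.

Lemma cn_sum (I : Type) (r : seq I) (P : pred I) (F : I -> R[i]) :
  cn (\sum_(i <- r | P i) F i) <= \sum_(i <- r | P i) cn (F i).
Proof.
elim/big_rec2: _ => [|i y x _ le]; first by rewrite cn0.
by apply: (le_trans (cnD _ _)); rewrite lerD2l.
Qed.

Lemma cn_prod (I : Type) (r : seq I) (P : pred I) (F : I -> R[i]) :
  cn (\prod_(i <- r | P i) F i) = \prod_(i <- r | P i) cn (F i).
Proof. by elim/big_rec2: _ => [|i y x _ le]; rewrite ?cn1// cnM le. Qed.

Lemma sqr_cn z : cn z ^+ 2 = complex.Re z ^+ 2 + complex.Im z ^+ 2.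
Proof. by case: z => a b /=; rewrite sqr_sqrtr// addr_ge0// sqr_ge0. Qed.

Lemma ler_Re_cn z : `|complex.Re z| <= cn z.
Proof.
rewrite -(@ler_pXn2r _ 2) ?nnegrE ?cn_ge0// sqr_cn real_normK ?num_real//.
by rewrite lerDl sqr_ge0.
Qed.

Lemma ler_Im_cn z : `|complex.Im z| <= cn z.
Proof.
rewrite -(@ler_pXn2r _ 2) ?nnegrE ?cn_ge0// sqr_cn real_normK ?num_real//.
by rewrite lerDr sqr_ge0.
Qed.

Lemma ler_cn_ReIm z : cn z <= `|complex.Re z| + `|complex.Im z|.
Proof.
rewrite -(@ler_pXn2r _ 2) ?nnegrE ?cn_ge0 ?addr_ge0// sqr_cn.
rewrite sqrrD !real_normK ?num_real// -addrA [X in _ <= _ + X]addrC addrA.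
by rewrite lerDl mulrn_wge0// mulr_ge0.
Qed.

Lemma conjc_cn z : cn (conjc z) = cn z.
Proof. by case: z => a b /=; rewrite sqrrN. Qed.

Lemma mulr_conjc z : z * conjc z = (cn z ^+ 2)%:C.
Proof.
rewrite sqr_cn; case: z => a b /=.
by apply/eqP; rewrite eq_complex /=; apply/andP; split; apply/eqP; ring.
Qed.

Lemma cReD z w : complex.Re (z + w) = complex.Re z + complex.Re w.
Proof. by case: z w => ? ? []. Qed.
Lemma cImD z w : complex.Im (z + w) = complex.Im z + complex.Im w.
Proof. by case: z w => ? ? []. Qed.
Lemma cReN z : complex.Re (- z) = - complex.Re z.
Proof. by case: z. Qed.
Lemma cImN z : complex.Im (- z) = - complex.Im z.
Proof. by case: z. Qed.
Lemma cReM z w : complex.Re (z * w) =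
  complex.Re z * complex.Re w - complex.Im z * complex.Im w.
Proof. by case: z w => ? ? []. Qed.
Lemma cImM z w : complex.Im (z * w) =
  complex.Re z * complex.Im w + complex.Im z * complex.Re w.
Proof. by case: z w => ? ? []. Qed.

Lemma complex_eq z w : complex.Re z = complex.Re w ->
  complex.Im z = complex.Im w -> z = w.
Proof. by case: z w => ? ? [? ?] /= -> ->. Qed.

(** Balls of [R[i]^o] have radii in [R[i]], but a positive element of [R[i]] is real, so real radii
    suffice. *)
Lemma near_cnP (s : R[i]) (P : R[i] -> Prop) :
  (\forall w \near (s : R[i]^o), P w) <->
  exists2 e : R, 0 < e & forall w, cn (w - s) < e -> P w.
Proof.
split.
  move=> /nbhs_ballP[e /= e0 H]; exists (complex.Re e).
    by move: e0; rewrite ltcE => /andP[].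
  move=> w hw; apply: H; rewrite -ball_normE /= distrC normr_cn.
  move: e0; rewrite ltcE /= => /andP[/eqP e0 _].
  by rewrite ltcE /= e0 eqxx.
move=> [e e0 H]; apply/nbhs_ballP; exists e%:C => /=.
  by rewrite ltcR.
move=> w; rewrite -ball_normE /= distrC normr_cn ltcR; exact: H.
Qed.

Lemma cvg_cnP (T : Type) (F : set_system T) (FF : Filter F) (f : T -> R[i]) l :
  (f x : R[i]^o) @[x --> F] --> (l : R[i]^o) <->
  forall e : R, 0 < e -> \forall x \near F, cn (f x - l) < e.
Proof.
split.
  move=> H e e0; have /H : nbhs (l : R[i]^o) [set w | cn (w - l) < e].
    by apply/near_cnP; exists e.
  by [].
move=> H P /near_cnP[e e0 hP].
by rewrite /nbhs /=; apply: filterS (H _ e0) => x /hP.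
Qed.

Lemma cderivableP (f : R[i] -> R[i]) s :
  cderivable f s <-> exists d, forall e : R, 0 < e -> exists2 del : R, 0 < del &
    forall z, cn z < del -> cn (f (s + z) - f s - d * z) <= e * cn z.
Proof.
split.
  move=> /cvg_ex[l] /cvg_cnP H; exists l => e e0.
  have := H e e0; rewrite near_withinE => /near_cnP[del del0 H'].
  exists del => // z hz; have [->|z0] := eqVneq z 0.
    by rewrite addr0 subrr mulr0 subr0 cn0 mulr0.
  have := H' z; rewrite subr0 => /(_ hz z0) /= /ltW.
  have -> : (z *: (1 : R[i]^o) + s : R[i]) = s + z.
    by rewrite addrC /GRing.scale /= mulr1.
  move=> {}H'; have -> : f (s + z) - f s - l * z =
     z * (z^-1 * (f (s + z) - f s) - l).
    by rewrite mulrBr mulrA divff// mul1r (mulrC l).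
  by rewrite cnM mulrC ler_wpM2r// cn_ge0.
move=> [d H]; apply/cvg_ex; exists d; apply/cvg_cnP => e e0.
have [|del del0 H'] := H (e / 2); first by rewrite divr_gt0.
rewrite near_withinE; apply/near_cnP; exists del => // z; rewrite subr0 => hz z0 /=.
have -> : (z *: (1 : R[i]^o) + s : R[i]) = s + z.
  by rewrite addrC /GRing.scale /= mulr1.
have -> : z^-1 *: (f (s + z) - f s : R[i]^o) - d =
     z^-1 * (f (s + z) - f s - d * z) :> R[i].
  rewrite [RHS]mulrBr; congr (_ - _).
  by rewrite mulrCA mulVf ?mulr1.
rewrite cnM cnV; apply: (le_lt_trans (y := e / 2)); last first.
  by rewrite ltr_pdivrMr// ltr_pMr// ltr1n.
by rewrite ler_pdivrMl ?cn_gt0// [leRHS]mulrC; exact: H'.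
Qed.

Lemma cderivable_continuous (f : R[i] -> R[i]) s : cderivable f s ->
  forall e : R, 0 < e -> exists2 del : R, 0 < del &
    forall w, cn (w - s) < del -> cn (f w - f s) < e.
Proof.
move=> /cderivableP[d H] e e0; have [|del del0 H'] := H 1; first exact: ltr01.
have k0 : 0 < cn d + 1 by rewrite ltr_wpDl ?cn_ge0.
exists (Num.min del (e / (cn d + 1))); first by rewrite lt_min del0 divr_gt0.
move=> w; rewrite lt_min => /andP[h1 h2].
have := H' _ h1; rewrite mul1r (addrC s) subrK => h.
have -> : f w - f s = f w - f s - d * (w - s) + d * (w - s) by rewrite subrK.
apply: (le_lt_trans (cnD _ _)); rewrite cnM.
apply: (@le_lt_trans _ _ ((cn d + 1) * cn (w - s))).
  by rewrite mulrDl mul1r addrC lerD2l.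
by rewrite mulrC -ltr_pdivlMr.
Qed.

Lemma cderivable_near (f g : R[i] -> R[i]) s (e : R) : 0 < e ->
  (forall w, cn (w - s) < e -> f w = g w) -> cderivable f s -> cderivable g s.
Proof.
move=> e0 H; apply: near_eq_derivable.
by apply/near_cnP; exists e => // w /H.
Qed.

Lemma cderivable_ext (f g : R[i] -> R[i]) s :
  cderivable f s -> (forall w, f w = g w) -> cderivable g s.
Proof. by move=> hf H; apply: (@cderivable_near _ _ _ 1 _ _ hf). Qed.

Lemma cderivableD (f g : R[i] -> R[i]) s : cderivable f s -> cderivable g s ->
  cderivable (fun w => f w + g w) s.
Proof. by move=> hf hg; exact: (@derivableD R[i] R[i]^o R[i]^o f g s 1 hf hg). Qed.

Lemma cderivableN (f : R[i] -> R[i]) s : cderivable f s ->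
  cderivable (fun w => - f w) s.
Proof. by move=> hf; exact: (@derivableN R[i] R[i]^o R[i]^o f s 1 hf). Qed.

Lemma cderivableB (f g : R[i] -> R[i]) s : cderivable f s -> cderivable g s ->
  cderivable (fun w => f w - g w) s.
Proof. by move=> hf hg; exact: (@derivableB R[i] R[i]^o R[i]^o f g s 1 hf hg). Qed.

Lemma cderivableM (f g : R[i] -> R[i]) s : cderivable f s -> cderivable g s ->
  cderivable (fun w => f w * g w) s.
Proof. by move=> hf hg; exact: (@derivableM R[i] R[i]^o f g s 1 hf hg). Qed.

Lemma cderivableV (f : R[i] -> R[i]) s : f s != 0 -> cderivable f s ->
  cderivable (fun w => (f w)^-1) s.
Proof. by move=> h0 hf; exact: (@derivableV R[i] R[i]^o f s 1 h0 hf). Qed.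

Lemma cderivable_cst c s : cderivable (fun=> c) s.
Proof. exact: (@derivable_cst R[i] R[i]^o R[i]^o c s 1). Qed.
Arguments cderivable_cst : clear implicits.

Lemma cderivable_id s : cderivable id s.
Proof. exact: (@derivable_id R[i] R[i]^o s 1). Qed.
Arguments cderivable_id : clear implicits.

Lemma cderivableX (f : R[i] -> R[i]) n s : cderivable f s ->
  cderivable (fun w => f w ^+ n) s.
Proof.
move=> hf; elim: n => [|n IH].
  by apply: (cderivable_ext (cderivable_cst 1 s)) => w; rewrite expr0.
by apply: (cderivable_ext (cderivableM hf IH)) => w; rewrite exprS.
Qed.

Lemma cderivable_sum (I : Type) (r : seq I) (P : pred I) (F : I -> R[i] -> R[i]) s :
  (forall i, P i -> cderivable (F i) s) ->
  cderivable (fun w => \sum_(i <- r | P i) F i w) s.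
Proof.
move=> H; elim: r => [|i r IH].
  by apply: (cderivable_ext (cderivable_cst 0 s)) => w; rewrite big_nil.
case Pi: (P i); last first.
  by apply: (cderivable_ext IH) => w; rewrite big_cons Pi.
by apply: (cderivable_ext (cderivableD (H _ Pi) IH)) => w; rewrite big_cons Pi.
Qed.

Lemma cderivable_prod (I : Type) (r : seq I) (P : pred I) (F : I -> R[i] -> R[i]) s :
  (forall i, P i -> cderivable (F i) s) ->
  cderivable (fun w => \prod_(i <- r | P i) F i w) s.
Proof.
move=> H; elim: r => [|i r IH].
  by apply: (cderivable_ext (cderivable_cst 1 s)) => w; rewrite big_nil.
case Pi: (P i); last first.
  by apply: (cderivable_ext IH) => w; rewrite big_cons Pi.
by apply: (cderivable_ext (cderivableM (H _ Pi) IH)) => w; rewrite big_cons Pi.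
Qed.

Lemma cderivable_comp (f g : R[i] -> R[i]) s : cderivable g s ->
  cderivable f (g s) -> cderivable (fun w => f (g w)) s.
Proof.
move=> /derivable1_diffP hg /derivable1_diffP hf; apply/derivable1_diffP.
exact: (@differentiable_comp R[i] R[i]^o R[i]^o R[i]^o g f s hg hf).
Qed.

Lemma cderivable_shift (f : R[i] -> R[i]) a s : cderivable f (a + s) ->
  cderivable (fun w => f (a + w)) s.
Proof.
move=> hf; apply: (@cderivable_comp f (fun w => a + w) s _ hf).
exact (cderivableD (cderivable_cst a s) (cderivable_id s)).
Qed.

End ComplexNorm.
Arguments cderivable_cst {R} c s.
Arguments cderivable_id {R} s.
Opaque cderivable.

Local Ltac pos :=
  match goal with
  | |- is_true (0 <= _ * _) => apply: mulr_ge0; pos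
  | |- is_true (0 <= _ + _) => first [by apply: addr_ge0; pos | lra]
  | |- is_true (0 <= _ ^+ _) => first [exact: sqr_ge0 | apply: exprn_ge0; pos]
  | |- is_true (0 <= _ ^-1) => rewrite invr_ge0; pos
  | |- is_true (0 <= _ `^ _) => exact: powR_ge0
  | |- is_true (0 <= cn _) => exact: cn_ge0
  | |- is_true (0 <= expR _) => exact: expR_ge0
  | |- is_true (0 <= `| _ |) => exact: normr_ge0
  | |- is_true (0 <= _%:R) => exact: ler0n
  | |- is_true (0 < _ * _) => apply: mulr_gt0; pos
  | |- is_true (0 < _ + _) =>
      first [by apply: ltr_wpDl; pos | by apply: ltr_wpDr; pos | lra]
  | |- is_true (0 < _ ^+ _) => apply: exprn_gt0; pos
  | |- is_true (0 < _ ^-1) => rewrite invr_gt0; pos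
  | |- is_true (0 < _ `^ _) => apply: powR_gt0; pos
  | |- is_true (0 < expR _) => exact: expR_gt0
  | |- is_true (0 < _.+1%:R) => exact: ltr0Sn
  | |- is_true (0 < _%:R) => by rewrite ltr0n
  | _ => first [by [] | assumption | by apply: ltW | lra]
  end.

(** * Goursat's theorem on rectangles *)

Section Goursat.
Variable R : realType.

Lemma MVT_norm_le (H k : R -> R) (a b M : R) : a <= b ->
  (forall x : R, is_derive x 1 H (k x)) ->
  (forall x, a <= x <= b -> `|k x| <= M) ->
  `|H b - H a| <= M * (b - a).
Proof.
move=> ab dH kM.
have cH : {within `[a, b], continuous H}.
  apply: continuous_subspaceT => y; apply: differentiable_continuous.
  by apply/derivable1_diffP; apply: ex_derive.
have [c cab ->] := MVT_segment ab (fun x _ => dH x) cH.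
rewrite normrM (ger0_norm (x := b - a)) ?subr_ge0// ler_wpM2r ?subr_ge0//.
by apply: kM; move: cab; rewrite in_itv.
Qed.

(** Integration from a base point [a] yields a primitive only to the right of [a]. Two such
    primitives differ by a constant to the right of both base points, so normalizing them to vanish
    at 1 and letting the base point depend on [x] glues them into one. *)
Lemma continuous_primitive (h : R -> R) : continuous h ->
  exists H : R -> R, forall x : R, is_derive x 1 H (h x).
Proof.
move=> ch.
have loc (a : R) : exists H : R -> R, forall x : R, a < x -> is_derive x 1 H (h x).
  exists (fun x => \int[lebesgue_measure]_(t in `[a, x]) h t) => x ax.
  have ii : lebesgue_measure.-integrable `[a, x + 1] (EFin \o h).
    apply: continuous_compact_integrable; first exact: segment_compact.
    exact: continuous_subspaceT.
  have [|d e] := @continuous_FTC1_closed R h a x (x + 1) _ ii ax (ch x).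
    by rewrite ltrDl.
  by apply: (DeriveDef d); rewrite -derive1E; exact: e.
have [H HH] := choice loc.
have const (a b c : R) : a <= b -> b < c -> H a c - H b c = H a (b + 1) - H b (b + 1).
  move=> ab bc.
  pose D x := H a x - H b x.
  have dD (x : R) : b < x -> is_derive x 1 D 0.
    move=> bx; have h1 := HH a x (le_lt_trans ab bx); have h2 := HH b x bx.
    by have := is_deriveB h1 h2; rewrite subrr.
  have key x y : b < x -> x <= y -> D x = D y.
    move=> bx xy; apply/eqP; rewrite -subr_eq0 -oppr_eq0 opprB; apply/eqP.
    have dD' z : z \in `]x, y[%R -> is_derive z 1 D 0.
      by rewrite in_itv /= => /andP[xz _]; apply: dD; exact: lt_trans xz.
    have cD : {within `[x, y], continuous D}.
      apply: derivable_within_continuous => u; rewrite in_itv /= => /andP[xu _].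
      by apply: ex_derive; apply: dD; exact: lt_le_trans xu.
    by have [z _ ->] := MVT_segment xy dD' cD; rewrite mul0r.
  have [le|lt] := leP c (b + 1); first exact: key.
  by apply/esym/key; [rewrite ltrDl|exact: ltW].
pose F x := H (Num.min x 0 - 1) x - H (Num.min x 0 - 1) 1 .
have Fa a x : a < 0 -> a < x -> F x = H a x - H a 1.
  move=> a0 ax.
  have [le|lt] := leP a (Num.min x 0 - 1).
    rewrite /F; set b := Num.min x 0 - 1 in le *.
    have bx : b < x by rewrite /b ltrBlDr gt_min ltrDl ltr01.
    have b1 : b < 1 by rewrite /b ltrBlDr gt_min orbC -[1 + 1]/2%:R ltr0n.
    have e1 := const a b x le bx; have e2 := const a b 1 le b1.
    by lra.
  rewrite /F; set b := Num.min x 0 - 1 in lt *.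
  have e1 := const b a x (ltW lt) ax.
  have e2 := const b a 1 (ltW lt) (lt_trans a0 ltr01).
  by lra.
exists F => x.
have := HH (Num.min x 0 - 1) x.
set a := Num.min x 0 - 1 => Ha.
have ax : a < x by rewrite /a ltrBlDr gt_min ltrDl ltr01.
have a0 : a < 0.
  by rewrite /a ltrBlDr add0r gt_min orbC ltr01.
have d1 := is_deriveB (Ha ax) (is_derive_cst (H a 1) x 1).
rewrite subr0 in d1.
apply: near_eq_is_derive d1.
near=> y; rewrite (Fa a)//.
near: y; exact: lt_nbhsr.
Unshelve. all: by end_near. Qed.

Definition prim (h : R -> R) : R -> R := xget (fun=> 0) [set H | forall x : R, is_derive x 1 H (h x)].

Lemma primP (h : R -> R) : continuous h -> forall x : R, is_derive x 1 (prim h) (h x).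
Proof.
by move=> /continuous_primitive[H HH]; exact: (@xgetPex _ (fun=> 0) [set H | _] (ex_intro _ H HH)).
Qed.

Section Rectangle.
Variables P Q : R -> R -> R.
Hypothesis cP : forall y, continuous (P^~ y).
Hypothesis cQ : forall x, continuous (Q x).

(** The circulation of [P dx + Q dy] counterclockwise around the rectangle with lower left corner
    [(a, c)], width [w] and height [h]; each side is an increment of a primitive. *)
Definition rect_int (a c w h : R) : R :=
  (prim (P^~ c) (a + w) - prim (P^~ c) a) - (prim (P^~ (c + h)) (a + w) - prim (P^~ (c + h)) a)
  + (prim (Q (a + w)) (c + h) - prim (Q (a + w)) c) - (prim (Q a) (c + h) - prim (Q a) c).

Lemma rect_int_bisect a c w h :
  rect_int a c w h = rect_int a c (w / 2) (h / 2) + rect_int (a + w / 2) c (w / 2) (h / 2)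
   + rect_int a (c + h / 2) (w / 2) (h / 2) + rect_int (a + w / 2) (c + h / 2) (w / 2) (h / 2).
Proof.
have e (u v : R) : u + v / 2 + v / 2 = u + v by lra.
rewrite /rect_int !e; ring.
Qed.

(** The forms are affine up to [e] with the same cross coefficient [be]. The corrections
    [be * h * x] and [- be * w * y] added to the primitives remove the linear part from the
    differences of opposite sides, and cancel over the whole boundary. *)
Lemma rect_int_small a c w h x0 y0 al be ga e : 0 <= w -> 0 <= h ->
  (forall x y, a <= x <= a + w -> c <= y <= c + h ->
    `|P x y - P x0 y0 - al * (x - x0) - be * (y - y0)| <= e /\
    `|Q x y - Q x0 y0 - be * (x - x0) - ga * (y - y0)| <= e) ->
  `|rect_int a c w h| <= 2 * e * (w + h).
Proof.
move=> w0 h0 H.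
have aw : a <= a + w by rewrite lerDl.
have ch : c <= c + h by rewrite lerDl.
pose F x := prim (P^~ c) x - prim (P^~ (c + h)) x + (be * h) * x.
have dF (x : R) : is_derive x 1 F (P x c - P x (c + h) + be * h).
  have d1 := primP (@cP c) x; have d2 := primP (@cP (c + h)) x.
  have := is_deriveD (is_deriveB d1 d2) (is_deriveZ (be * h) (is_derive_id x 1)).
  by rewrite /GRing.scale /= mulr1.
pose G y := prim (Q (a + w)) y - prim (Q a) y - (be * w) * y.
have dG (y : R) : is_derive y 1 G (Q (a + w) y - Q a y - be * w).
  have d1 := primP (@cQ (a + w)) y; have d2 := primP (@cQ a) y.
  have := is_deriveB (is_deriveB d1 d2) (is_deriveZ (be * w) (is_derive_id y 1)).
  by rewrite /GRing.scale /= mulr1.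
have hF := MVT_norm_le aw dF (M := 2 * e).
have hG := MVT_norm_le ch dG (M := 2 * e).
have -> : rect_int a c w h = (F (a + w) - F a) + (G (c + h) - G c).
  by rewrite /rect_int /F /G; ring.
apply: (le_trans (ler_normD _ _)).
rewrite mulrDr; apply: lerD.
  rewrite (_ : a + w - a = w) in hF; last by ring.
  apply: hF => x ax.
  have [|h1 _] := H x c ax; first by rewrite lexx.
  have [|h2 _] := H x (c + h) ax; first by rewrite lexx andbT.
  have -> : P x c - P x (c + h) + be * h =
    (P x c - P x0 y0 - al * (x - x0) - be * (c - y0)) -
    (P x (c + h) - P x0 y0 - al * (x - x0) - be * (c + h - y0)) by ring.
  by apply: (le_trans (ler_normB _ _)); lra.
rewrite (_ : c + h - c = h) in hG; last by ring.
apply: hG => y cy.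
have [|_ h1] := H (a + w) y _ cy; first by rewrite lexx andbT.
have [|_ h2] := H a y _ cy; first by rewrite lexx.
have -> : Q (a + w) y - Q a y - be * w =
    (Q (a + w) y - Q x0 y0 - be * (a + w - x0) - ga * (y - y0)) -
    (Q a y - Q x0 y0 - be * (a - x0) - ga * (y - y0)) by ring.
by apply: (le_trans (ler_normB _ _)); lra.
Qed.

(** Differentiability of [P] and [Q] at the point with equal cross derivatives [be]. For the
    imaginary and real parts of a holomorphic function this equality is one of the Cauchy-Riemann
    equations. *)
Definition closed_at (x y : R) := exists al be ga : R, forall e, 0 < e ->
  exists2 del : R, 0 < del & forall x' y', `|x' - x| < del -> `|y' - y| < del ->
    `|P x' y' - P x y - al * (x' - x) - be * (y' - y)| <= e * (`|x' - x| + `|y' - y|) /\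
    `|Q x' y' - Q x y - be * (x' - x) - ga * (y' - y)| <= e * (`|x' - x| + `|y' - y|).

Definition bisect_step (w h : R) (p : R * R) : R * R :=
  let J := `|rect_int p.1 p.2 w h| in
  let w' := w / 2 in let h' := h / 2 in
  if J <= 4 * `|rect_int p.1 p.2 w' h'| then p
  else if J <= 4 * `|rect_int (p.1 + w') p.2 w' h'| then (p.1 + w', p.2)
  else if J <= 4 * `|rect_int p.1 (p.2 + h') w' h'| then (p.1, p.2 + h')
  else (p.1 + w', p.2 + h').

Fixpoint bisect (a c w h : R) (n : nat) : R * R :=
  if n is m.+1 then bisect_step (w / 2 ^+ m) (h / 2 ^+ m) (bisect a c w h m) else (a, c).

Lemma bisect_stepP w h p : 0 <= w -> 0 <= h ->
  [/\ `|rect_int p.1 p.2 w h| <=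
      4 * `|rect_int (bisect_step w h p).1 (bisect_step w h p).2 (w / 2) (h / 2)|,
   p.1 <= (bisect_step w h p).1 <= p.1 + w / 2 &
   p.2 <= (bisect_step w h p).2 <= p.2 + h / 2].
Proof.
move=> w0 h0; rewrite /bisect_step.
have := rect_int_bisect p.1 p.2 w h.
set J := rect_int p.1 p.2 w h.
set J1 := rect_int _ _ _ _; set J2 := rect_int _ _ _ _.
set J3 := rect_int _ _ _ _; set J4 := rect_int _ _ _ _ => e.
case: ifPn => [h1|/negP h1]; first by split => //; apply/andP; split; lra.
case: ifPn => [h2|/negP h2]; first by split => //=; apply/andP; split; lra.
case: ifPn => [h3|/negP h3]; first by split => //=; apply/andP; split; lra.
split => /=; [|by apply/andP; split; lra|by apply/andP; split; lra].
rewrite -/J4.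
have : `|J| <= `|J1| + `|J2| + `|J3| + `|J4|.
  rewrite e; do 3! (apply: (le_trans (ler_normD _ _)); rewrite lerD2r); done.
move: h1 h2 h3 => /negP; rewrite -ltNge => h1 /negP; rewrite -ltNge => h2 /negP.
by rewrite -ltNge => h3 h4; lra.
Qed.

(** Each bisection keeps at least a quarter of the circulation, while closedness at the limit point
    bounds the circulation of the [n]-th rectangle by an arbitrarily small multiple of [4 ^- n]. *)
Lemma goursat_rect a c w h : 0 <= w -> 0 <= h ->
  (forall x y, a <= x <= a + w -> c <= y <= c + h -> closed_at x y) ->
  rect_int a c w h = 0.
Proof.
move=> w0 h0 H.
pose p n := bisect a c w h n.
have wn n : 0 <= w / 2 ^+ n by rewrite divr_ge0// exprn_ge0.
have hn n : 0 <= h / 2 ^+ n by rewrite divr_ge0// exprn_ge0.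
have half (u : R) n : u / 2 ^+ n / 2 = u / 2 ^+ n.+1.
  by rewrite exprSr invfM mulrA.
have stp n := bisect_stepP (p n) (wn n) (hn n).
have J n : `|rect_int a c w h| <= 4 ^+ n * `|rect_int (p n).1 (p n).2 (w / 2 ^+ n) (h / 2 ^+ n)|.
  elim: n => [|n IH]; first by rewrite expr0 mul1r !divr1.
  apply: (le_trans IH); rewrite exprSr -mulrA ler_wpM2l ?exprn_ge0//.
  by have [] := stp n; rewrite !half.
have nest1 n m : (n <= m)%N -> (p n).1 <= (p m).1 /\ (p m).1 + w / 2 ^+ m <= (p n).1 + w / 2 ^+ n.
  elim: m => [|m IH]; first by rewrite leqn0 => /eqP ->.
  rewrite leq_eqVlt => /orP[/eqP ->//|/IH[i1 i2]].
  have [_ + _] := stp m; rewrite -/(p m.+1) half => /andP[j1 j2].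
  have e : w / 2 ^+ m = w / 2 ^+ m.+1 + w / 2 ^+ m.+1 by rewrite -half; lra.
  by split; lra.
have nest2 n m : (n <= m)%N -> (p n).2 <= (p m).2 /\ (p m).2 + h / 2 ^+ m <= (p n).2 + h / 2 ^+ n.
  elim: m => [|m IH]; first by rewrite leqn0 => /eqP ->.
  rewrite leq_eqVlt => /orP[/eqP ->//|/IH[i1 i2]].
  have [_ _ +] := stp m; rewrite -/(p m.+1) half => /andP[j1 j2].
  have e : h / 2 ^+ m = h / 2 ^+ m.+1 + h / 2 ^+ m.+1 by rewrite -half; lra.
  by split; lra.
have limpt (q r : nat -> R) : (forall n, 0 <= r n) ->
    (forall n m, (n <= m)%N -> q n <= q m /\ q m + r m <= q n + r n) ->
    exists x, forall n, q n <= x <= q n + r n.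
  move=> r0 nest; exists (sup (range q)) => n.
  have ub k : ubound (range q) (q k + r k).
    move=> _ [m _ <-]; have [km|mk] := leqP k m.
      by have [_] := nest _ _ km; apply: le_trans; rewrite lerDl.
    by have [h1 _] := nest _ _ (ltnW mk); apply: (le_trans h1); rewrite lerDl.
  apply/andP; split.
    apply: ub_le_sup; last by exists n.
    by exists (q 0%N + r 0%N); exact: ub.
  by apply: ge_sup; [exists (q 0%N), 0%N|exact: ub].
have [x0 hx] := limpt _ _ wn nest1.
have [y0 hy] := limpt _ _ hn nest2.
have := hx 0%N; have := hy 0%N; rewrite !divr1 /= => hy0 hx0.
have [al [be [ga Hc]]] := H _ _ hx0 hy0.
apply/eqP; rewrite -normr_le0; apply/ler_addgt0Pl => e e0; rewrite addr0.
(* The total error comes out as [e / k * (2 * (w + h) ^ 2)]; adding 1 keeps [k] positive for a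
   degenerate rectangle. *)
pose k := 2 * (w + h) * (w + h) + 1.
have k0 : 0 < k by rewrite /k ltr_wpDl// !mulr_ge0// addr_ge0.
have [|del del0 Hd] := Hc (e / k); first by rewrite divr_gt0.
have [n [hwn hhn]] : exists n, w / 2 ^+ n < del /\ h / 2 ^+ n < del.
  have [n hn'] : exists n, (w + h) / del < 2 ^+ n.
    exists (Num.bound ((w + h) / del)).
    have := @upper_nthrootP R ((w + h) / del) (Num.bound ((w + h) / del)) (leqnn _).
    by [].
  have p2 : 0 < 2 ^+ n :> R by rewrite exprn_gt0.
  exists n; move: hn'; rewrite ltr_pdivrMr// => hn'.
  rewrite !ltr_pdivrMr// ![del * _]mulrC; split; apply: le_lt_trans hn'.
    by rewrite lerDl.
  by rewrite lerDr.
have := J n; have := @rect_int_small (p n).1 (p n).2 (w / 2 ^+ n) (h / 2 ^+ n)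
  x0 y0 al be ga (e / k * (w / 2 ^+ n + h / 2 ^+ n)) (wn n) (hn n).
move=> h1; have /h1 h2 : forall x y, (p n).1 <= x <= (p n).1 + w / 2 ^+ n ->
   (p n).2 <= y <= (p n).2 + h / 2 ^+ n ->
    `|P x y - P x0 y0 - al * (x - x0) - be * (y - y0)| <= e / k * (w / 2 ^+ n + h / 2 ^+ n) /\
    `|Q x y - Q x0 y0 - be * (x - x0) - ga * (y - y0)| <= e / k * (w / 2 ^+ n + h / 2 ^+ n).
  move=> x y /andP[x1 x2] /andP[y1 y2].
  have /andP[x3 x4] := hx n; have /andP[y3 y4] := hy n.
  have dx : `|x - x0| <= w / 2 ^+ n by rewrite ler_norml; apply/andP; split; lra.
  have dy : `|y - y0| <= h / 2 ^+ n by rewrite ler_norml; apply/andP; split; lra.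
  have [g1 g2] := Hd x y (le_lt_trans dx hwn) (le_lt_trans dy hhn).
  have g3 : e / k * (`|x - x0| + `|y - y0|) <= e / k * (w / 2 ^+ n + h / 2 ^+ n).
    by apply: ler_wpM2l; [rewrite divr_ge0// ltW|exact: lerD].
  by split; [exact: le_trans g1 g3|exact: le_trans g2 g3].
move=> h3; apply: (le_trans h3).
apply: (@le_trans _ _ (4 ^+ n * (2 * (e / k * (w / 2 ^+ n + h / 2 ^+ n)) * (w / 2 ^+ n + h / 2 ^+ n)))).
  by rewrite ler_wpM2l// exprn_ge0.
have -> : 4 ^+ n * (2 * (e / k * (w / 2 ^+ n + h / 2 ^+ n)) * (w / 2 ^+ n + h / 2 ^+ n))
   = e / k * (2 * (w + h) * (w + h)).
  have -> : 4 ^+ n = 2 ^+ n * 2 ^+ n :> R by rewrite -exprMn -natrM.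
  have : 2 ^+ n != 0 :> R by rewrite expf_neq0.
  have := k0 => /lt0r_neq0.
  move: (2 ^+ n) => u; clear; move=> k0 u0.
  by field; rewrite u0 k0.
rewrite mulrAC ler_pdivrMr// ler_wpM2l ?ltW// /k; lra.
Qed.

End Rectangle.
End Goursat.

(** * The maximum modulus principle *)

Section ComplexExp.
Variable R : realType.
Implicit Types (z w s : R[i]) (u v : R).

Lemma expR_sub1_norm u : `|expR u - 1| <= `|u| * Num.max 1 (expR u).
Proof.
have [u0|u0] := leP 0 u.
  have h := expR_ge1Dx (- u); rewrite expRN in h.
  have e0 := expR_gt0 u.
  rewrite !ger0_norm ?subr_ge0//; last first.
    by apply: le_trans (expR_ge1Dx u); rewrite lerDl.
  apply: (@le_trans _ _ (u * expR u)); last by rewrite ler_wpM2l// le_max lexx orbT.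
  have : (1 + - u) * expR u <= 1 by rewrite -ler_pdivlMr// mul1r.
  by lra.
have h := expR_ge1Dx u.
rewrite ler0_norm; last by rewrite subr_le0 expR_le1 ltW.
rewrite ltr0_norm//; apply: (@le_trans _ _ (- u * 1)); first by lra.
by apply: ler_wpM2l; [rewrite oppr_ge0 ltW|rewrite le_max lexx].
Qed.

Lemma expR_sub1x_norm u : `|expR u - 1 - u| <= u ^+ 2 * Num.max 1 (expR u).
Proof.
have h := expR_ge1Dx u.
rewrite ger0_norm; last by lra.
have [u0|u0] := leP 0 u.
  have := expR_sub1_norm u; have e0 := expR_gt0 u.
  have e1 : 1 <= expR u by lra.
  rewrite (max_idPr e1) !ger0_norm//; last by lra.
  move=> h1; apply: (@le_trans _ _ (u * (expR u - 1))).
    have h2 := expR_ge1Dx (- u); rewrite expRN in h2.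
    have : (1 + - u) * expR u <= 1 by rewrite -ler_pdivlMr// mul1r.
    by lra.
  by rewrite expr2 -mulrA ler_wpM2l.
apply: (@le_trans _ _ (u ^+ 2 * 1)); last by rewrite ler_wpM2l ?sqr_ge0// le_max lexx.
have h2 := expR_ge1Dx (- u); rewrite expRN in h2.
have e0 := expR_gt0 u.
have h3 : (1 - u) * expR u <= 1 by rewrite -ler_pdivlMr// mul1r.
have h4 : 0 < 1 - u by lra.
rewrite -(ler_pM2l h4); apply: (@le_trans _ _ (u ^+ 2)); last by nra.
by nra.
Qed.

Lemma sin_norm_le v : `|sin v| <= `|v|.
Proof.
wlog v0 : v / 0 <= v.
  move=> H; have [/H//|v0] := leP 0 v.
  by have := H (- v); rewrite sinN !normrN; apply; rewrite oppr_ge0 ltW.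
have := @MVT_norm_le R sin cos 0 v 1 v0 (fun x => is_derive_sin x) (fun x _ => cos_max x).
by rewrite sin0 !subr0 mul1r (ger0_norm v0).
Qed.

Lemma cos_sub1_norm v : `|cos v - 1| <= `|v|.
Proof.
wlog v0 : v / 0 <= v.
  move=> H; have [/H//|v0] := leP 0 v.
  by have := H (- v); rewrite cosN !normrN; apply; rewrite oppr_ge0 ltW.
have := @MVT_norm_le R cos (fun x => - sin x) 0 v 1 v0 (fun x => is_derive_cos x).
rewrite cos0 !subr0 mul1r (ger0_norm v0); apply => x _.
by rewrite normrN sin_max.
Qed.

Lemma cos_sub1_sqr v : `|cos v - 1| <= v ^+ 2.
Proof.
wlog v0 : v / 0 <= v.
  move=> H; have [/H//|v0] := leP 0 v.
  by have := H (- v); rewrite cosN sqrrN; apply; rewrite oppr_ge0 ltW.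
have := @MVT_norm_le R cos (fun x => - sin x) 0 v v v0 (fun x => is_derive_cos x).
rewrite cos0 !subr0 -expr2; apply => x /andP[x0 xv].
by rewrite normrN (le_trans (sin_norm_le x))// ger0_norm.
Qed.

Lemma sin_subx_sqr v : `|sin v - v| <= v ^+ 2.
Proof.
wlog v0 : v / 0 <= v.
  move=> H; have [/H//|v0] := leP 0 v.
  by have := H (- v); rewrite sinN sqrrN -opprD normrN; apply; rewrite oppr_ge0 ltW.
have d (x : R) : is_derive x 1 (fun x => sin x - x : R) (cos x - 1).
  exact: (is_deriveB (is_derive_sin x) (is_derive_id x 1)).
have := @MVT_norm_le R (fun x => sin x - x) (fun x => cos x - 1) 0 v v v0 d.
rewrite sin0 !subr0 -expr2; apply => x /andP[x0 xv].
by rewrite (le_trans (cos_sub1_norm x))// ger0_norm.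
Qed.

Definition cexp z : R[i] :=
  (expR (complex.Re z) * cos (complex.Im z)) +i* (expR (complex.Re z) * sin (complex.Im z)).

Lemma cexpD z w : cexp (z + w) = cexp z * cexp w.
Proof.
apply: complex_eq; rewrite /cexp ?cReM ?cImM /= cReD cImD ?cosD ?sinD expRD; ring.
Qed.

Lemma cexp0 : cexp 0 = 1.
Proof. by rewrite /cexp /= expR0 cos0 sin0 mulr1 mulr0. Qed.

Lemma cn_cexp z : cn (cexp z) = expR (complex.Re z).
Proof.
rewrite /cexp /= !exprMn -mulrDr cos2Dsin2 mulr1 sqrtr_sqr ger0_norm//.
Qed.

Lemma cexpMn z n : cexp (z *+ n) = cexp z ^+ n.
Proof. by elim: n => [|n IH]; rewrite ?mulr0n ?cexp0// mulrS cexpD IH exprS. Qed.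

Lemma cexp_sub1_norm w :
  cn (cexp w - 1) <= 3 * cn w * Num.max 1 (expR (complex.Re w)).
Proof.
have := ler_Re_cn w; have := ler_Im_cn w.
move=> hv hu; apply: (le_trans (ler_cn_ReIm _)); move: hv hu.
rewrite /cexp cReD cImD cReN cImN /=; set u := complex.Re w; set v := complex.Im w.
set c := cn w; set m := Num.max _ _ => hv hu.
have m1 : 1 <= m by rewrite /m le_max lexx.
have me : expR u <= m by rewrite /m le_max lexx orbT.
have c0 : 0 <= c by rewrite /c cn_ge0.
have -> : expR u * cos v - 1 = (expR u - 1) * cos v + (cos v - 1) by ring.
have h1 : `|(expR u - 1) * cos v + (cos v - 1)| <= c * m + c.
  apply: (le_trans (ler_normD _ _)); apply: lerD.
    rewrite normrM -[leRHS]mulr1; apply: ler_pM => //; last exact: cos_max.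
    by apply: (le_trans (expR_sub1_norm u)); rewrite ler_wpM2r// (le_trans _ m1).
  exact: le_trans (cos_sub1_norm v) hv.
have h2 : `|expR u * sin v - 0| <= m * c.
  rewrite subr0 normrM ger0_norm ?expR_ge0//; apply: ler_pM => //.
  exact: le_trans (sin_norm_le v) hv.
by apply: (le_trans (lerD h1 h2)); nra.
Qed.

Lemma cexp_sub1x_norm w :
  cn (cexp w - 1 - w) <= 4 * cn w ^+ 2 * Num.max 1 (expR (complex.Re w)).
Proof.
have := ler_Re_cn w; have := ler_Im_cn w; have := sqr_cn w.
move=> hc hv hu; apply: (le_trans (ler_cn_ReIm _)); move: hc hv hu.
rewrite /cexp !cReD !cImD !cReN !cImN /=; set u := complex.Re w; set v := complex.Im w.
set c := cn w; set m := Num.max _ _ => hc hv hu.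
have m1 : 1 <= m by rewrite /m le_max lexx.
have me : expR u <= m by rewrite /m le_max lexx orbT.
have e0 := expR_ge0 u.
have c0 : 0 <= c by rewrite /c cn_ge0.
have -> : expR u * cos v - 1 - u = (expR u - 1 - u) + expR u * (cos v - 1) by ring.
have -> : expR u * sin v - 0 - v = expR u * (sin v - v) + (expR u - 1) * v by ring.
have h1 : `|(expR u - 1 - u) + expR u * (cos v - 1)| <= u ^+ 2 * m + m * v ^+ 2.
  apply: (le_trans (ler_normD _ _)); apply: lerD; first exact: expR_sub1x_norm.
  by rewrite normrM (ger0_norm e0); apply: ler_pM => //; exact: cos_sub1_sqr.
have h2 : `|expR u * (sin v - v) + (expR u - 1) * v| <= m * v ^+ 2 + c * m * c.
  apply: (le_trans (ler_normD _ _)); rewrite !normrM (ger0_norm e0); apply: lerD.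
    by apply: ler_pM => //; exact: sin_subx_sqr.
  apply: ler_pM => //; apply: (le_trans (expR_sub1_norm u)).
  by rewrite ler_wpM2r// (le_trans _ m1).
apply: (le_trans (lerD h1 h2)).
have : v ^+ 2 <= c ^+ 2 by rewrite hc lerDr sqr_ge0.
have -> : u ^+ 2 * m + m * v ^+ 2 = c ^+ 2 * m by rewrite hc; ring.
have : 0 <= m by lra.
have := sqr_ge0 c; rewrite expr2 => c2 m0 h.
have h3 := ler_wpM2l m0 h.
by nra.
Qed.

Lemma cderivable_cexp s : cderivable cexp s.
Proof.
apply/cderivableP; exists (cexp s) => e e0.
pose k := 4 * cn (cexp s) * expR 1 + 1.
have k0 : 0 < k by rewrite ltr_wpDl// !mulr_ge0// ?cn_ge0 ?expR_ge0.
exists (Num.min 1 (e / k)); first by rewrite lt_min ltr01 divr_gt0.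
move=> z; rewrite lt_min => /andP[z1 z2].
have -> : cexp (s + z) - cexp s - cexp s * z = cexp s * (cexp z - 1 - z).
  by rewrite cexpD; ring.
have c0 := cn_ge0 z; have s0 := cn_ge0 (cexp s).
rewrite cnM; apply: (@le_trans _ _ (cn (cexp s) * (4 * cn z ^+ 2 * expR 1))).
  rewrite ler_wpM2l//; apply: (le_trans (cexp_sub1x_norm z)).
  rewrite ler_wpM2l ?mulr_ge0 ?sqr_ge0// ge_max; apply/andP; split.
    by rewrite -[leLHS]expR0 ler_expR.
  by rewrite ler_expR (le_trans (ler_norm _))// (le_trans (ler_Re_cn _))// ltW.
have -> : cn (cexp s) * (4 * cn z ^+ 2 * expR 1) = (k - 1) * cn z * cn z.
  by rewrite /k; ring.
rewrite ler_wpM2r//; move: z2; rewrite ltr_pdivlMr// => z2.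
by nra.
Qed.

Lemma cpowE (x : R) s : 0 < x -> cpow x s = cexp (s * (ln x)%:C).
Proof.
move=> x0; rewrite /cpow /powR gt_eqF// /cexp cReM cImM /=.
by rewrite !mulr0 subr0 add0r (mulrC (complex.Im s)) mulrC.
Qed.

End ComplexExp.

Section MaximumModulus.
Variable R : realType.

Lemma continuous_epsP (h : R -> R) :
  (forall x e, 0 < e -> exists2 del : R, 0 < del &
     forall x', `|x' - x| < del -> `|h x' - h x| < e) -> continuous h.
Proof.
move=> H x; apply/cvgrPdist_lt => e e0; have [d d0 Hd] := H x e e0.
apply/nbhs_ballP; exists d => //= y; rewrite /ball /= distrC => hy.
by rewrite distrC; exact: Hd.
Qed.

Lemma prim_le (h : R -> R) (a b M : R) : a <= b -> continuous h ->
  (forall x, a <= x <= b -> h x <= M) -> prim h b - prim h a <= M * (b - a).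
Proof.
move=> ab ch hM; have dH := primP ch.
have cH : {within `[a, b], continuous (prim h)}.
  apply: continuous_subspaceT => y; apply: differentiable_continuous.
  by apply/derivable1_diffP; apply: ex_derive.
have [c cab ->] := MVT_segment ab (fun x _ => dH x) cH.
by rewrite ler_wpM2r ?subr_ge0//; apply: hM; move: cab; rewrite in_itv.
Qed.

Lemma prim_ge (h : R -> R) (a b M : R) : a <= b -> continuous h ->
  (forall x, a <= x <= b -> M <= h x) -> M * (b - a) <= prim h b - prim h a.
Proof.
move=> ab ch hM; have dH := primP ch.
have cH : {within `[a, b], continuous (prim h)}.
  apply: continuous_subspaceT => y; apply: differentiable_continuous.
  by apply/derivable1_diffP; apply: ex_derive.
have [c cab ->] := MVT_segment ab (fun x _ => dH x) cH.
by rewrite ler_wpM2r ?subr_ge0//; apply: hM; move: cab; rewrite in_itv.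
Qed.

(* In the coordinate z with s = s0 + e^z, Cauchy's theorem on the rectangle
   [a, b] x [0, 2 pi] says that the mean of f over the circle of radius e^x does
   not depend on x, as the horizontal sides cancel by periodicity. *)
Lemma max_Re_center (f : R[i] -> R[i]) s0 (r r' M : R) : 0 < r < r' ->
  (forall w, cn (w - s0) < r' -> cderivable f w) ->
  (forall y, 0 <= y <= pi *+ 2 -> complex.Re (f (s0 + cexp (ln r +i* y))) <= M) ->
  complex.Re (f s0) <= M.
Proof.
move=> /andP[r0 rr'] df fM.
apply/ler_addgt0Pr => e e0.
have r'0 : 0 < r' by exact: lt_trans rr'.
have [|del del0 fc] := cderivable_continuous (df s0 _) e0; first by rewrite subrr cn0.
pose b := ln r; pose b' := ln ((r + r') / 2).
have bb' : b < b' by rewrite /b /b' ltr_ln ?posrE//; lra.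
(* On the circle of radius [expR a < del] the function is within [e] of [f s0]. *)
pose a := Num.min (ln (del / 2)) (b - 1).
have ab : a <= b by rewrite /a ge_min gerBl ler01 orbT.
have ea : expR a < del.
  apply: (@le_lt_trans _ _ (del / 2)); last by lra.
  by rewrite -[leRHS]lnK ?posrE ?divr_gt0// ler_expR ge_min lexx.
pose G z := f (s0 + cexp z).
have b'r : expR b' < r' by rewrite lnK ?posrE; lra.
have dG z : complex.Re z <= b' -> cderivable G z.
  move=> hz; apply: (@cderivable_comp R f (fun w => s0 + cexp w)).
    by apply: cderivableD; [exact: cderivable_cst|exact: cderivable_cexp].
  by apply: df; rewrite addrC addKr cn_cexp (le_lt_trans _ b'r)// ler_expR.
(* Clamping the abscissa at [b'] makes [g] continuous on the whole plane, as [prim] requires,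
   without changing it on the rectangle. *)
pose g x y := G (Num.min x b' +i* y).
have cg x y e1 : 0 < e1 -> exists2 d : R, 0 < d & forall x' y',
    `|x' - x| < d -> `|y' - y| < d -> cn (g x' y' - g x y) < e1.
  move=> e10; have [|d d0 Hd] := cderivable_continuous (dG (Num.min x b' +i* y) _) e10.
    by rewrite /= ge_min lexx orbT.
  exists (d / 2) => [|x' y' hx hy]; first by rewrite divr_gt0.
  apply: Hd; apply: (le_lt_trans (ler_cn_ReIm _)) => /=.
  have : `|Num.min x' b' - Num.min x b'| <= `|x' - x|.
    by rewrite /Num.min; do 2 case: ifPn; rewrite -?leNgt => h1 h2;
      rewrite ler_norml ?subrr ?normr0; apply/andP; split; move: hx;
      rewrite ?ltr_norml => /andP[hx1 hx2]; have := ler_norm (x' - x);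
      have := ler_norm (-(x' - x)); rewrite normrN; lra.
  by lra.
pose P x y := complex.Im (g x y); pose Q x y := complex.Re (g x y).
have cP y : continuous (P^~ y).
  apply: continuous_epsP => x e1 e10; have [d d0 Hd] := cg x y e1 e10.
  exists d => // x' hx; rewrite /P -cImN -cImD.
  by apply: (le_lt_trans (ler_Im_cn _)); apply: Hd => //; rewrite subrr normr0.
have cQ x : continuous (Q x).
  apply: continuous_epsP => y e1 e10; have [d d0 Hd] := cg x y e1 e10.
  exists d => // y' hy; rewrite /Q -cReN -cReD.
  by apply: (le_lt_trans (ler_Re_cn _)); apply: Hd => //; rewrite subrr normr0.
have w0 : 0 <= b - a by rewrite subr_ge0.
have p0 : 0 <= pi *+ 2 :> R by rewrite mulrn_wge0// pi_ge0.
have := @goursat_rect R P Q cP cQ a 0 (b - a) (pi *+ 2) w0 p0.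
have cl : forall x y, a <= x <= a + (b - a) -> 0 <= y <= 0 + pi *+ 2 -> closed_at P Q x y.
  move=> x y /andP[_ xb] _; have {}xb : x <= b by lra.
  have xb' : Num.min x b' = x by apply/min_idPl; lra.
  have /cderivableP[d Hd] := dG (x +i* y) (le_trans xb (ltW bb')).
  exists (complex.Im d), (complex.Re d), (- complex.Im d) => e1 e10.
  have [d1 d10 Hd1] := Hd e1 e10.
  exists (Num.min (d1 / 2) (b' - b)); first by rewrite lt_min divr_gt0//= subr_gt0.
  move=> x' y'; rewrite !lt_min => /andP[hx1 hx2] /andP[hy1 _].
  have xb1' : Num.min x' b' = x'.
    by apply/min_idPl; move: hx2; rewrite ltr_norml => /andP[? ?]; lra.
  rewrite /P /Q /g xb' xb1'.
  pose z := (x' - x) +i* (y' - y).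
  have -> : x' +i* y' = (x +i* y) + z by apply: complex_eq; rewrite ?cReD ?cImD /=; ring.
  have zz : cn z <= `|x' - x| + `|y' - y| by exact: ler_cn_ReIm.
  have zd : cn z < d1 by lra.
  have {Hd1} := Hd1 _ zd; set D := G _ - _ - _ => HD.
  have {}HD : cn D <= e1 * (`|x' - x| + `|y' - y|).
    by apply: (le_trans HD); rewrite ler_wpM2l// ltW.
  split.
    have -> : complex.Im (G (x +i* y + z)) - complex.Im (G (x +i* y)) -
      complex.Im d * (x' - x) - complex.Re d * (y' - y) = complex.Im D.
      by rewrite /D !cImD !cImN cImM /=; ring.
    exact: le_trans (ler_Im_cn _) HD.
  have -> : complex.Re (G (x +i* y + z)) - complex.Re (G (x +i* y)) -
      complex.Re d * (x' - x) - - complex.Im d * (y' - y) = complex.Re D.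
    by rewrite /D !cReD !cReN cReM /=; ring.
  exact: le_trans (ler_Re_cn _) HD.
move=> /(_ cl) {cl}; rewrite /rect_int.
have -> : P^~ (0 + pi *+ 2) = P^~ 0.
  apply/funext => x; rewrite /P /g /G; congr (complex.Im (f (s0 + _))).
  by rewrite /cexp /= cosD2pi sinD2pi.
rewrite addrC subrr add0r !(addrC a) subrK addrC => J.
have gb : prim (Q b) (0 + pi *+ 2) - prim (Q b) 0 <= M * (0 + pi *+ 2 - 0).
  apply: prim_le => //; first by rewrite add0r.
  by move=> y hy; rewrite /Q /g /G (min_idPl (ltW bb')); apply: fM; rewrite -[pi *+ 2]add0r.
have ga : (complex.Re (f s0) - e) * (0 + pi *+ 2 - 0) <=
   prim (Q a) (0 + pi *+ 2) - prim (Q a) 0.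
  apply: prim_ge => //; first by rewrite add0r.
  move=> y _; have := fc (s0 + cexp (Num.min a b' +i* y)).
  rewrite addrC addKr cn_cexp /= (min_idPl (le_trans ab (ltW bb'))) => /(_ ea) h.
  have := le_lt_trans (ler_Re_cn _) h; rewrite cReD cReN ltr_norml /Q /g /G addrC => /andP[h1 _].
  by rewrite (min_idPl (le_trans ab (ltW bb'))); lra.
have pp : 0 < 0 + pi *+ 2 - 0 :> R by rewrite add0r subr0 mulrn_wgt0// pi_gt0.
rewrite !(add0r, subr0) in J gb ga pp.
have : (complex.Re (f s0) - e) * (pi *+ 2) <= M * (pi *+ 2).
  by apply: (le_trans ga); apply: le_trans gb; lra.
by rewrite ler_pM2r// lerBlDr.
Qed.

(** Multiplying [f] by a unimodular constant makes its value at the centre real and positive, which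
    reduces moduli to real parts. *)
Lemma max_modulus_circle (f : R[i] -> R[i]) s0 (r r' M : R) : 0 < r < r' ->
  (forall w, cn (w - s0) < r' -> cderivable f w) ->
  (forall y, 0 <= y <= pi *+ 2 -> cn (f (s0 + cexp (ln r +i* y))) <= M) ->
  cn (f s0) <= M.
Proof.
move=> rr' df fM; have [r0 _] := andP rr'.
have M0 : 0 <= M.
  apply: le_trans (fM 0 _); first exact: cn_ge0.
  by rewrite lexx mulrn_wge0// pi_ge0.
have [f0|f0] := eqVneq (f s0) 0; first by rewrite f0 cn0.
pose u := conjc (f s0) * ((cn (f s0))^-1)%:C.
have n0 : 0 < cn (f s0) by rewrite cn_gt0.
have u1 : cn u = 1.
  by rewrite cnM conjc_cn cn_real ger0_norm ?invr_ge0 ?cn_ge0// divff// gt_eqF.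
have := @max_Re_center (fun w => u * f w) s0 r r' M rr'.
have -> : complex.Re (u * f s0) = cn (f s0).
  have -> : u * f s0 = (cn (f s0))%:C.
    rewrite /u mulrAC [conjc _ * _]mulrC mulr_conjc -rmorphM /=; congr (_%:C).
    by rewrite expr2 mulfK// gt_eqF.
  by [].
apply.
  by move=> w hw; apply: cderivableM; [exact: cderivable_cst|exact: df].
move=> y /fM h; apply: (le_trans (ler_norm _)); apply: (le_trans (ler_Re_cn _)).
by rewrite cnM u1 mul1r.
Qed.

Lemma max_modulus_center (f : R[i] -> R[i]) s0 (r r' M : R) : 0 < r < r' ->
  (forall w, cn (w - s0) < r' -> cderivable f w) ->
  (forall w, cn (w - s0) = r -> cn (f w) <= M) ->
  cn (f s0) <= M.
Proof.
move=> rr' df fM; apply: (max_modulus_circle rr' df) => y _; apply: fM.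
by rewrite addrC addKr cn_cexp lnK// posrE; case/andP: rr'.
Qed.

Lemma circle_bounded (f : R[i] -> R[i]) s0 (r r' : R) : 0 < r < r' ->
  (forall w, cn (w - s0) < r' -> cderivable f w) ->
  exists M, forall y, 0 <= y <= pi *+ 2 -> cn (f (s0 + cexp (ln r +i* y))) <= M.
Proof.
move=> /andP[r0 rr'] df.
pose h (y : R) := cn (f (s0 + cexp (ln r +i* y))).
have ch : continuous h.
  apply: continuous_epsP => x e e0.
  have dG : cderivable (fun z => f (s0 + cexp z)) (ln r +i* x).
    apply: (@cderivable_comp R f (fun w => s0 + cexp w)).
      by apply: cderivableD; [exact: cderivable_cst|exact: cderivable_cexp].
    by apply: df; rewrite addrC addKr cn_cexp lnK ?posrE.
  have [d d0 Hd] := cderivable_continuous dG e0.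
  exists d => // x' hx.
  have /Hd h1 : cn ((ln r +i* x') - (ln r +i* x)) < d.
    by apply: le_lt_trans (ler_cn_ReIm _) _; rewrite /= subrr normr0 add0r.
  apply: le_lt_trans h1; rewrite ler_norml /h; apply/andP; split; last exact: cnBl.
  by rewrite lerNl opprB cn_sym cnBl.
have p0 : 0 <= pi *+ 2 :> R by rewrite mulrn_wge0// pi_ge0.
have [c _ Hc] := @EVT_max R h 0 (pi *+ 2) p0 (continuous_subspaceT ch).
by exists (h c) => y hy; apply: Hc; rewrite in_itv.
Qed.

End MaximumModulus.

(** * Limits of holomorphic functions and the identity theorem *)

Section Consequences.
Variable R : realType.

(** Passing to [n]-th powers makes constant factors irrelevant: were [y < x], the ratio
    [(y / x) ^ n] would tend to 0. The next applications of the maximum principle rest on this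
    device. *)
Lemma geometric_le (c d x y : R) : 0 < c -> 0 <= y ->
  (forall n, c * x ^+ n <= d * y ^+ n) -> x <= y.
Proof.
move=> c0 y0 H; rewrite leNgt; apply/negP => yx.
have x0 : 0 < x by exact: le_lt_trans yx.
have d0 : 0 < d.
  by have := H 0%N; rewrite !expr0 !mulr1; exact: lt_le_trans.
have q0 : 0 <= y / x by rewrite divr_ge0// ltW.
have q1 : `|y / x| < 1 by rewrite ger0_norm// ltr_pdivrMr// mul1r.
have /cvgrPdist_lt/(_ (c / d)) := cvg_expr q1.
rewrite divr_gt0// => /(_ isT)[n _ /(_ n (leqnn _))] /=.
rewrite sub0r normrN ger0_norm ?exprn_ge0// expr_div_n ltr_pdivrMr ?exprn_gt0//.
rewrite mulrAC ltr_pdivlMr// mulrC => h.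
by have := lt_le_trans h (H n); rewrite ltxx.
Qed.

Definition ccont (q : R[i] -> R[i]) p := forall e : R, 0 < e ->
  exists2 del : R, 0 < del & forall w, cn (w - p) < del -> cn (q w - q p) < e.

Lemma ccontM q1 q2 p : ccont q1 p -> ccont q2 p -> ccont (fun w => q1 w * q2 w) p.
Proof.
move=> h1 h2 e e0.
pose k := cn (q1 p) + cn (q2 p) + 1.
have n1 := cn_ge0 (q1 p); have n2 := cn_ge0 (q2 p).
have k0 : 0 < k by rewrite /k; lra.
pose e1 := Num.min 1 (e / (k + 1)).
have e10 : 0 < e1 by rewrite lt_min ltr01 divr_gt0//; lra.
have [d1 d10 H1] := h1 _ e10; have [d2 d20 H2] := h2 _ e10.
exists (Num.min d1 d2); first by rewrite lt_min d10.
move=> w; rewrite lt_min => /andP[/H1 g1 /H2 g2].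
have -> : q1 w * q2 w - q1 p * q2 p = (q1 w - q1 p) * (q2 w - q2 p)
   + ((q1 w - q1 p) * q2 p + q1 p * (q2 w - q2 p)) by ring.
apply: (le_lt_trans (cnD _ _)); apply: (@le_lt_trans _ _ (e1 * 1 + (e1 * cn (q2 p) + cn (q1 p) * e1))).
  apply: lerD.
    rewrite cnM; apply: ler_pM; rewrite ?cn_ge0// ?(ltW g1)//.
    by apply: (le_trans (ltW g2)); rewrite /e1 ge_min lexx.
  apply: (le_trans (cnD _ _)); rewrite !cnM; apply: lerD.
    by rewrite ler_wpM2r// ltW.
  by rewrite ler_wpM2l// ltW.
have -> : e1 * 1 + (e1 * cn (q2 p) + cn (q1 p) * e1) = e1 * k by rewrite /k; ring.
apply: (@le_lt_trans _ _ (e / (k + 1) * k)).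
  by rewrite ler_wpM2r ?(ltW k0)// /e1 ge_min lexx orbT.
by rewrite mulrAC ltr_pdivrMr ?ltr_pM2l//; lra.
Qed.

Lemma ccontX q p n : ccont q p -> ccont (fun w => q w ^+ n) p.
Proof.
move=> h; elim: n => [|n IH].
  by move=> e e0; exists 1 => // w _; rewrite !expr0 subrr cn0.
move=> e e0; have [d d0 Hd] := ccontM h IH e0.
by exists d => // w /Hd; rewrite !exprS.
Qed.

(** The difference quotient at the root is [q] itself, so continuity of [q] suffices. *)
Lemma cderivable_mul_root q p : ccont q p -> cderivable (fun w => (w - p) * q w) p.
Proof.
move=> h; apply/cderivableP; exists (q p) => e e0; have [d d0 Hd] := h _ e0.
exists d => // z hz; have /Hd/ltW h1 : cn (p + z - p) < d by rewrite addrC addKr.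
have -> : (p + z - p) * q (p + z) - (p - p) * q p - q p * z = (q (p + z) - q p) * z by ring.
by rewrite cnM ler_wpM2r// cn_ge0.
Qed.

(* The functions (w - p) q(w)^n are differentiable at p too; their moduli give
   the bound for q as n goes to infinity. *)
Lemma max_modulus_exceptional q p z (r r' M : R) : 0 < r < r' -> z != p ->
  ccont q p -> (forall w, cn (w - z) < r' -> w != p -> cderivable q w) ->
  (forall w, cn (w - z) = r -> cn (q w) <= M) -> cn (q z) <= M.
Proof.
move=> rr' zp qp dq qM; have [r0 _] := andP rr'.
have M0 : 0 <= M.
  apply: le_trans (qM (z + r%:C) _); first exact: cn_ge0.
  by rewrite addrC addKr cn_real gtr0_norm.
apply: (@geometric_le (cn (z - p)) (r + cn (z - p))) => //.
  by rewrite cn_gt0 subr_eq0.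
move=> n; rewrite -cnX -cnM.
apply: (@max_modulus_center R (fun w => (w - p) * q w ^+ n) z r r') => //.
  move=> w hw; have [->|wp] := eqVneq w p.
    exact: cderivable_mul_root (ccontX n qp).
  apply: cderivableM; last by apply: cderivableX; exact: dq.
  exact: cderivableB (cderivable_id _) (cderivable_cst _ _).
move=> w hw; rewrite cnM cnX; apply: ler_pM; rewrite ?cn_ge0 ?exprn_ge0 ?cn_ge0//.
  have -> : w - p = (w - z) + (z - p) by ring.
  by apply: (le_trans (cnD _ _)); rewrite hw.
by apply: lerXn2r; rewrite ?nnegrE ?cn_ge0//; exact: qM.
Qed.

(** Every [x n - c n] lies below every [x m + c m]; the supremum of the former is a limit with
    explicit rate once [c] tends to 0. *)
Lemma real_limit (x c : nat -> R) : (forall n m, x n - x m <= c n + c m) ->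
  exists l, forall n, `|x n - l| <= c n.
Proof.
move=> H; pose S := range (fun n => x n - c n); exists (sup S) => n.
have ub m : ubound S (x m + c m).
  by move=> _ [k _ <-]; have := H k m; lra.
have h1 : x n - c n <= sup S.
  by apply: ub_le_sup; [exists (x 0%N + c 0%N); exact: ub|exists n].
have h2 : sup S <= x n + c n.
  by apply: ge_sup; [exists (x 0%N - c 0%N), 0%N|exact: ub].
by rewrite ler_norml; apply/andP; split; lra.
Qed.

Lemma complex_limit (x : nat -> R[i]) (c : nat -> R) :
  (forall n m, cn (x n - x m) <= c n + c m) ->
  exists l, forall n, cn (x n - l) <= 2 * c n.
Proof.
move=> H.
have [n m|a Ha] := @real_limit (fun n => complex.Re (x n)) c.
  apply: le_trans (H n m); rewrite -cReN -cReD.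
  exact: le_trans (ler_norm _) (ler_Re_cn _).
have [n m|b Hb] := @real_limit (fun n => complex.Im (x n)) c.
  apply: le_trans (H n m); rewrite -cImN -cImD.
  exact: le_trans (ler_norm _) (ler_Im_cn _).
exists (a +i* b) => n; apply: (le_trans (ler_cn_ReIm _)).
rewrite cReD cImD cReN cImN /=; have := Ha n; have := Hb n; lra.
Qed.

(** A substitute for Cauchy's estimate. The difference quotient, extended by [d] at 0, is continuous
    there and holomorphic elsewhere, so the maximum principle with one exceptional point applies on
    the circle of radius [r / 2] about [z]. On it the increment has modulus at least [r / 4], whence
    [2 * e / (r / 4)]. *)
Lemma diff_quotient_bound (D : R[i] -> R[i]) d s0 (r e : R) : 0 < r ->
  (forall w, cn (w - s0) < r -> cderivable D w) ->
  (forall w, cn (w - s0) < r -> cn (D w) <= e) ->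
  (forall e1, 0 < e1 -> exists2 del : R, 0 < del &
    forall z, cn z < del -> cn (D (s0 + z) - D s0 - d * z) <= e1 * cn z) ->
  (forall z, z != 0 -> cn z < r / 4 -> cn (D (s0 + z) - D s0) <= 8 * e / r * cn z) /\
  cn d <= 8 * e / r.
Proof.
move=> r0 dD De Hd.
pose q z := if z == 0 then d else (D (s0 + z) - D s0) / z.
have e0 : 0 <= e.
  by apply: le_trans (De s0 _); [exact: cn_ge0|rewrite subrr cn0].
have qc : ccont q 0.
  move=> e1 e10; have [|del del0 H] := Hd (e1 / 2); first by rewrite divr_gt0.
  exists del => // w; rewrite subr0 => hw; rewrite /q eqxx.
  case: eqP => [_|/eqP w0]; first by rewrite subrr cn0.
  have -> : (D (s0 + w) - D s0) / w - d = (D (s0 + w) - D s0 - d * w) / w.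
    by rewrite [RHS]mulrBl mulfK.
  rewrite cnM cnV; apply: (@le_lt_trans _ _ (e1 / 2)); last by lra.
  by rewrite ler_pdivrMr ?cn_gt0//; exact: H.
have qd w : w != 0 -> cn w < r -> cderivable q w.
  move=> w0 wr.
  apply: (@cderivable_near R (fun z => (D (s0 + z) - D s0) / z) q w (cn w)).
  - by rewrite cn_gt0.
  - move=> z hz; rewrite /q; case: eqP => // z0.
    by move: hz; rewrite z0 sub0r cnN ltxx.
  - apply: cderivableM; last by apply: cderivableV => //; exact: cderivable_id.
    apply: cderivableB; last exact: cderivable_cst.
    by apply: cderivable_shift; apply: dD; rewrite addrC addKr.
have key z : z != 0 -> cn z < r / 4 -> cn (q z) <= 8 * e / r.
  move=> z0 zr; apply: (@max_modulus_exceptional q 0 z (r / 2) (3 * r / 4)) => //.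
  - by apply/andP; split; lra.
  - move=> w hw w0; apply: qd => //.
    have := cnBl w z; lra.
  - move=> w hw; have := cnB w z; have := cnBl w z; rewrite hw => g1 g2.
    have w1 : r / 4 <= cn w by lra.
    have w0 : w != 0 by rewrite -cn_gt0; lra.
    rewrite /q (negbTE w0) cnM cnV.
    have e4 : 8 * e / r = 2 * e * (r / 4)^-1 by field; lra.
    rewrite e4; apply: ler_pM; rewrite ?cn_ge0 ?invr_ge0 ?cn_ge0//.
      have := cnB (D (s0 + w)) (D s0).
      have wr : cn (s0 + w - s0) < r by rewrite addrC addKr; lra.
      have := De _ wr; have := De s0; rewrite subrr cn0 => /(_ r0); lra.
    by rewrite lef_pV2 ?posrE//; lra.
split.
  move=> z z0 /(key z z0); rewrite /q (negbTE z0) cnM cnV ler_pdivrMr// cn_gt0//.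
apply/ler_addgt0Pr => e1 e10; have [del del0 H] := qc _ e10.
pose t := Num.min (del / 2) (r / 8).
have t0 : 0 < t by rewrite lt_min !divr_gt0.
have ct : cn t%:C = t by rewrite cn_real gtr0_norm.
have tz : t%:C != 0 by rewrite -cn_gt0 ct.
have t1 : t <= del / 2 by rewrite /t ge_min lexx.
have t2 : t <= r / 8 by rewrite /t ge_min lexx orbT.
have h1 : cn (q t%:C) <= 8 * e / r by apply: key => //; rewrite ct; lra.
have h2 : cn (q t%:C - q 0) < e1 by apply: H; rewrite subr0 ct; lra.
have -> : d = q 0 by rewrite /q eqxx.
by have := cnBl (q 0) (q t%:C); rewrite cn_sym; lra.
Qed.

(** Applied to differences of approximants, the bound on difference quotients makes their
    derivatives at [s0] a Cauchy sequence and controls their quotients uniformly in the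
    increment. *)
Lemma weierstrass (f : R[i] -> R[i]) s0 (r : R) : 0 < r ->
  (forall e, 0 < e -> exists2 F : R[i] -> R[i],
     (forall w, cn (w - s0) < r -> cderivable F w) &
     (forall w, cn (w - s0) < r -> cn (F w - f w) <= e)) ->
  cderivable f s0.
Proof.
move=> r0 H; have s0r : cn (s0 - s0) < r by rewrite subrr cn0.
have H' n : exists Fd : (R[i] -> R[i]) * R[i],
  [/\ (forall w, cn (w - s0) < r -> cderivable Fd.1 w),
      (forall w, cn (w - s0) < r -> cn (Fd.1 w - f w) <= n.+1%:R^-1) &
      (forall e1, 0 < e1 -> exists2 del : R, 0 < del &
    forall z, cn z < del -> cn (Fd.1 (s0 + z) - Fd.1 s0 - Fd.2 * z) <= e1 * cn z)].
  have [|F F1 F2] := H (n.+1%:R^-1); first by rewrite invr_gt0.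
  by have /cderivableP[d Hd] := F1 s0 s0r; exists (F, d).
have [Fd HFd] := choice H' => {H H'}.
pose F n := (Fd n).1; pose d n := (Fd n).2; pose c n : R := 8 / r * n.+1%:R^-1.
have cmp n m := @diff_quotient_bound (fun w => F n w - F m w) (d n - d m) s0 r
    (n.+1%:R^-1 + m.+1%:R^-1) r0.
have cmp1 n m : (forall z, z != 0 -> cn z < r / 4 ->
    cn ((F n (s0 + z) - F m (s0 + z)) - (F n s0 - F m s0)) <= (c n + c m) * cn z) /\
    cn (d n - d m) <= c n + c m.
  have -> : c n + c m = 8 * (n.+1%:R^-1 + m.+1%:R^-1) / r by rewrite /c; ring.
  have [a1 a2 a3] := HFd n; have [b1 b2 b3] := HFd m.
  apply: cmp.
  - by move=> w hw; apply: cderivableB; [exact: a1|exact: b1].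
  - move=> w hw; have -> : F n w - F m w = (F n w - f w) - (F m w - f w) by ring.
    by apply: (le_trans (cnB _ _)); apply: lerD; [exact: a2|exact: b2].
  - move=> e1 e10; have [|d1 d10 D1] := a3 (e1 / 2); first by rewrite divr_gt0.
    have [|d2 d20 D2] := b3 (e1 / 2); first by rewrite divr_gt0.
    exists (Num.min d1 d2); first by rewrite lt_min d10.
    move=> z; rewrite lt_min => /andP[/D1 g1 /D2 g2].
    have -> : F n (s0 + z) - F m (s0 + z) - (F n s0 - F m s0) - (d n - d m) * z =
      (F n (s0 + z) - F n s0 - d n * z) - (F m (s0 + z) - F m s0 - d m * z) by ring.
    apply: (le_trans (cnB _ _)); apply: (le_trans (lerD g1 g2)).
    by rewrite -mulrDl -splitr.
have [l Hl] := @complex_limit d c (fun n m => (cmp1 n m).2).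
have c_small (e : R) : 0 < e -> exists n, c n <= e.
  move=> e0; exists (Num.bound (8 / r / e)).
  rewrite /c ler_pdivrMr ?ltr0Sn// [leRHS]mulrC -ler_pdivrMr//.
  apply: ltW; apply: (lt_trans (archi_boundP _)); last by rewrite ltr_nat.
  by rewrite !divr_ge0// ltW.
apply/cderivableP; exists l => e e0.
have [n Hn] := c_small (e / 8) ltac:(by rewrite divr_gt0).
have [a1 a2 a3] := HFd n.
have [|d1 d10 D1] := a3 (e / 4); first by rewrite divr_gt0.
exists (Num.min d1 (r / 4)); first by rewrite lt_min d10 divr_gt0.
move=> z; rewrite lt_min => /andP[zd zr].
have [->|z0] := eqVneq z 0; first by rewrite addr0 subrr mulr0 subr0 cn0 mulr0.
have zp : 0 < cn z by rewrite cn_gt0.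
have szr : cn (s0 + z - s0) < r by rewrite addrC addKr; lra.
(* [m] depends on [z]: exchanging [f] for [F m] must cost only a fraction of [e * cn z]. *)
have [m Hm] := c_small (Num.min (e / 8) (e / 8 * cn z * (8 / r))) ltac:(by
  rewrite lt_min !(divr_gt0, mulr_gt0, e0)).
move: Hm; rewrite le_min => /andP[Hm1 Hm2].
have em : m.+1%:R^-1 <= e / 8 * cn z.
  have k0 : 0 < 8 / r by rewrite divr_gt0.
  by move: Hm2; rewrite /c [leRHS]mulrC ler_pM2l.
have [b1 b2 b3] := HFd m.
have -> : f (s0 + z) - f s0 - l * z =
   (F n (s0 + z) - F n s0 - d n * z) + (d n - l) * z
   - ((F n (s0 + z) - F m (s0 + z)) - (F n s0 - F m s0))
   - (F m (s0 + z) - f (s0 + z)) + (F m s0 - f s0) by ring.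
have g1 := D1 z zd; rewrite -/(F n) -/(d n) in g1.
have g2 : cn ((d n - l) * z) <= 2 * c n * cn z by rewrite cnM ler_wpM2r ?cn_ge0.
have g3 := (cmp1 n m).1 z z0 zr.
have g4 := le_trans (b2 _ szr) em; have g5 := le_trans (b2 _ s0r) em.
rewrite -/(F m) in g4 g5.
apply: (le_trans (cnD _ _)); apply: (le_trans (lerD (cnB _ _) g5)).
apply: (le_trans (lerD (lerD (cnB _ _) g4) (lexx _))).
apply: (le_trans (lerD (lerD (lerD (cnD _ _) g3) (lexx _)) (lexx _))).
apply: (le_trans (lerD (lerD (lerD (lerD g1 g2) (lexx _)) (lexx _)) (lexx _))).
have : c n * cn z <= e / 8 * cn z by rewrite ler_wpM2r// ltW.
have : c m * cn z <= e / 8 * cn z by rewrite ler_wpM2r// ltW.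
by lra.
Qed.

(** As [D] vanishes near [s1], every [D w / (w - s1) ^ n] is holomorphic. On the circle of radius
    [5 / 2 * t] about [s] the distance to [s1] is at least [3 / 2 * t], while at [s] it is [t]; for
    large [n] a nonzero [D s] would violate the maximum principle. *)
Lemma identity_ball (D : R[i] -> R[i]) s1 (rho r : R) : 0 < rho ->
  (forall w, cn (w - s1) < r -> cderivable D w) ->
  (forall w, cn (w - s1) < rho -> D w = 0) ->
  forall s, cn (s - s1) < r / 4 -> D s = 0.
Proof.
move=> rho0 dD D0 s hs; have [ss1|ss1] := eqVneq s s1.
  by apply: D0; rewrite ss1 subrr cn0.
set t := cn (s - s1) in hs.
have t0 : 0 < t by rewrite cn_gt0 subr_eq0.
have circ : 0 < 5 / 2 * t < 3 * t by apply/andP; split; lra.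
have dDs w : cn (w - s) < 3 * t -> cderivable D w.
  move=> hw; apply: dD; have -> : w - s1 = (w - s) + (s - s1) by ring.
  by apply: (le_lt_trans (cnD _ _)); rewrite -/t; lra.
have [M HM] := circle_bounded circ dDs.
have M0 : 0 <= M.
  apply: le_trans (HM 0 _); first exact: cn_ge0.
  by rewrite lexx mulrn_wge0// pi_ge0.
apply/eqP; rewrite -cn_eq0 -normr_le0 ger0_norm ?cn_ge0// leNgt; apply/negP => Ds.
have : t^-1 <= (3 / 2 * t)^-1.
  apply: (@geometric_le (cn (D s)) M) => //; first by rewrite invr_ge0; lra.
  move=> n; rewrite -cnV -cnX -cnM.
  apply: (@max_modulus_circle R (fun w => D w * (w - s1)^-1 ^+ n) s _ _ _ circ).
    move=> w hw; have [ws|ws] := eqVneq w s1.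
      apply: (@cderivable_near R (fun=> 0) _ w rho) => //; last exact: cderivable_cst.
      by move=> z hz; rewrite D0 ?mul0r// -ws.
    apply: cderivableM; first exact: dDs.
    apply: cderivableX; apply: cderivableV; first by rewrite subr_eq0.
    exact: cderivableB (cderivable_id _) (cderivable_cst _ _).
  move=> y hy; set w := s + _; rewrite cnM cnX cnV; apply: ler_pM => //.
  - exact: cn_ge0.
  - by rewrite exprn_ge0// invr_ge0 cn_ge0.
  - exact: HM.
  - apply: lerXn2r; rewrite ?nnegrE ?invr_ge0 ?cn_ge0//; first by lra.
    have wz : cn (w - s) = 5 / 2 * t by rewrite /w addrC addKr cn_cexp lnK// posrE; lra.
    have h : 3 / 2 * t <= cn (w - s1).
      have -> : w - s1 = (w - s) + (s - s1) by ring.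
      by apply: le_trans (cnDl _ _); rewrite wz -/t; lra.
    by rewrite lef_pV2 ?posrE//; lra.
by rewrite lef_pV2 ?posrE//; lra.
Qed.

(** A nonreal point is reached along a horizontal line from the half-plane where [D] is known to
    vanish, by discs of radius [r / 4] whose centres move by at most [r / 8]; the discs of radius
    [r] avoid the real axis, hence the point 1. Real points follow by continuity. *)
Lemma identity_half_plane (D : R[i] -> R[i]) (theta : R) : theta < 1 ->
  (forall s, theta < complex.Re s -> s != 1 -> cderivable D s) ->
  (forall s, 1 < complex.Re s -> D s = 0) ->
  forall s, theta < complex.Re s -> s != 1 -> D s = 0.
Proof.
move=> th1 dD D0.
have nonreal s : theta < complex.Re s -> complex.Im s != 0 -> D s = 0.
  move=> hs hi.
  have [h1|h1] := ltP 1 (complex.Re s); first exact: D0.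
  pose r := Num.min (complex.Re s - theta) `|complex.Im s|.
  have r0 : 0 < r by rewrite lt_min subr_gt0 hs normr_gt0.
  have rs : r <= complex.Re s - theta by rewrite /r ge_min lexx.
  have ri : r <= `|complex.Im s| by rewrite /r ge_min lexx orbT.
  pose p (x : R) := x +i* complex.Im s.
  have dp x : complex.Re s <= x -> forall w, cn (w - p x) < r -> cderivable D w.
    move=> hx w hw; apply: dD.
      have := le_lt_trans (ler_Re_cn _) hw; rewrite cReD cReN /= ltr_norml => /andP[? _].
      lra.
    apply: contraTneq hw => ->; rewrite -leNgt; apply: (le_trans ri).
    by rewrite -normrN -[- _]/(complex.Im (- p x)) -[X in `|X|]add0r -[0]/(complex.Im (1 : R[i])) -cImD; exact: ler_Im_cn.
  have key n : forall w, cn (w - p (Num.max (complex.Re s) (2 - n%:R * (r / 8)))) < r / 4 -> D w = 0.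
    elim: n => [|n IH].
      move=> w; rewrite mul0r subr0 => hw.
      pose x := Num.max (complex.Re s) 2.
      have hx : complex.Re s <= x by rewrite le_max lexx.
      have x2 : 2 <= x by rewrite le_max lexx orbT.
      apply: (@identity_ball D (p x) 1 r ltr01 (dp _ hx)) => // w' hw'.
      apply: D0; have := le_lt_trans (ler_Re_cn _) hw'.
      by rewrite cReD cReN /= ltr_norml => /andP[? _]; lra.
    set x := Num.max _ _ in IH; move=> w; set x' := Num.max _ _ => hw.
    have hx' : complex.Re s <= x' by rewrite le_max lexx.
    apply: (@identity_ball D (p x') (r / 8) r _ (dp _ hx')) => //.
      by rewrite divr_gt0.
    move=> w' hw'; apply: IH.
    have -> : w' - p x = (w' - p x') + (x' - x)%:C.
      by rewrite /p; apply: complex_eq; rewrite !(cReD, cImD, cReN, cImN) /=; ring.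
    apply: (le_lt_trans (cnD _ _)); rewrite cn_real.
    suff : `|x' - x| <= r / 8 by lra.
    rewrite /x /x' -natr1 /Num.max; do 2 case: ifPn; rewrite -?leNgt => g1 g2;
      rewrite ler_norml; apply/andP; split; lra.
  have [n Hn] : exists n, 2 - n%:R * (r / 8) <= complex.Re s.
    exists (Num.bound (`|2 - complex.Re s| / (r / 8))).
    have := archi_boundP (x := `|2 - complex.Re s| / (r / 8)).
    rewrite divr_ge0 ?(divr_ge0, ltW r0)// => /(_ isT).
    rewrite ltr_pdivrMr ?divr_gt0// => h.
    have := ler_norm (2 - complex.Re s); lra.
  apply: (key n); rewrite (max_idPl Hn).
  have -> : p (complex.Re s) = s by apply: complex_eq.
  by rewrite subrr cn0 divr_gt0.
move=> s hs s1; have [i0|/nonreal] := eqVneq (complex.Im s) 0; last exact.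
apply/eqP; rewrite -cn_eq0 -normr_le0 ger0_norm ?cn_ge0//.
apply/ler_addgt0Pr => e e0; rewrite add0r.
have [d d0 Hd] := cderivable_continuous (dD s hs s1) e0.
have /Hd : cn (s + 0 +i* (d / 2) - s) < d.
  rewrite addrC addKr; apply: (le_lt_trans (ler_cn_ReIm _)) => /=.
  by rewrite normr0 add0r gtr0_norm; lra.
rewrite [D (s + _)]nonreal; first by rewrite sub0r cnN => /ltW.
  by rewrite cReD /= addr0.
by rewrite cImD /= i0 add0r; lra.
Qed.

End Consequences.

(** * Jensen's inequality *)

Section Jensen.
Variable R : realType.

(** The condition under the supremum in [vanishing_order], with a real radius. *)
Definition vanishes_to (f : R[i] -> R[i]) rho m := exists (e : R) (g : R[i] -> R[i]),
  0 < e /\ forall w, cn (w - rho) < e -> cderivable g w /\ f w = (w - rho) ^+ m * g w.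

Lemma vanishes_toM f h rho m (e : R) : 0 < e ->
  (forall w, cn (w - rho) < e -> cderivable h w) ->
  vanishes_to f rho m -> vanishes_to (fun w => f w * h w) rho m.
Proof.
move=> e0 dh [e1 [g [e10 H]]]; exists (Num.min e e1), (fun w => g w * h w).
split; first by rewrite lt_min e0.
move=> w; rewrite lt_min => /andP[/dh hw /H[gw ->]].
by rewrite mulrA; split; [exact (cderivableM gw hw)|].
Qed.

Lemma vanishes_to_near f f' rho m (e : R) : 0 < e ->
  (forall w, cn (w - rho) < e -> f w = f' w) ->
  vanishes_to f rho m -> vanishes_to f' rho m.
Proof.
move=> e0 ff' [e1 [g [e10 H]]]; exists (Num.min e e1), g.
split; first by rewrite lt_min e0.
by move=> w; rewrite lt_min => /andP[/ff' <- /H].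
Qed.

(** A factor [(w - rho) ^ m] is replaced by [B w ^ m], which has the same modulus on the circle of
    radius [r] and modulus [r ^ m] at the centre, so [cn (f s0)] is multiplied by
    [(r / cn (rho - s0)) ^ m]. Zeros are removed one at a time, the vanishing at the others being
    preserved. *)
Lemma blaschke_division (f : R[i] -> R[i]) s0 (r r' r1 : R) (zs : seq (R[i] * nat)) :
  0 < r1 -> r1 <= r -> r < r' ->
  (forall w, cn (w - s0) < r' -> cderivable f w) ->
  f s0 != 0 -> uniq (map fst zs) ->
  (forall p, p \in zs -> [/\ cn (p.1 - s0) <= r1, p.1 != s0 & vanishes_to f p.1 p.2]) ->
  exists G : R[i] -> R[i], [/\ (forall w, cn (w - s0) < r' -> cderivable G w),
    (forall w, cn (w - s0) = r -> cn (G w) <= cn (f w)) &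
    cn (f s0) * (r / r1) ^+ (\sum_(p <- zs) p.2) <= cn (G s0)].
Proof.
move=> r10 r1r rr'; elim: zs f => [|[rho m] zs IH] f df fs0.
  by move=> _ _; exists f; split => //; rewrite big_nil expr0 mulr1.
have r0 : 0 < r by exact: lt_le_trans r1r.
rewrite /= => /andP[rhozs uzs] H.
have [/= h1 rs0 [e [g [e0 Hg]]]] := H (rho, m) (mem_head _ _).
pose B w := ((r ^+ 2)%:C - conjc (rho - s0) * (w - s0)) / r%:C.
(* The removable singularity at [rho] is filled in from the local factorization. *)
pose f1 w := (if w == rho then g rho else f w / (w - rho) ^+ m) * B w ^+ m.
have dB w : cderivable B w.
  apply: cderivableM; last exact: cderivable_cst.
  apply: cderivableB; first exact: cderivable_cst.
  apply: cderivableM; first exact: cderivable_cst.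
  exact: cderivableB (cderivable_id _) (cderivable_cst _ _).
have f1E w : w != rho -> f1 w = f w * ((w - rho)^-1 ^+ m * B w ^+ m).
  by move=> wr; rewrite /f1 (negbTE wr) -exprVn mulrA.
have dI w : w != rho -> cderivable (fun z => (z - rho)^-1 ^+ m * B z ^+ m) w.
  move=> wr; apply: cderivableM; apply: cderivableX => //.
  apply: cderivableV; first by rewrite subr_eq0.
  exact: cderivableB (cderivable_id _) (cderivable_cst _ _).
have df1 w : cn (w - s0) < r' -> cderivable f1 w.
  move=> hw; have [wr|wr] := eqVneq w rho.
    apply: (@cderivable_near R (fun z => g z * B z ^+ m) f1 w e) => //.
      move=> z; rewrite wr => hz; rewrite /f1; case: eqP => [->//|/eqP zr].
      by rewrite (Hg z hz).2 [(_ ^+ m) * g z]mulrC mulfK// expf_neq0// subr_eq0.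
    apply: cderivableM; last exact: cderivableX.
    by apply: (Hg w _).1; rewrite wr subrr cn0.
  apply: (@cderivable_near R (fun z => f z * ((z - rho)^-1 ^+ m * B z ^+ m)) f1 w (cn (w - rho))).
  - by rewrite cn_gt0 subr_eq0.
  - move=> z hz; rewrite f1E//; apply: contraTneq hz => ->.
    by rewrite cn_sym ltxx.
  - by apply: cderivableM; [exact: df|exact: dI].
have f1s0 : f1 s0 = f s0 * ((s0 - rho)^-1 ^+ m * r%:C ^+ m).
  rewrite f1E 1?eq_sym//; congr (_ * (_ * _ ^+ _)).
  rewrite /B subrr mulr0 subr0 expr2 rmorphM /= mulfK//.
  by rewrite -cn_gt0 cn_real gtr0_norm.
have nf1 : cn (f1 s0) = cn (f s0) * (r / cn (rho - s0)) ^+ m.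
  rewrite f1s0 !cnM !cnX cnV cn_real gtr0_norm// -exprMn; congr (_ * _ ^+ _).
  by rewrite mulrC cn_sym.
have [||p pzs|G [G1 G2 G3]] := IH f1 df1.
- rewrite -cn_gt0 nf1 mulr_gt0 ?cn_gt0// exprn_gt0// divr_gt0// cn_gt0 subr_eq0//.
- exact: uzs.
- have [|a1 a2 a3] := H p; first by rewrite inE pzs orbT.
  split => //.
  have pr : p.1 != rho.
    by apply: contraNneq rhozs => <-; apply: map_f.
  have d0 : 0 < cn (p.1 - rho) by rewrite cn_gt0 subr_eq0.
  have ne w : cn (w - p.1) < cn (p.1 - rho) -> w != rho.
    by move=> hw; apply: contraTneq hw => ->; rewrite cn_sym ltxx.
  apply: (@vanishes_to_near (fun w => f w * ((w - rho)^-1 ^+ m * B w ^+ m)) _ _ _ _ d0).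
    by move=> w /ne wr; rewrite f1E.
  by apply: (vanishes_toM d0) => // w /ne; exact: dI.
exists G; split => //.
  move=> w hw; apply: (le_trans (G2 w hw)).
  have [wr|wr] := eqVneq w rho.
    (* A zero on the circle itself: it is its own reflection, so [B] vanishes there; if [m] is 0,
       nothing is divided out. *)
    have rr1 : r1 = r by apply/eqP; rewrite eq_le r1r -hw wr h1.
    have [m0|m0] := posnP m.
      rewrite /f1 wr eqxx (Hg rho _).2 ?subrr ?cn0//.
      by rewrite m0 !expr0 mulr1 mul1r.
    rewrite /f1 wr eqxx; suff -> : B rho = 0 by rewrite expr0n gtn_eqF// mulr0 cn0 cn_ge0.
    by rewrite /B [conjc _ * _]mulrC mulr_conjc -wr hw subrr mul0r.
  rewrite f1E// !cnM !cnX cnV -exprMn.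
  suff -> : (cn (w - rho))^-1 * cn (B w) = 1 by rewrite expr1n mulr1.
  rewrite /B cnM cnV cn_real gtr0_norm//.
  have -> : (r ^+ 2)%:C - conjc (rho - s0) * (w - s0) = conjc (w - rho) * (w - s0).
    rewrite -hw -mulr_conjc.
    have -> : w - rho = (w - s0) - (rho - s0) by ring.
    by rewrite rmorphB /=; ring.
  rewrite cnM conjc_cn hw mulfK ?gt_eqF// mulVf// gt_eqF// cn_gt0 subr_eq0//.
apply: le_trans G3; rewrite big_cons exprD mulrA ler_wpM2r//.
  by rewrite exprn_ge0// divr_ge0// ltW.
rewrite nf1 ler_wpM2l ?cn_ge0// lerXn2r ?nnegrE ?divr_ge0 ?cn_ge0 ?(ltW r0) ?(ltW r10)//.
by rewrite ler_pM2l// lef_pV2 ?posrE// cn_gt0 subr_eq0.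
Qed.

(* Jensen's inequality for the product over j of w |-> f j (c j + w), from the
   maximum modulus principle alone. *)
Lemma jensen_product n (f : 'I_n -> R[i] -> R[i]) (c : 'I_n -> R[i]) (r r' r1 S : R)
    (zs : 'I_n -> seq (R[i] * nat)) :
  0 < r1 -> r1 <= r -> r < r' ->
  (forall j w, cn (w - c j) < r' -> cderivable (f j) w) ->
  (forall j, f j (c j) != 0) ->
  (forall j, uniq (map fst (zs j))) ->
  (forall j p, p \in zs j ->
     [/\ cn (p.1 - c j) <= r1, p.1 != c j & vanishes_to (f j) p.1 p.2]) ->
  (forall w, cn w = r ->
     \prod_j cn (f j (c j + w)) <= expR S * \prod_j cn (f j (c j))) ->
  (r / r1) ^+ (\sum_j \sum_(p <- zs j) p.2) <= expR S.
Proof.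
move=> r10 r1r rr' df fc uz Hz HS.
have [G HG] := choice (fun j => @blaschke_division (f j) (c j) r r' r1 (zs j)
   r10 r1r rr' (df j) (fc j) (uz j) (Hz j)).
have r0 : 0 < r by exact: lt_le_trans r1r.
pose P w := \prod_j G j (c j + w).
have : cn (P 0) <= expR S * \prod_j cn (f j (c j)).
  apply: (@max_modulus_center R P 0 r r'); first by rewrite r0.
    move=> w; rewrite subr0 => hw; apply: cderivable_prod => j _.
    apply: cderivable_shift; have [h _ _] := HG j; apply: h.
    by rewrite addrC addKr.
  move=> w; rewrite subr0 => hw; apply: le_trans (HS w hw).
  rewrite /P cn_prod; apply: ler_prod => j _; rewrite cn_ge0 /=.
  by have [_ h _] := HG j; apply: h; rewrite addrC addKr.
have f0 : 0 < \prod_j cn (f j (c j)).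
  by apply: prodr_gt0 => j _; rewrite cn_gt0.
move=> h; rewrite -(ler_pM2r f0); apply: le_trans h.
rewrite /P cn_prod expr_sum -big_split /=; apply: ler_prod => j _.
have [_ _] := HG j; rewrite addr0 mulrC => ->; rewrite andbT.
by rewrite mulr_ge0 ?cn_ge0// exprn_ge0// divr_ge0// ltW.
Qed.

End Jensen.

(** * Moebius inversion for generalized integers *)

Section ExponentVectors.
Local Open Scope fset_scope.
Variable R : realType.
Implicit Types f g h : {fsfun nat -> nat with 0%N}.

Definition fadd f g : {fsfun nat -> nat with 0%N} :=
  [fsfun i in finsupp f `|` finsupp g => (f i + g i)%N].
Definition fmin f g : {fsfun nat -> nat with 0%N} :=
  [fsfun i in finsupp f => minn (f i) (g i)].
Definition fsub f g : {fsfun nat -> nat with 0%N} :=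
  [fsfun i in finsupp f => (f i - g i)%N].
Definition fzero : {fsfun nat -> nat with 0%N} := [fsfun i in fset0 => 0%N].

Lemma faddE f g i : fadd f g i = (f i + g i)%N.
Proof.
rewrite /fadd fsfunE inE; case: ifPn => //; rewrite negb_or => /andP[].
by rewrite !memNfinsupp => /eqP -> /eqP ->.
Qed.

Lemma fminE f g i : fmin f g i = minn (f i) (g i).
Proof.
rewrite /fmin fsfunE; case: ifPn => //; rewrite memNfinsupp => /eqP ->.
by rewrite min0n.
Qed.

Lemma fsubE f g i : fsub f g i = (f i - g i)%N.
Proof.
rewrite /fsub fsfunE; case: ifPn => //; rewrite memNfinsupp => /eqP ->.
by rewrite sub0n.
Qed.

Lemma fzeroE i : fzero i = 0%N.
Proof. by rewrite /fzero fsfunE inE. Qed.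

Definition toggle (x : nat) : nat := if x is 0 then 1 else if x is 1 then 0 else x.

Definition ftoggle p f : {fsfun nat -> nat with 0%N} :=
  [fsfun i in p |` finsupp f => if i == p then toggle (f i) else f i].

Lemma ftoggleE p f i : ftoggle p f i = if i == p then toggle (f i) else f i.
Proof.
rewrite /ftoggle fsfunE !inE; case: eqP => //= _.
by case: ifPn => //; rewrite memNfinsupp => /eqP.
Qed.

Definition mobius1 (x : nat) : R := if x is 0 then 1 else if x is 1 then -1 else 0.

Definition mobius f : R := \prod_(i <- finsupp f) mobius1 (f i).

Lemma finsupp_prod (F : nat -> nat -> R) f (S : {fset nat}) : finsupp f `<=` S ->
  (forall i, F i 0%N = 1) ->
  \prod_(i <- S) F i (f i) = \prod_(i <- finsupp f) F i (f i).
Proof.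
move=> fS F0; apply/esym/big_fset_incl => // i _; rewrite memNfinsupp => /eqP ->.
exact: F0.
Qed.

Lemma mobius_norm_le1 f : `|mobius f| <= 1.
Proof.
rewrite /mobius; elim/big_rec: _ => [|i x _ hx]; first by rewrite normr1.
rewrite normrM mulr_ile1// /mobius1; case: (f i) => [|[|k]];
  by rewrite ?normr1 ?normrN1 ?normr0.
Qed.

(** [toggle] exchanges the exponents 0 and 1, which flips the sign, and fixes the larger ones, for
    which both sides are 0. *)
Lemma mobius_toggle p f : mobius (ftoggle p f) = - mobius f.
Proof.
pose S := p |` finsupp f.
have S1 : finsupp f `<=` S by rewrite fsubsetU// fsubset_refl orbT.
have S2 : finsupp (ftoggle p f) `<=` S.
  apply/fsubsetP => i; rewrite mem_finsupp ftoggleE /S !inE mem_finsupp.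
  by case: (i == p).
rewrite /mobius -(finsupp_prod (F := fun=> mobius1) S1)// -(finsupp_prod (F := fun=> mobius1) S2)//.
have pS : p \in S by rewrite !inE eqxx.
rewrite !(big_fsetD1 p pS) /= ftoggleE eqxx -mulNr; congr (_ * _).
  by case: (f p) => [|[|k]]; rewrite /= ?opprK ?oppr0.
apply: eq_big_seq => i; rewrite !inE => /andP[/negbTE ip _].
by rewrite ftoggleE ip.
Qed.

End ExponentVectors.

(** * The semigroup carried by the indices, and mollified partial sums *)

Section Arithmetic.
Local Open Scope fset_scope.
Variables (R : realType) (B : beurling R).
Let n := bint B.

Lemma bint_ge1 k : 1 <= n k.
Proof. by rewrite -(bint0 B); exact: bint_nondecreasing. Qed.

Lemma bint_gt0 k : 0 < n k.
Proof. exact: lt_le_trans ltr01 (bint_ge1 k). Qed.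

Lemma bint_gt1 k : (0 < k)%N -> 1 < n k.
Proof. by move=> k0; apply: lt_le_trans (bint1_gt1 B) _; exact: bint_nondecreasing. Qed.

(** The arithmetic is moved from exponent vectors to indices, so that equal values with different
    factorizations stay distinct: [mul] is multiplication, [dvs] lists divisors, [mob] is the
    Moebius function and [size (dvs j)] the divisor function. Divisor sums of [mob] vanish by the
    sign-reversing involution that toggles one prime dividing [j]. *)
Lemma arithmetic_structure : exists (mul : nat -> nat -> nat) (dvs : nat -> seq nat) (mob : nat -> R),
  [/\ (forall k l, n (mul k l) = n k * n l) /\
        (forall k l, (k <= mul k l)%N /\ (l <= mul k l)%N),
      (forall k k' l, mul k l = mul k' l -> k = k'),
      (forall j, uniq (dvs j)) /\ (forall j l, l \in dvs j <-> exists k, mul k l = j),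
      (forall l, `|mob l| <= 1) /\ (forall j, (0 < j)%N -> \sum_(l <- dvs j) mob l = 0) &
      mob 0%N = 1 /\ (forall k l, (size (dvs (mul k l)) <= size (dvs k) * size (dvs l))%N)].
Proof.
have [nu [ni nuK niK] val] := bint_factor B.
pose v (f : {fsfun nat -> nat with 0%N}) := \prod_(j <- finsupp f) bprime B j ^+ f j.
have vE k : n k = v (nu k) by exact: val.
have vadd f g : v (fadd f g) = v f * v g.
  pose S := finsupp f `|` finsupp g.
  have S1 : finsupp f `<=` S by rewrite fsubsetUl.
  have S2 : finsupp g `<=` S by rewrite fsubsetUr.
  have S3 : finsupp (fadd f g) `<=` S.
    by apply/fsubsetP => i; rewrite mem_finsupp faddE !inE !mem_finsupp addn_eq0 negb_and.
  have F0 i : bprime B i ^+ 0 = 1 by rewrite expr0.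
  rewrite /v -(finsupp_prod (F := fun i k => bprime B i ^+ k) S1)//.
  rewrite -(finsupp_prod (F := fun i k => bprime B i ^+ k) S2)//.
  rewrite -(finsupp_prod (F := fun i k => bprime B i ^+ k) S3)//.
  by rewrite -big_split /=; apply: eq_bigr => i _; rewrite faddE exprD.
pose mul k l := ni (fadd (nu k) (nu l)).
have mulE k l : n (mul k l) = n k * n l by rewrite vE niK vadd -!vE.
have numul k l : nu (mul k l) = fadd (nu k) (nu l) by rewrite niK.
(* Index 0 is the unit, being the only index of value 1. *)
have nu0 : nu 0%N = fzero.
  have : n (ni fzero) = 1.
    rewrite vE niK /v big1_seq// => i /andP[_]; rewrite mem_finsupp fzeroE eqxx//.
  case E : (ni fzero) => [|k]; first by move=> _; have := niK fzero; rewrite E.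
  by move=> h; have := @bint_gt1 k.+1 isT; rewrite h ltxx.
(* Multiplication by a nonunit strictly increases the value, hence the index. *)
have le_n k l j : mul k l = j -> (k <= j)%N.
  move=> e; case: l e => [|l] e.
    suff <- : k = j by [].
    rewrite -e /mul nu0; have -> : fadd (nu k) fzero = nu k.
      by apply/fsfunP => i; rewrite faddE fzeroE addn0.
    by rewrite nuK.
  rewrite leqNgt; apply/negP => jk.
  have h1 : n j <= n k by apply: bint_nondecreasing; exact: ltnW.
  have := @bint_gt1 l.+1 isT; have := mulE k l.+1; rewrite e => h2 h3.
  have := bint_gt0 k; nra.
have mulC k l : mul k l = mul l k.
  by rewrite /mul; congr ni; apply/fsfunP => i; rewrite !faddE addnC.
have mulI k k' l : mul k l = mul k' l -> k = k'.
  move=> /(can_inj niK)/fsfunP h; apply: (can_inj nuK); apply/fsfunP => i.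
  by have := h i; rewrite !faddE => /addIn.
pose dv l j := `[< exists k, mul k l = j >].
pose dvs j := [seq l <- iota 0 j.+1 | dv l j].
have mem_dvs j l : l \in dvs j <-> exists k, mul k l = j.
  rewrite mem_filter mem_iota add0n ltnS; split; first by move=> /andP[/asboolP].
  move=> h; apply/andP; split; first exact/asboolP.
  by case: h => k; rewrite mulC; exact: le_n.
have uniq_dvs j : uniq (dvs j) by rewrite filter_uniq// iota_uniq.
have dvP j l : l \in dvs j <-> forall i, (nu l i <= nu j i)%N.
  split=> [/mem_dvs[k <-] i|h]; first by rewrite numul faddE leq_addl.
  apply/mem_dvs; exists (ni (fsub (nu j) (nu l))); apply: (can_inj nuK).
  by rewrite numul niK; apply/fsfunP => i; rewrite faddE fsubE subnK.
pose mob l := mobius R (nu l).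
exists mul, dvs, mob; split => //; split => //.
- by move=> k l; split; [exact: (@le_n k l)|rewrite mulC; exact: (@le_n l k)].
- by move=> l; exact: mobius_norm_le1.
- move=> j j0.
  have [p pj] : exists p, (0 < nu j p)%N.
    have : nu j != nu 0%N by rewrite (inj_eq (can_inj nuK)) -lt0n.
    have [h _|] := pselect (exists p, (0 < nu j p)%N); first exact: h.
    move=> h /eqP[]; apply/fsfunP => i; rewrite nu0 fzeroE.
    by apply/eqP; rewrite -leqn0 leqNgt; apply/negP => hi; apply: h; exists i.
  pose tau l := ni (ftoggle p (nu l)).
  have tauK : involutive tau.
    move=> l; rewrite /tau; apply: (can_inj nuK); rewrite niK; apply/fsfunP => i.
    rewrite ftoggleE niK ftoggleE; case: eqP => // _.
    by case: (nu l i) => [|[|k]].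
  have tau_dvs l : l \in dvs j -> tau l \in dvs j.
    move=> /dvP h; apply/dvP => i; rewrite /tau niK ftoggleE; case: eqP => // ->.
    by have := h p; case: (nu l p) => [|[|k]].
  have pe : perm_eq (map tau (dvs j)) (dvs j).
    apply: uniq_perm => //; first by rewrite map_inj_uniq//; exact: inv_inj.
    move=> l; apply/mapP/idP => [[l' /tau_dvs h ->]//|h].
    by exists (tau l); [exact: tau_dvs|rewrite tauK].
  have : \sum_(l <- dvs j) mob l = - \sum_(l <- dvs j) mob l.
    rewrite -{1}(perm_big _ pe) /= big_map -sumrN; apply: eq_bigr => l _.
    by rewrite /mob /tau niK mobius_toggle.
  by move=> h; lra.
- rewrite /mob nu0 /mobius big1_seq// => i /andP[_]; rewrite mem_finsupp fzeroE eqxx//.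
- move=> k l.
  (* A divisor [a] of the product is determined by its greatest common divisor with [k] and the
     cofactor, which divide [k] and [l] respectively. *)
  pose F a := (ni (fmin (nu a) (nu k)), ni (fsub (nu a) (nu k))).
  rewrite -(size_allpairs pair) -(size_map F); apply: uniq_leq_size.
    rewrite map_inj_in_uniq// => a b _ _ [/(can_inj niK)/fsfunP e1 /(can_inj niK)/fsfunP e2].
    apply: (can_inj nuK); apply/fsfunP => i; have := e1 i; have := e2 i.
    rewrite !fminE !fsubE => h1 h2.
    have mm (a1 a2 : nat) : (minn a1 a2 + (a1 - a2))%N = a1 by rewrite minnE subnK// leq_subr.
    by rewrite -(mm (nu a i) (nu k i)) h1 h2 mm.
  move=> c /mapP[a /dvP ha ->]; apply/allpairsP; exists (F a); split => //=.
    by apply/dvP => i; rewrite niK fminE geq_minr.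
  apply/dvP => i; rewrite niK fsubE leq_subLR; have := ha i.
  by rewrite numul faddE.
Qed.

Local Close Scope fset_scope.

Lemma sum_pick (V : comNzRingType) (Y a : nat) (F : nat -> V) : (a < Y)%N ->
  \sum_(j < Y) (a == j)%:R * F j = F a.
Proof.
move=> aY; rewrite (bigD1 (Ordinal aY)) //= eqxx mul1r big1 ?addr0// => j /eqP ja.
by case: eqP => [e|_]; [case: ja; exact/val_inj|rewrite mul0r].
Qed.

Lemma sum_mem (V : comNzRingType) (x : nat) (s : seq nat) (F : nat -> V) : uniq s ->
  \sum_(l < x) (nat_of_ord l \in s)%:R * F l = \sum_(l <- s | (l < x)%N) F l.
Proof.
move=> us; rewrite -(big_mkord xpredT (fun l => (l \in s)%:R * F l)) /index_iota subn0.
rewrite -(big_filter s) (eq_bigr (fun l => if l \in s then F l else 0)); last first.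
  by move=> l _; case: (l \in s); rewrite ?mul1r ?mul0r.
rewrite -big_mkcond -big_filter; apply: perm_big; apply: uniq_perm.
- by rewrite filter_uniq// iota_uniq.
- by rewrite filter_uniq.
- by move=> l; rewrite !mem_filter mem_iota add0n andbC.
Qed.

Section Convolution.
Variables (V : comNzRingType) (mul : nat -> nat -> nat) (m x Y : nat).
Hypothesis mulY : forall k l, (k < m)%N -> (l < x)%N -> (mul k l < Y)%N.

Lemma convolution (w : nat -> V) (chi : nat -> V) :
  \sum_(k < m) \sum_(l < x) w l * chi (mul k l) =
  \sum_(j < Y) (\sum_(k < m) \sum_(l < x) (mul k l == j)%:R * w l) * chi j.
Proof.
rewrite (eq_bigr (fun j : 'I_Y => \sum_(k < m) \sum_(l < x) (mul k l == j)%:R * (w l * chi j))); last first.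
  move=> j _; rewrite big_distrl; apply: eq_bigr => k _; rewrite big_distrl.
  by apply: eq_bigr => l _; rewrite mulrA.
rewrite [RHS]exchange_big; apply: eq_bigr => k _; rewrite [RHS]exchange_big; apply: eq_bigr => l _.
by rewrite (sum_pick (fun j => w l * chi j))//; exact: mulY.
Qed.

End Convolution.

(** Since [x <= m], the coefficient of each [j < x] in the product is a complete divisor sum of
    [mob], so only [j = 0] survives below [x]. The claims quantify over multiplicative [phi] after
    [b], so that one [b] serves all [s]. The fourth power arises because [b] is dominated by the
    divisor function, which is submultiplicative. *)
Lemma mollifier : exists mob : nat -> R, (forall l, `|mob l| <= 1) /\
  forall m x, (0 < x <= m)%N -> exists (Y : nat) (b : nat -> R),
  [/\ (forall phi : R -> R[i], phi 1 = 1 ->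
         (forall u v, 0 < u -> 0 < v -> phi (u * v) = phi u * phi v) ->
         (\sum_(k < m) phi (n k)) * (\sum_(l < x) (mob l)%:C * phi (n l)) =
         1 + \sum_(x <= j < Y) (b j)%:C * phi (n j)),
      \sum_(x <= j < Y) b j ^+ 2 / n j <= (\sum_(k < m) (n k)^-1) ^+ 4,
      (forall j, b j != 0 -> n j <= n m * n x) &
      (forall phi : R -> R, (forall u, 0 < u -> 0 <= phi u) ->
         (forall u v, 0 < u -> 0 < v -> phi (u * v) = phi u * phi v) ->
         \sum_(x <= j < Y) `|b j| * phi (n j) <= (\sum_(k < m) phi (n k)) ^+ 2)].
Proof.
have [mul [dvs [mob [[mulE le_mul] mulI [ud md] [mob1 mob0] [mob00 dsub]]]]] := arithmetic_structure.
exists mob; split => // m x /andP[x0 xm].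
pose Y := maxn x (\sum_(k < m) \sum_(l < x) mul k l).+1.
have xY : (x <= Y)%N by rewrite leq_max leqnn.
have mulY k l : (k < m)%N -> (l < x)%N -> (mul k l < Y)%N.
  move=> km lx; rewrite leq_max ltnS; apply/orP; right.
  by rewrite (bigD1 (Ordinal km))//= (bigD1 (Ordinal lx))//= -addnA leq_addr.
have n0 j : 0 < n j := bint_gt0 j.
(* [b] is the true coefficient, [c] counts the same representations without signs and [d] is the
   divisor function; thus [|b| <= c <= d]. *)
pose b j : R := \sum_(k < m) \sum_(l < x) (mul k l == j)%:R * mob l.
pose c j : R := \sum_(k < m) \sum_(l < x) (mul k l == j)%:R * 1.
pose d j : R := (size (dvs j))%:R.
have fib_le j l : \sum_(k < m) ((mul k l == j)%:R : R) <= (l \in dvs j)%:R.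
  have [/md[k0 e]|h] := boolP (l \in dvs j).
    apply: (@le_trans _ _ (\sum_(k < m) (k0 == k)%:R)).
      apply: ler_sum => k _; case: eqP => //= e'.
      by rewrite -e in e'; rewrite (mulI _ _ _ e') eqxx.
    have [km|km] := ltnP k0 m.
      by have := @sum_pick R m k0 (fun=> 1) km; under eq_bigr do rewrite mulr1; move=> ->.
    rewrite big1 ?ler01// => k _; case: eqP => // e2.
    by have := ltn_ord k; rewrite -e2 ltnNge km.
  rewrite big1// => k _; case: eqP => // e; case/negP: h; apply/md; by exists k.
have fib_eq j l : (j < m)%N -> \sum_(k < m) ((mul k l == j)%:R : R) = (l \in dvs j)%:R.
  move=> jm; apply/eqP; rewrite eq_le fib_le /=.
  have [/md[k0 e]|h] := boolP (l \in dvs j); last by rewrite sumr_ge0// => k _; rewrite ler0n.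
  have km : (k0 < m)%N by apply: leq_ltn_trans jm; rewrite -e; case: (le_mul k0 l).
  by rewrite (bigD1 (Ordinal km))//= e eqxx lerDl sumr_ge0// => k _; rewrite ler0n.
have c_le j : c j <= d j.
  rewrite /c exchange_big /=; apply: (@le_trans _ _ (\sum_(l < x) (nat_of_ord l \in dvs j)%:R * 1)).
    apply: ler_sum => l _; rewrite mulr1; under eq_bigr do rewrite mulr1; exact: fib_le.
  rewrite (@sum_mem R x (dvs j) (fun=> 1) (ud j)) -big_filter big_const_seq count_predT iter_addr_0.
  rewrite /d ler_nat size_filter.
  exact: count_size.
have c_ge0 j : 0 <= c j.
  by rewrite /c; apply: sumr_ge0 => k _; apply: sumr_ge0 => l _; rewrite mulr1 ler0n.
have d_ge0 j : 0 <= d j by exact: ler0n.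
have b_le j : `|b j| <= c j.
  rewrite /b /c; apply: (le_trans (ler_norm_sum _ _ _)); apply: ler_sum => k _.
  apply: (le_trans (ler_norm_sum _ _ _)); apply: ler_sum => l _.
  by rewrite normrM ger0_norm ?ler0n// ler_wpM2l ?ler0n.
have b_dvs j : (j < x)%N -> b j = \sum_(l <- dvs j) mob l.
  move=> jx; rewrite /b exchange_big /=.
  rewrite (eq_bigr (fun l : 'I_x => (nat_of_ord l \in dvs j)%:R * mob l)); last first.
    by move=> l _; rewrite -big_distrl /= fib_eq//; exact: leq_trans xm.
  rewrite (@sum_mem R x (dvs j) mob (ud j)) big_seq_cond [RHS]big_seq; apply: eq_bigl => l.
  have [/md[k e]|//] := boolP (l \in dvs j); rewrite /=.
  by apply: leq_ltn_trans jx; rewrite -e; case: (le_mul k l).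
have b0 : b 0%N = 1.
  rewrite b_dvs// (perm_big [:: 0%N]); first by rewrite big_seq1.
  apply: uniq_perm => // l; rewrite inE; apply/idP/eqP.
    by move=> /md[k e]; apply/eqP; rewrite -leqn0 -e; case: (le_mul k l).
  move=> ->; apply/md; exists 0%N.
  case E : (mul 0%N 0%N) => [//|k]; have := mulE 0%N 0%N.
  have := @bint_gt1 k.+1 isT; rewrite E /n (bint0 B) mulr1 => h1 h2.
  by rewrite /n h2 ltxx in h1.
have bz j : (0 < j < x)%N -> b j = 0.
  by move=> /andP[j0 jx]; rewrite b_dvs// mob0.
(* For [j < m] every factorization of [j] occurs in the expanded square of the harmonic sum, so
   [d j / n j] is a part of it. *)
have hdiv : \sum_(k < m) d k / n k <= (\sum_(k < m) (n k)^-1) ^+ 2.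
  rewrite expr2 big_distrl /=.
  apply: (@le_trans _ _ (\sum_(k < m) \sum_(l < m) (n (mul k l))^-1)); last first.
    by apply: ler_sum => k _; rewrite big_distrr; apply: ler_sum => l _ /=; rewrite mulE invfM.
  pose Z := maxn m (\sum_(k < m) \sum_(l < m) mul k l).+1.
  have mulZ k l : (k < m)%N -> (l < m)%N -> (mul k l < Z)%N.
    move=> km lm; rewrite leq_max ltnS; apply/orP; right.
    by rewrite (bigD1 (Ordinal km))//= (bigD1 (Ordinal lm))//= -addnA leq_addr.
  have := @convolution R mul m m Z mulZ (fun=> 1) (fun j => (n j)^-1).
  under [X in X = _]eq_bigr do under eq_bigr do rewrite mul1r.
  move=> ->; rewrite -(big_mkord xpredT (fun j => (\sum_(k < m) \sum_(l < m) (mul k l == j)%:R * 1) * (n j)^-1)).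
  have mZ : (m <= Z)%N by rewrite leq_max leqnn.
  rewrite (big_cat_nat (n := m)) //= -[leLHS]addr0; apply: lerD; last first.
    apply: sumr_ge0 => j _; apply: mulr_ge0; last by rewrite invr_ge0 ltW.
    by apply: sumr_ge0 => k _; apply: sumr_ge0 => l _; rewrite mulr1 ler0n.
  rewrite big_mkord; apply: ler_sum => j _; rewrite ler_wpM2r ?invr_ge0 ?(ltW (n0 _))//.
  rewrite exchange_big /=.
  rewrite (eq_bigr (fun l : 'I_m => (nat_of_ord l \in dvs j)%:R * 1)); last first.
    by move=> l _; rewrite -big_distrl /= fib_eq.
  rewrite (@sum_mem R m (dvs j) (fun=> 1) (ud j)) -big_filter big_const_seq count_predT iter_addr_0.
  rewrite /d ler_nat.
  have /all_filterP -> // : all (fun i => (i < m)%N) (dvs j).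
  apply/allP => l /md[k e].
  by apply: leq_ltn_trans (ltn_ord j); rewrite -[X in (_ <= X)%N]e; case: (le_mul k l).
have sub_sum (F : nat -> R) : (forall j, 0 <= F j) -> \sum_(x <= j < Y) F j <= \sum_(j < Y) F j.
  move=> F0; rewrite -(big_mkord xpredT F) [leRHS](big_cat_nat (n := x)) //=.
  by rewrite lerDr sumr_ge0.
exists Y, b; split.
- move=> phi phi1 phiM.
  rewrite big_distrl /=.
  rewrite (eq_bigr (fun k : 'I_m => \sum_(l < x) (mob l)%:C * phi (n (mul k l)))); last first.
    by move=> k _; rewrite big_distrr; apply: eq_bigr => l _ /=; rewrite mulE phiM// mulrCA.
  rewrite (convolution mulY (fun l => (mob l)%:C) (fun j => phi (n j))).
  rewrite (eq_bigr (fun j : 'I_Y => (b j)%:C * phi (n j))); last first.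
    move=> j _; congr (_ * _); rewrite /b rmorph_sum; apply: eq_bigr => k _.
    by rewrite rmorph_sum; apply: eq_bigr => l _ /=; rewrite rmorphM rmorph_nat.
  rewrite -(big_mkord xpredT (fun j => (b j)%:C * phi (n j))) (big_cat_nat (n := x)) //=.
  congr (_ + _); rewrite big_ltn// b0 /n bint0 phi1 mul1r big_nat_cond big1 ?addr0// => j.
  by rewrite andbT => /bz ->; rewrite mul0r.
- apply: (@le_trans _ _ (\sum_(x <= j < Y) c j * (d j / n j))).
    apply: ler_sum => j _; rewrite mulrA ler_wpM2r ?invr_ge0 ?(ltW (n0 _))//.
    rewrite -[X in X <= _]real_normK ?num_real// expr2; apply: ler_pM => //.
    exact: le_trans (b_le j) (c_le j).
  apply: (le_trans (sub_sum _ _)).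
    by move=> j; rewrite mulr_ge0// divr_ge0// ltW.
  rewrite -(convolution mulY (fun=> 1) (fun j => d j / n j)).
  apply: (@le_trans _ _ (\sum_(k < m) \sum_(l < x) (d k / n k) * (d l / n l))).
    apply: ler_sum => k _; apply: ler_sum => l _.
    rewrite mul1r mulE mulrACA -invfM ler_wpM2r ?invr_ge0 ?mulr_ge0 ?(ltW (n0 _))//.
    by rewrite /d -natrM ler_nat.
  have -> : \sum_(k < m) \sum_(l < x) d k / n k * (d l / n l) =
     (\sum_(k < m) d k / n k) * (\sum_(l < x) d l / n l).
    by rewrite big_distrl; apply: eq_bigr => k _; rewrite big_distrr.
  have dn0 j : 0 <= d j / n j by rewrite divr_ge0// ltW.
  have hx : \sum_(l < x) d l / n l <= \sum_(k < m) d k / n k.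
    rewrite -(big_mkord xpredT (fun l => d l / n l)) -(big_mkord xpredT (fun l => d l / n l)).
    by rewrite [leRHS](big_cat_nat (n := x)) //= lerDl sumr_ge0.
  rewrite [X in _ <= X](_ : _ = (\sum_(k < m) (n k)^-1) ^+ 2 * (\sum_(k < m) (n k)^-1) ^+ 2); last first.
    by rewrite -exprD.
  apply: ler_pM => //; try exact: sumr_ge0.
  exact: le_trans hx hdiv.
- move=> j bj; have : c j != 0.
    by apply: contraNneq bj => cj; rewrite -normr_le0 -cj; exact: b_le.
  have [[k [l [km lx e]]]|h] := pselect (exists k l, [/\ (k < m)%N, (l < x)%N & mul k l = j]).
    move=> _; rewrite -e mulE; apply: ler_pM; rewrite ?(ltW (n0 _))//;
      by apply: (bint_nondecreasing B); exact: ltnW.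
  rewrite /c big1 ?eqxx// => k _; rewrite big1// => l _; case: eqP => [e|_]; last by rewrite mul0r.
  by case: h; exists k, l; split.
- move=> phi phi0 phiM.
  apply: (@le_trans _ _ (\sum_(x <= j < Y) c j * phi (n j))).
    by apply: ler_sum => j _; rewrite ler_wpM2r ?phi0.
  apply: (le_trans (sub_sum _ _)); first by move=> j; rewrite mulr_ge0 ?phi0.
  rewrite -(convolution mulY (fun=> 1) (fun j => phi (n j))).
  have -> : \sum_(k < m) \sum_(l < x) 1 * phi (n (mul k l)) =
     (\sum_(k < m) phi (n k)) * (\sum_(l < x) phi (n l)).
    rewrite big_distrl; apply: eq_bigr => k _; rewrite big_distrr; apply: eq_bigr => l _ /=.
    by rewrite mul1r mulE phiM.
  rewrite expr2 ler_wpM2l ?sumr_ge0//; first by move=> k _; rewrite phi0.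
  rewrite -(big_mkord xpredT (fun l => phi (n l))) -(big_mkord xpredT (fun l => phi (n l))).
  by rewrite [leRHS](big_cat_nat (n := x)) //= lerDl sumr_ge0// => k _; rewrite phi0.
Qed.

End Arithmetic.

(** * A discrete mean value theorem *)

Section MeanValue.
Variable R : realType.

Lemma geometric_sum_cn (u : R[i]) N : cn u = 1 ->
  cn (\sum_(i < N) u ^+ i) <= N%:R /\ cn (\sum_(i < N) u ^+ i) * cn (u - 1) <= 2.
Proof.
move=> u1; split.
  apply: (le_trans (cn_sum _ _ _)).
  by under eq_bigr do rewrite cnX u1 expr1n; rewrite sumr_const card_ord.
rewrite mulrC -cnM -subrX1; apply: (le_trans (cnB _ _)).
by rewrite cnX u1 expr1n cn1.
Qed.

(** For such [t] there is no wrap-around, and [|sin t| >= |t| - t ^ 2]. *)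
Lemma cexp_i_sub1_ge (t : R) : `|t| <= 1 / 2 -> `|t| / 2 <= cn (cexp (0 +i* t) - 1).
Proof.
move=> ht; apply: (@le_trans _ _ `|sin t|).
  have := sin_subx_sqr t; have := ler_distD (sin t) t 0.
  rewrite !subr0 (distrC t) -(real_normK (num_real t)).
  have := normr_ge0 t; nra.
have -> : sin t = complex.Im (cexp (0 +i* t) - 1).
  by rewrite /cexp cImD cImN /= expR0 mul1r subr0.
exact: ler_Im_cn.
Qed.

Lemma sum_inv_sqr N : \sum_(d < N) ((d.+1%:R : R) ^+ 2)^-1 <= 2.
Proof.
case: N => [|N]; first by rewrite big_ord0.
suff : \sum_(d < N.+1) ((d.+1%:R : R) ^+ 2)^-1 <= 2 - N.+1%:R^-1.
  by move=> h; apply: (le_trans h); rewrite gerBl invr_ge0.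
elim: N => [|N IH]; first by rewrite big_ord_recr big_ord0 /= expr1n invr1; lra.
rewrite big_ord_recr /=; apply: (le_trans (lerD IH (lexx _))).
have n0 : 0 < N.+1%:R :> R by rewrite ltr0Sn.
rewrite -[N.+2%:R]natr1; move: (N.+1%:R) n0 => y y0.
rewrite -subr_ge0.
have -> : 2 - (y + 1)^-1 - (2 - y^-1 + ((y + 1) ^+ 2)^-1) = (y * (y + 1) ^+ 2)^-1.
  by field; apply/andP; split; lra.
by rewrite invr_ge0 mulr_ge0 ?sqr_ge0 ?ltW.
Qed.

Lemma sum_shift (a n : nat) (f : nat -> R) :
  \sum_(a <= i < a + n) f i = \sum_(i < n) f (i + a)%N.
Proof. by rewrite -{1}[a]add0n big_addn addKn big_mkord. Qed.

Lemma sum_kernel A (a : 'I_A) :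
  \sum_(b < A) ((((a - b) + (b - a)).+1%:R : R) ^+ 2)^-1 <= 4.
Proof.
pose K d : R := ((d.+1%:R : R) ^+ 2)^-1.
have K0 d : 0 <= K d by rewrite invr_ge0 sqr_ge0.
rewrite (bigID (fun b : 'I_A => (b <= a)%N)) /=.
have -> : 4 = 2 + 2 :> R by lra.
apply: lerD.
  rewrite (eq_bigr (fun b : 'I_A => K (a - b)%N)); last first.
    move=> b h; have /eqP -> : (b - a == 0)%N by rewrite subn_eq0.
    by rewrite addn0.
  rewrite -(big_mkord (fun b => b <= a)%N (fun b => K (a - b)%N)).
  rewrite -(@big_nat_widen _ _ _ 0 a.+1 A xpredT)// big_nat_rev /= add0n.
  apply: le_trans (sum_inv_sqr a.+1).
  rewrite -(big_mkord xpredT K) big_nat_cond [leRHS]big_nat_cond; apply: ler_sum => b.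
  by rewrite andbT => /andP[_ ba]; rewrite subSS subKn// -ltnS.
rewrite (eq_bigr (fun b : 'I_A => K (b - a)%N)); last first.
  move=> b; rewrite -ltnNge => h.
  by have /eqP -> : (a - b == 0)%N by rewrite subn_eq0 ltnW.
rewrite (eq_bigl (fun b : 'I_A => true && (a.+1 <= b)%N)); last first.
  by move=> b; rewrite -ltnNge.
rewrite -(big_geq_mkord a.+1 A xpredT (fun b => K (b - a)%N)).
rewrite -{1}[a.+1]add0n big_addn big_mkord; apply: le_trans (sum_inv_sqr (A - a.+1)).
apply: ler_sum => b _; rewrite addnS subSn ?leq_addl// addnK /K.
by rewrite lef_pV2 ?posrE ?exprn_gt0 ?ltr0Sn// lerXn2r ?nnegrE// ler_nat.
Qed.

(** The left side is repeated [n] times inside a double sum over [i < 2 n] and [k < n]. There the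
    coefficient of a pair of terms is a product of two geometric sums, so it decays like the inverse
    square of the phase distance and is summable over cells with no logarithmic loss. Cells have
    phase width about [1 / n], and [W] bounds the number of nonzero terms sharing a cell. *)
Lemma mean_value_phases n P A (c : 'I_P -> R[i]) (t : 'I_P -> R)
    (cell : 'I_P -> 'I_A) (W : 'I_P -> R) : (0 < n)%N ->
  (forall p q, `|t p - t q| <= 1 / 2) ->
  (forall p q, ((cell p - cell q) + (cell q - cell p))%:R - 1 <= n%:R * `|t p - t q|) ->
  (forall p, c p != 0 -> (#|[pred q | (cell q == cell p) && (c q != 0)]|)%:R <= W p) ->
  \sum_(i < n) cn (\sum_p c p * cexp (0 +i* t p) ^+ i) ^+ 2 <=
  1024 * n%:R * \sum_p W p * cn (c p) ^+ 2.
Proof.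
move=> n0 t1 tc cW.
have [z zE] : exists z, forall p, z p = cexp (0 +i* t p).
  by exists (fun p => cexp (0 +i* t p)).
rewrite (eq_bigr (fun i : 'I_n => cn (\sum_p c p * z p ^+ i) ^+ 2)); last first.
  by move=> i _; congr (cn _ ^+ 2); apply: eq_bigr => p _; rewrite zE.
have z1 p : cn (z p) = 1 by rewrite zE cn_cexp /= expR0.
have zc p : z p * conjc (z p) = 1 by rewrite mulr_conjc z1 expr1n.
pose H i k := \sum_p c p * (z p ^+ i * conjc (z p) ^+ k).
pose dist p q : nat := ((cell p - cell q) + (cell q - cell p))%N.
pose K d : R := ((d.+1%:R : R) ^+ 2)^-1.
have K0 d : 0 <= K d by rewrite invr_ge0 sqr_ge0.
have nn : 0 < n%:R :> R by rewrite ltr0n.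
(* For fixed [k], the terms [i = k, ..., k + n - 1] of the double sum reproduce those on the left,
   as [z p * conjc (z p) = 1]. *)
have step1 : n%:R * \sum_(i < n) cn (\sum_p c p * z p ^+ i) ^+ 2 <=
   \sum_(i < n + n) \sum_(k < n) cn (H i k) ^+ 2.
  rewrite exchange_big /= mulr_natl -[X in _ *+ X](card_ord n) -sumr_const.
  apply: ler_sum => k _; rewrite -(big_mkord xpredT (fun i => cn (H i k) ^+ 2)).
  rewrite (big_cat_nat (n := k)) //=; last by rewrite (leq_trans (ltnW (ltn_ord k)))// leq_addr.
  have knn : (k + n <= n + n)%N by rewrite leq_add2r ltnW.
  rewrite [X in _ + X](big_cat_nat (n := (k + n)%N)) //=; last by rewrite leq_addr.
  rewrite (sum_shift k n (fun i => cn (H i k) ^+ 2)).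
  rewrite addrCA -[leLHS]addr0; apply: lerD; last first.
    by apply: addr_ge0; apply: sumr_ge0 => i _; rewrite sqr_ge0.
  apply: ler_sum => i _; apply: eq_ler; congr (cn _ ^+ 2).
  apply: eq_bigr => p _; congr (_ * _).
  by rewrite exprD -mulrA -exprMn zc expr1n mulr1.
have step2 : \sum_(i < n + n) \sum_(k < n) cn (H i k) ^+ 2 <=
   \sum_p \sum_q cn (c p) * cn (c q) * (256 * n%:R ^+ 2 * K (dist p q)).
  pose u p q := z p * conjc (z q).
  have u1 p q : cn (u p q) = 1 by rewrite cnM conjc_cn !z1 mulr1.
  have e : (\sum_(i < n + n) \sum_(k < n) cn (H i k) ^+ 2)%:C =
     \sum_p \sum_q c p * conjc (c q) *
       ((\sum_(i < n + n) u p q ^+ i) * (\sum_(k < n) u q p ^+ k)).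
    rewrite rmorph_sum /=.
    rewrite (eq_bigr (fun i : 'I_(n + n) => \sum_(k < n) \sum_p \sum_q c p * conjc (c q) * (u p q ^+ i * u q p ^+ k))); last first.
      move=> i _; rewrite rmorph_sum; apply: eq_bigr => k _ /=.
      rewrite -mulr_conjc /H rmorph_sum /= big_distrl; apply: eq_bigr => p _ /=.
      rewrite big_distrr; apply: eq_bigr => q _ /=.
      rewrite !rmorphM !rmorphXn /= conjcK /u !exprMn.
      ring.
    rewrite (eq_bigr (fun i : 'I_(n + n) => \sum_p \sum_q \sum_(k < n) c p * conjc (c q) * (u p q ^+ i * u q p ^+ k))); last first.
      by move=> i _; rewrite exchange_big; apply: eq_bigr => p _ /=; rewrite exchange_big.
    rewrite exchange_big; apply: eq_bigr => p _ /=; rewrite exchange_big; apply: eq_bigr => q _ /=.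
    rewrite big_distrl big_distrr; apply: eq_bigr => i _ /=.
    by rewrite !big_distrr.
  have e0 : 0 <= \sum_(i < n + n) \sum_(k < n) cn (H i k) ^+ 2.
    by apply: sumr_ge0 => i _; apply: sumr_ge0 => k _; rewrite sqr_ge0.
  rewrite -(ger0_norm e0) -cn_real e.
  apply: (le_trans (cn_sum _ _ _)); apply: ler_sum => p _.
  apply: (le_trans (cn_sum _ _ _)); apply: ler_sum => q _.
  rewrite !cnM conjc_cn ler_wpM2l ?mulr_ge0 ?cn_ge0//.
  have [a1 a2] := geometric_sum_cn (n + n) (u1 p q).
  have [b1 b2] := geometric_sum_cn n (u1 q p).
  set D1 := cn (\sum_(i < n + n) _) in a1 a2 *; set D2 := cn (\sum_(i < n) _) in b1 b2 *.
  have D10 : 0 <= D1 by exact: cn_ge0.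
  have D20 : 0 <= D2 by exact: cn_ge0.
  have ue p' q' : u p' q' = cexp (0 +i* (t p' - t q')).
    rewrite /u !zE; have -> : conjc (cexp (0 +i* t q')) = cexp (0 +i* - t q').
      by rewrite /cexp /= cosN sinN mulrN.
    by rewrite -cexpD; congr cexp; apply: complex_eq; rewrite ?cReD ?cImD /= ?addr0.
  have := cexp_i_sub1_ge (t1 p q); rewrite -ue => g1.
  have := cexp_i_sub1_ge (t1 q p); rewrite -ue (distrC (t q)) => g2.
  have := tc p q; rewrite -/(dist p q); move: (dist p q) => d hd.
  set x := `|t p - t q| in g1 g2 hd.
  have x0 : 0 <= x by rewrite normr_ge0.
  have h1 : D1 * x <= 4 by apply: le_trans (_ : D1 * (2 * cn (u p q - 1)) <= _); [apply: ler_wpM2l; lra|lra].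
  have h2 : D2 * x <= 4 by apply: le_trans (_ : D2 * (2 * cn (u q p - 1)) <= _); [apply: ler_wpM2l; lra|lra].
  rewrite natrD in a1.
  (* Equal or adjacent cells give no separation and get the trivial bound [2 * n * n]; otherwise
     each geometric sum is at most 4 over the phase distance. *)
  rewrite /K; case: (leqP d 1) => hd1.
    have dd : (d.+1%:R : R) <= 2 by rewrite ler_nat.
    have dd0 : 0 < (d.+1%:R : R) by rewrite ltr0Sn.
    rewrite ler_pdivlMr ?exprn_gt0//.
    apply: (@le_trans _ _ ((n%:R + n%:R) * n%:R * 2 ^+ 2)).
      by apply: ler_pM; rewrite ?mulr_ge0 ?sqr_ge0//; [exact: ler_pM|rewrite lerXn2r// nnegrE ltW].
    by rewrite !expr2; nra.
  have dd : 2 <= (d%:R : R) by rewrite ler_nat.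
  have e1 : (d.+1%:R : R) <= 4 * (n%:R * x).
    rewrite -natr1; lra.
  rewrite ler_pdivlMr ?exprn_gt0 ?ltr0Sn//.
  apply: (@le_trans _ _ (D1 * D2 * (4 * (n%:R * x)) ^+ 2)).
    by rewrite ler_wpM2l ?mulr_ge0// lerXn2r ?nnegrE// (le_trans _ e1).
  have -> : D1 * D2 * (4 * (n%:R * x)) ^+ 2 = 16 * n%:R ^+ 2 * ((D1 * x) * (D2 * x)) by ring.
  have -> : 256 * n%:R ^+ 2 = 16 * n%:R ^+ 2 * (4 * 4) :> R by ring.
  rewrite ler_wpM2l ?mulr_ge0 ?sqr_ge0//; apply: ler_pM => //; exact: mulr_ge0.
pose S (a : 'I_A) := \sum_(p | cell p == a) cn (c p).
have S0 a : 0 <= S a by apply: sumr_ge0 => p _; exact: cn_ge0.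
pose D (a b : 'I_A) : nat := ((a - b) + (b - a))%N.
have step3 : \sum_p \sum_q cn (c p) * cn (c q) * (256 * n%:R ^+ 2 * K (dist p q)) =
   256 * n%:R ^+ 2 * \sum_a \sum_b S a * S b * K (D a b).
  rewrite (partition_big cell predT) //= big_distrr; apply: eq_bigr => a _ /=.
  rewrite (eq_bigr (fun p => \sum_(b < A) cn (c p) * S b * (256 * n%:R ^+ 2 * K (D a b)))); last first.
    move=> p /eqP pa; rewrite (partition_big cell predT) //=; apply: eq_bigr => b _.
    rewrite /S big_distrr big_distrl; apply: eq_bigr => q /eqP qb /=.
    by rewrite /dist /D pa qb.
  rewrite exchange_big big_distrr; apply: eq_bigr => b _ /=.
  by rewrite -big_distrl -big_distrl /= -/(S a); ring.
(* Schur's test: the arithmetic-geometric mean inequality, with row sums of the kernel at most 4. *)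
have step4 : \sum_a \sum_b S a * S b * K (D a b) <= 4 * \sum_a S a ^+ 2.
  apply: (@le_trans _ _ (\sum_a \sum_b ((S a ^+ 2 * K (D a b)) / 2 + (S b ^+ 2 * K (D a b)) / 2))).
    apply: ler_sum => a _; apply: ler_sum => b _.
    have h : S a * S b <= S a ^+ 2 / 2 + S b ^+ 2 / 2.
      by have := sqr_ge0 (S a - S b); nra.
    by have := ler_wpM2r (K0 (D a b)) h; lra.
  under eq_bigr do rewrite big_split /=.
  rewrite big_split /= [X in _ + X]exchange_big /=.
  have Dsym a b : D a b = D b a by rewrite /D addnC.
  have half : \sum_a \sum_b S a ^+ 2 * K (D a b) / 2 <= 2 * \sum_a S a ^+ 2.
    rewrite big_distrr; apply: ler_sum => a _ /=.
    rewrite -big_distrl -big_distrr /=.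
    have := @sum_kernel A a; rewrite -/(K _) => h.
    have := ler_wpM2l (sqr_ge0 (S a)) h; rewrite /K; lra.
  apply: (@le_trans _ _ (2 * \sum_a S a ^+ 2 + 2 * \sum_a S a ^+ 2)); last by lra.
  apply: lerD => //; apply: le_trans half; apply: ler_sum => a _; apply: ler_sum => b _.
  by rewrite Dsym.
(* Cauchy-Schwarz in each cell, where only nonzero coefficients are counted. *)
have step5 : \sum_a S a ^+ 2 <= \sum_p W p * cn (c p) ^+ 2.
  rewrite [leRHS](partition_big cell predT) //=; apply: ler_sum => a _.
  pose nz p := (cell p == a) && (c p != 0).
  have restrict (F : 'I_P -> R) : (forall p, c p = 0 -> F p = 0) ->
      \sum_(p < P | cell p == a) F p = \sum_(p < P | nz p) F p.
    move=> F0; rewrite (bigID (fun p => c p != 0)) /= [X in _ + X]big1 ?addr0//.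
    by move=> p /andP[_ /negPn/eqP]; exact: F0.
  rewrite /S restrict; last by move=> p ->; rewrite cn0.
  rewrite restrict; last by move=> p ->; rewrite cn0 expr0n mulr0.
  set V := \sum_(p < P | nz p) cn (c p) ^+ 2.
  set k := #|[pred q | nz q]|.
  have cs : (\sum_(p < P | nz p) cn (c p)) ^+ 2 <= k%:R * V.
    rewrite expr2 big_distrl /=.
    apply: (@le_trans _ _ (\sum_(p | nz p) \sum_(q | nz q) (cn (c p) ^+ 2 / 2 + cn (c q) ^+ 2 / 2))).
      apply: ler_sum => p _; rewrite big_distrr; apply: ler_sum => q _ /=.
      have := sqr_ge0 (cn (c p) - cn (c q)); nra.
    have sc (v : R) : \sum_(q < P | nz q) v = k%:R * v.
      by rewrite sumr_const mulr_natl; congr (_ *+ _); apply: eq_card.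
    rewrite (eq_bigr (fun p => k%:R * (cn (c p) ^+ 2 / 2) + V / 2)); last first.
      by move=> p _; rewrite big_split /= sc /V -big_distrl.
    rewrite big_split /= sc -big_distrr -big_distrl /= -/V; lra.
  apply: (le_trans cs); rewrite big_distrr; apply: ler_sum => p /andP[/eqP pa cp] /=.
  by rewrite ler_wpM2r ?sqr_ge0//; have := cW p cp; rewrite pa.
rewrite -(ler_pM2l nn); apply: (le_trans step1); apply: (le_trans step2).
rewrite step3; apply: (@le_trans _ _ (256 * n%:R ^+ 2 * (4 * \sum_p W p * cn (c p) ^+ 2))).
  rewrite ler_wpM2l ?mulr_ge0 ?sqr_ge0//; apply: (le_trans step4).
  by rewrite ler_wpM2l.
by rewrite expr2; lra.
Qed.

End MeanValue.

(** * Growth of the generalized integers *)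

Section Counting.
Variables (R : realType) (theta A K : R).
Hypotheses (theta_ge0 : 0 <= theta) (theta_lt1 : theta < 1) (A_gt0 : 0 < A).

Lemma ler_powR_1 (x y : R) : 1 <= x -> y <= 1 -> x `^ y <= x.
Proof. by move=> x1 y1; rewrite -[leRHS]powRr1 ?(le_trans ler01)// ler_powR. Qed.

Section OneSystem.
Variable B : beurling R.
Hypothesis wb : well_behaved theta A K B.
Let n := bint B.

Lemma wb_K_ge0 : 0 <= K.
Proof. by have := wb (lexx 1); rewrite powR1 mulr1; apply: le_trans; exact: normr_ge0. Qed.

Lemma bint_unbounded (x : R) : exists k, x < n k.
Proof.
apply: contrapT => H.
have {}H k : n k <= x by rewrite leNgt; apply/negP => h; apply: H; exists k.
pose k0 := K / A + 1.
have KA : 0 <= K / A by rewrite divr_ge0 ?wb_K_ge0// ltW.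
have k01 : 1 <= k0 by rewrite /k0 lerDr.
pose y := Num.max x (Num.max 1 (k0 `^ (1 - theta)^-1)).
have y1 : 1 <= y by rewrite /y !le_max lexx orbT.
have y0 : 0 < y by exact: lt_le_trans y1.
have xy : x <= y by rewrite /y le_max lexx.
have yk : k0 <= y `^ (1 - theta).
  have t0 : 0 < 1 - theta by rewrite subr_gt0.
  have -> : k0 = (k0 `^ (1 - theta)^-1) `^ (1 - theta).
    by rewrite -powRrM mulVf ?gt_eqF// powRr1// (le_trans ler01 k01).
  apply: ge0_ler_powR; rewrite ?nnegrE ?powR_ge0 ?(ltW t0) ?(ltW y0)//.
  by rewrite /y !le_max lexx !orbT.
(* If [bint] is bounded, the set counted is infinite and the sum over it is 0 by convention,
   although [A * y] exceeds the error term. *)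
have b0 : bcount B y = 0.
  rewrite /bcount no_finite_support ?big_nil//.
  rewrite (_ : _ `&` _ = setT); first exact: infinite_nat.
  apply/seteqP; split => // k _; split => /=; first exact: le_trans (H k) xy.
  by apply/eqP; exact: oner_neq0.
have := wb y1; rewrite b0 sub0r normrN gtr0_norm ?mulr_gt0// => h.
have : y = y `^ (1 - theta) * y `^ theta.
  by rewrite -powRD ?subrK ?powRr1// ?(ltW y0)// (gt_eqF y0) implybT.
have yt : 0 < y `^ theta by exact: powR_gt0.
move=> e; rewrite {1}e mulrA ler_pM2r// in h.
have : K < A * y `^ (1 - theta).
  apply: (@lt_le_trans _ _ (A * k0)); last by rewrite ler_pM2l.
  by rewrite /k0 mulrDr mulr1 mulrC divfK ?gt_eqF// ltrDl.
by rewrite ltNge h.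
Qed.

Lemma bcount_nat (x : R) : exists N, bcount B x = N%:R /\ forall k, (n k <= x) = (k < N)%N.
Proof.
have ex : exists k, x < n k := bint_unbounded x.
pose N := ex_minn ex; exists N.
have NP k : (n k <= x) = (k < N)%N.
  rewrite /N; case: ex_minnP => N' h1 h2; apply/idP/idP => h.
    rewrite ltnNge; apply/negP => h3.
    by have := le_trans (bint_nondecreasing B h3) h; rewrite leNgt h1.
  by rewrite leNgt; apply/negP => /h2; rewrite leqNgt h.
split => //; rewrite /bcount (_ : [set k | _] = `I_N); last first.
  by apply/seteqP; split => k /=; rewrite -/(n k) NP.
by rewrite -fsbig_ord sumr_const card_ord.
Qed.

Lemma bint_ge_linear k : k.+1%:R <= (A + K) * n k.
Proof.
have [N [e NP]] := bcount_nat (n k).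
have kN : (k < N)%N by rewrite -NP.
have n1 : 1 <= n k := bint_ge1 B k.
have := wb n1; rewrite e ler_norml => /andP[_ h].
have h2 := ler_wpM2l wb_K_ge0 (ler_powR_1 n1 (ltW theta_lt1)).
have : (k.+1%:R : R) <= N%:R by rewrite ler_nat.
lra.
Qed.

(** Because of ties, [bcount] at [bint B k] may exceed [k]; it is evaluated just below that point,
    where it is at most [k]. *)
Lemma bint_le_linear k : (0 < k)%N -> A * n k <= k%:R + K * n k `^ theta.
Proof.
move=> k0; rewrite leNgt; apply/negP => h.
have n1 : 1 < n k := bint_gt1 B k0.
pose r := (k%:R + K * n k `^ theta) / A.
have rn : r < n k by rewrite /r ltr_pdivrMr// [ltRHS]mulrC.
pose x := Num.max 1 ((r + n k) / 2).
have xn : x < n k by rewrite /x gt_max n1 /=; lra.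
have x1 : 1 <= x by rewrite /x le_max lexx.
have rx : r < x by rewrite /x lt_max; apply/orP; right; lra.
have [N [e NP]] := bcount_nat x.
have Nk : (N <= k)%N by rewrite leqNgt -NP -ltNge.
have := wb x1; rewrite e ler_norml => /andP[h1 _].
have : (N%:R : R) <= k%:R by rewrite ler_nat.
have : K * x `^ theta <= K * n k `^ theta.
  apply: ler_wpM2l; first exact: wb_K_ge0.
  by apply: ge0_ler_powR => //; rewrite ?nnegrE ?(le_trans ler01 (ltW n1)) ?(le_trans ler01)// ltW.
move: rx; rewrite /r ltr_pdivrMr// => h2 h3 h4; lra.
Qed.

Lemma bint_interval_count (y y' : R) P : 1 <= y -> y <= y' ->
  (#|[pred q : 'I_P | y < n q <= y']|)%:R <= A * (y' - y) + 2 * K * y' `^ theta.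
Proof.
move=> y1 yy'; have y1' := le_trans y1 yy'.
have [N [e NP]] := bcount_nat y; have [N' [e' NP']] := bcount_nat y'.
have NN : (N <= N')%N.
  rewrite leqNgt; apply/negP; rewrite -NP => h1.
  by have := le_trans h1 yy'; rewrite NP' ltnn.
have : (#|[pred q : 'I_P | (y < n q <= y')%R]| <= N' - N)%N.
  rewrite -(size_iota N (N' - N)) cardE -(size_map val); apply: uniq_leq_size.
    by rewrite map_inj_uniq ?enum_uniq//; exact: val_inj.
  move=> q /mapP[q']; rewrite mem_enum inE ltNge NP NP' -leqNgt => /andP[h1 h2] ->.
  by rewrite mem_iota h1 subnKC.
rewrite -(ler_nat R) natrB// => h.
have := wb y1; rewrite e ler_norml => /andP[h1 _].
have := wb y1'; rewrite e' ler_norml => /andP[_ h2].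
have : K * y `^ theta <= K * y' `^ theta.
  apply: ler_wpM2l; first exact: wb_K_ge0.
  by apply: ge0_ler_powR => //; rewrite ?nnegrE ?(le_trans ler01).
lra.
Qed.

End OneSystem.

(** Inversion of the counting hypothesis: the [k]-th integer is [k / A] up to a multiple of
    [k ^ theta]. [C] is fixed before the system, hence the use of [|K|]: that [K] is nonnegative is
    known only from a system. *)
Lemma bint_asymptotics : exists2 C : R, 1 <= C & forall B, well_behaved theta A K B ->
  (forall k, k.+1%:R <= C * bint B k) /\
  (forall k, (0 < k)%N -> bint B k <= C * k%:R /\ `|A * bint B k - k%:R| <= C * k%:R `^ theta).
Proof.
(* Above [c0] the error [K * y ^ theta] is at most [A / 2 * y]; below it a constant bound
   suffices. *)
pose c0 := (2 * `|K| / A) `^ (1 - theta)^-1.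
have c00 : 0 <= c0 by exact: powR_ge0.
have A2 : 0 <= 2 / A by rewrite divr_ge0// ltW.
have [C1 [C11 C1A C1c]] : exists C1, [/\ 1 <= C1, 2 / A <= C1 & c0 <= C1].
  by exists (2 / A + c0 + 1); split; lra.
have K0 := normr_ge0 K.
have [D0 D0E] : exists D0 : R, D0 = `|K| * C1 `^ theta by eexists.
have KC : 0 <= D0 by rewrite D0E mulr_ge0// powR_ge0.
have [C [C_1 CK1 CC1 CD0]] : exists C, [/\ 1 <= C, A + `|K| <= C, C1 <= C & D0 <= C].
  exists (1 + (A + `|K|) + C1 + D0); move: `|K| K0 A_gt0 KC C11 => k k0 a0 d0 c1.
  by clear -k0 a0 d0 c1; split; lra.
exists C => // B wb.
have KK : `|K| = K by rewrite ger0_norm//; exact: wb_K_ge0 wb.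
have n1 k := bint_ge1 B k.
split.
  move=> k; apply: (le_trans (bint_ge_linear wb k)).
  by rewrite ler_wpM2r ?(le_trans ler01 (n1 k))// -KK.
move=> k k0; have k1 : 1 <= k%:R :> R by rewrite ler1n.
have hn := bint_le_linear wb k0.
set y := bint B k in hn *; have y1 : 1 <= y := n1 k.
have y0 : 0 < y by lra.
have t0 : 0 < 1 - theta by rewrite subr_gt0.
have ey : y = y `^ (1 - theta) * y `^ theta.
  by rewrite -powRD ?subrK ?powRr1// ?(ltW y0)// (gt_eqF y0) implybT.
have yt : 0 < y `^ theta by exact: powR_gt0.
have yC1 : y <= C1 * k%:R.
  have [h|h] := leP (K * y `^ theta) (A / 2 * y).
    have : y <= 2 / A * k%:R by rewrite mulrAC ler_pdivlMr//; lra.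
    by move=> h2; apply: (le_trans h2); rewrite ler_wpM2r ?(le_trans ler01).
  have {}h : A / 2 * y `^ (1 - theta) < K by rewrite -(ltr_pM2r yt) -(mulrA (A / 2)) -ey.
  have hy : y <= c0.
    rewrite -[leLHS]powRr1 ?(ltW y0)// -(divff (x := 1 - theta)) ?gt_eqF// powRrM.
    apply: ge0_ler_powR; rewrite ?nnegrE ?invr_ge0 ?(ltW t0) ?powR_ge0//.
      by rewrite divr_ge0 ?mulr_ge0// ltW.
    by rewrite ler_pdivlMr// KK; lra.
  apply: (le_trans hy); apply: (@le_trans _ _ (C1 * 1)); first by rewrite mulr1.
  by rewrite ler_wpM2l//; lra.
have yt2 : K * y `^ theta <= D0 * k%:R `^ theta.
  rewrite D0E KK -mulrA -powRM ?(le_trans ler01 k1) ?(le_trans ler01 C11)//.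
  apply: ler_wpM2l; first by rewrite -KK.
  by apply: ge0_ler_powR => //; rewrite ?nnegrE ?(ltW y0)// mulr_ge0 ?(le_trans ler01).
have kt : 0 <= k%:R `^ theta :> R by exact: powR_ge0.
have CK : D0 * k%:R `^ theta <= C * k%:R `^ theta.
  by rewrite ler_wpM2r.
split.
  by apply: (le_trans yC1); rewrite ler_wpM2r ?(le_trans ler01).
have [N [e NP]] := bcount_nat wb y.
have kN : (k < N)%N by rewrite -NP.
have := wb _ y1; rewrite e ler_norml => /andP[_ h2].
have : (k.+1%:R : R) <= N%:R by rewrite ler_nat.
rewrite -natr1 => h3.
rewrite ler_norml; apply/andP; split; lra.
Qed.

End Counting.

(** * Continuation of the zeta function *)

Section PowerFacts.
Variable R : realType.
Implicit Types (x y : R) (s : R[i]).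

Lemma cn_cpow x s : 0 < x -> cn (cpow x s) = x `^ complex.Re s.
Proof.
move=> x0; rewrite cpowE// cn_cexp cReM /= mulr0 subr0 /powR gt_eqF//.
Qed.

Lemma cpowM x y s : 0 < x -> 0 < y -> cpow (x * y) s = cpow x s * cpow y s.
Proof.
move=> x0 y0; rewrite !cpowE ?mulr_gt0// lnM ?posrE// rmorphD mulrDr cexpD//.
Qed.

Lemma cpow1 s : cpow 1 s = 1.
Proof. by rewrite cpowE// ln1 mulr0 cexp0. Qed.

Lemma cderivable_cpow x (f : R[i] -> R[i]) s : 0 < x -> cderivable f s ->
  cderivable (fun w => cpow x (f w)) s.
Proof.
move=> x0 df.
apply: (@cderivable_near R (fun w => cexp (f w * (ln x)%:C)) _ s 1 ltr01).
  by move=> w _; rewrite cpowE.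
apply: (@cderivable_comp R (@cexp R) (fun w => f w * (ln x)%:C)).
  exact: cderivableM df (cderivable_cst _ _).
exact: cderivable_cexp.
Qed.

Lemma ln1DV_ge x : 0 < x -> (x + 1)^-1 <= ln (1 + x^-1).
Proof.
move=> x0; have x10 : 0 < x + 1 by lra.
have e : 1 + x^-1 = (1 + - (x + 1)^-1)^-1 by field; rewrite !gt_eqF//; lra.
have h : -1 < - (x + 1)^-1 by rewrite ltrN2 invf_lt1//; lra.
have h0 : 0 < 1 + - (x + 1)^-1 by lra.
have := le_ln1Dx h; rewrite e lnV ?posrE//; lra.
Qed.

Lemma ln1DV_le x : 0 < x -> ln (1 + x^-1) <= x^-1.
Proof.
by move=> x0; apply: le_ln1Dx; apply: (@lt_trans _ _ 0); rewrite ?invr_gt0// ltrN10.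
Qed.

(** Plays the part of comparing a sum with an integral; it rests on
    [ln (1 + 1 / x) >= 1 / (x + 1)]. *)
Lemma powR_telescope x (eta : R) : 0 < x -> 0 < eta ->
  (x + 1) `^ (- 1 - eta) <= (x `^ (- eta) - (x + 1) `^ (- eta)) / eta.
Proof.
move=> x0 e0; have x10 : 0 < x + 1 by lra.
have nz : x + 1 != 0 by rewrite gt_eqF.
rewrite ler_pdivlMr//.
have -> : x `^ (- eta) = (x + 1) `^ (- eta) * expR (eta * ln (1 + x^-1)).
  rewrite /powR !gt_eqF// -expRD; congr expR.
  have -> : 1 + x^-1 = (x + 1) / x by field; rewrite gt_eqF.
  by rewrite ln_div ?posrE//; ring.
have -> : (x + 1) `^ (- 1 - eta) = (x + 1) `^ (- eta) * (x + 1)^-1.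
  by rewrite [- 1 - eta]addrC powRD ?nz ?implybT// powR_inv1// ltW.
have p0 : 0 <= (x + 1) `^ (- eta) by exact: powR_ge0.
rewrite -[X in _ <= _ - X]mulr1 -mulrBr -mulrA; apply: ler_wpM2l => //.
have h := expR_ge1Dx (eta * ln (1 + x^-1)).
have h2 := ler_wpM2l (ltW e0) (ln1DV_ge x0).
by rewrite mulrC; lra.
Qed.

Lemma powR_tail x (eta : R) : 1 <= x -> 0 < eta ->
  x `^ (- 1 - eta) <= 2 `^ (1 + eta) / eta * (x `^ (- eta) - (x + 1) `^ (- eta)).
Proof.
move=> x1 e0; have x0 : 0 < x by lra.
have x10 : 0 < x + 1 by lra.
apply: (@le_trans _ _ (2 `^ (1 + eta) * (x + 1) `^ (- 1 - eta))).
  have -> : - 1 - eta = - (1 + eta) by ring.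
  rewrite !powRN -[leLHS]mul1r ler_pdivrMr ?powR_gt0// mulrAC ler_pdivlMr ?powR_gt0//.
  rewrite mul1r -powRM ?(ltW x0)//; apply: ge0_ler_powR; rewrite ?nnegrE; lra.
rewrite mulrAC -mulrA ler_wpM2l ?powR_ge0//; exact: powR_telescope.
Qed.

Lemma powR_small (eta e : R) : 0 < eta -> 0 < e ->
  exists N, (0 < N)%N /\ forall m, (N <= m)%N -> m%:R `^ (- eta) <= e.
Proof.
move=> eta0 e0; pose t := (e^-1) `^ (eta^-1).
have t0 : 0 < t by rewrite powR_gt0// invr_gt0.
exists (Num.bound t).+1; split => // m hm.
have tm : t <= m%:R.
  apply: ltW; apply: (lt_le_trans (archi_boundP (ltW t0))).
  by rewrite ler_nat (leq_trans _ hm).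
have m0 : 0 < m%:R :> R by exact: lt_le_trans tm.
rewrite powRN -[leRHS]invrK lef_pV2 ?posrE ?powR_gt0 ?invr_gt0//.
have -> : e^-1 = t `^ eta.
  by rewrite /t -powRrM mulVf ?gt_eqF// powRr1// invr_ge0 ltW.
by apply: ge0_ler_powR; rewrite ?nnegrE ?(ltW eta0) ?(ltW t0) ?(ltW m0).
Qed.

End PowerFacts.

Section Continuation.
Variables (R : realType) (theta A K : R).
Hypotheses (theta_ge0 : 0 <= theta) (theta_lt1 : theta < 1) (A_gt0 : 0 < A).
Implicit Types (B : beurling R) (s : R[i]).

Definition dsum B m s : R[i] := \sum_(k < m) cpow (bint B k) (- s).

(** The terms from [m] on are modelled by the integral of [(u / A) ^ (- s)] over [u >= m], equal to
    [A * (m / A) ^ (1 - s) / (s - 1)]; multiplication by [s - 1] removes the pole. *)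
Definition zapp B m s : R[i] := (s - 1) * dsum B m s + A%:C * cpow (m%:R / A) (1 - s).

Lemma cderivable_dsum B m s : cderivable (dsum B m) s.
Proof.
apply: cderivable_sum => k _; apply: cderivable_cpow; first exact: bint_gt0.
exact: cderivableN (cderivable_id _).
Qed.

Lemma cderivable_zapp B m s : (0 < m)%N -> cderivable (zapp B m) s.
Proof.
move=> m0; apply: cderivableD.
  apply: cderivableM; last exact: cderivable_dsum.
  exact: cderivableB (cderivable_id _) (cderivable_cst _ _).
apply: cderivableM; first exact: cderivable_cst.
apply: cderivable_cpow; first by rewrite divr_gt0// ltr0n.
exact: cderivableB (cderivable_cst _ _) (cderivable_id _).
Qed.

(** The exponent of [m] is below -1, so the steps are summable throughout the half-plane right of
    [theta]. [Smax] bounds the real part so that factors like [A ^ complex.Re s] are constants. *)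
Lemma zapp_step (Smax : R) : exists2 E : R, 0 < E & forall B, well_behaved theta A K B ->
  forall s m, (0 < m)%N -> theta < complex.Re s <= Smax ->
  cn (zapp B m.+1 s - zapp B m s) <= E * (1 + cn s) ^+ 2 * m%:R `^ (theta - complex.Re s - 1).
Proof.
have [C C1 HC] := bint_asymptotics K theta_ge0 theta_lt1 A_gt0.
have C0 : 0 < C by lra.
pose Q := Num.max 1 (C / A); pose QS := Q `^ Num.max 0 Smax.
pose Q2 := Num.max 1 A `^ Num.max 0 Smax.
have Q1 : 1 <= Q by rewrite le_max lexx.
have QS1 : 1 <= QS by rewrite -[leLHS](powRr0 Q) ler_powR// le_max lexx.
have Q21 : 1 <= Q2 by rewrite -[leLHS](powRr0 (Num.max 1 A)) ler_powR// le_max lexx.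
pose k1 := 3 * (C / A * (C + A)) * QS + 9.
have k10 : 0 < k1 by rewrite /k1; pos.
exists (Q2 * k1); first by rewrite mulr_gt0//; lra.
move=> B wb s m m0 /andP[ts sS].
have [hl hu] := HC B wb; have [hu1 hu2] := hu m m0; have {}hl := hl m.
pose M : R := m%:R; pose n := bint B m; pose y := M / A; pose sg := complex.Re s.
rewrite -/M -/n in hl hu1 hu2.
have M1 : 1 <= M by rewrite /M ler1n.
have M0 : 0 < M by lra.
have n0 : 0 < n by exact: bint_gt0.
have y0 : 0 < y by rewrite divr_gt0.
have sg0 : 0 <= sg by apply: ltW; exact: le_lt_trans ts.
pose L1 := ln (1 + M^-1); pose w := (1 - s) * L1%:C.
pose N := cpow n (- s); pose Y := cpow y (- s).
have L10 : 0 <= L1 by apply: ln_ge0; rewrite lerDl invr_ge0 ltW.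
have L1u : L1 <= M^-1 by exact: ln1DV_le.
have L1l : (M + 1)^-1 <= L1 by exact: ln1DV_ge.
have e1 : cpow (m.+1%:R / A) (1 - s) = cpow y (1 - s) * cexp w.
  have -> : m.+1%:R / A = y * (1 + M^-1).
    by rewrite -natr1 /y -/M; field; rewrite !gt_eqF.
  have h0 : 0 < 1 + M^-1 by rewrite addr_gt0// invr_gt0.
  by rewrite cpowM// (cpowE _ h0).
have e2 : A%:C * cpow y (1 - s) = M%:C * Y.
  have -> : cpow y (1 - s) = y%:C * Y.
    rewrite /Y !cpowE// mulrDl mul1r cexpD; congr (_ * _).
    by rewrite /cexp /= cos0 sin0 mulr1 mulr0 lnK ?posrE.
  by rewrite mulrA -rmorphM /y /= [A * _]mulrC divfK ?gt_eqF.
have -> : zapp B m.+1 s - zapp B m s =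
   (s - 1) * (N - Y) + (s - 1) * Y * (1 - M * L1)%:C + M%:C * Y * (cexp w - 1 - w).
  rewrite /zapp /dsum big_ord_recr /= -/N e1 -/M -/y mulrA e2.
  rewrite rmorphB rmorphM rmorph1 /= /w; ring.
have cY : cn Y = y `^ (- sg) by rewrite cn_cpow// cReN.
have yM : y `^ (- sg) <= Q2 * M `^ (- sg).
  rewrite /y powRM ?invr_ge0 ?(ltW M0) ?(ltW A_gt0)// mulrC ler_wpM2r ?powR_ge0//.
  rewrite -powR_inv1 ?(ltW A_gt0)// -powRrM mulrNN mul1r /Q2.
  apply: (@le_trans _ _ (Num.max 1 A `^ sg)).
    apply: ge0_ler_powR; rewrite ?nnegrE ?le_max ?ler01 ?(ltW A_gt0) ?lexx ?orbT//.
  by apply: ler_powR; rewrite ?le_max ?lexx// sS orbT.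
have S10 : 0 <= cn s := cn_ge0 s; set S1 := 1 + cn s.
have S11 : 1 <= S1 by rewrite /S1; lra.
have cs1 : cn (s - 1) <= S1 by apply: (le_trans (cnB _ _)); rewrite cn1 addrC.
have cs1' : cn (1 - s) <= S1 by rewrite cn_sym.
have Mt : M^-1 <= M `^ (theta - 1).
  by rewrite -powR_inv1 ?(ltW M0)//; apply: ler_powR; rewrite ?lerBrDr ?addNr.
have Mt0 : 0 <= M `^ (theta - 1) by exact: powR_ge0.
have Yp : 0 <= y `^ (- sg) by exact: powR_ge0.
have T1 : cn ((s - 1) * (N - Y)) <=
   y `^ (- sg) * (S1 ^+ 2 * (3 * (C / A * (C + A)) * QS * M `^ (theta - 1))).
  pose dl := ln n - ln y.
  have -> : N - Y = Y * (cexp (- s * dl%:C) - 1).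
    have -> : N = Y * cexp (- s * dl%:C).
      rewrite /N /Y !cpowE// -cexpD -mulrDr -rmorphD /= /dl.
      by rewrite addrCA subrr addr0.
    ring.
  have dlb : `|dl| <= C / A * (C + A) * M `^ (theta - 1).
    have ny : `|n - y| <= C / A * M `^ theta.
      have -> : n - y = (A * n - M) / A by rewrite /y; field; rewrite gt_eqF.
      rewrite normrM normfV (gtr0_norm A_gt0) mulrAC ler_wpM2r// invr_ge0 ltW//.
    have h1 : `|dl| <= `|n - y| * (n^-1 + y^-1).
      have q0 : 0 < n / y by rewrite divr_gt0.
      have i0 : 0 < n^-1 by rewrite invr_gt0.
      have j0 : 0 < y^-1 by rewrite invr_gt0.
      have a1 : dl <= (n - y) * y^-1.
        have := @le_ln1Dx _ (n / y - 1); rewrite [1 + _]addrC subrK ln_div ?posrE//.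
        have -> : n / y - 1 = (n - y) * y^-1 by field; rewrite gt_eqF.
        apply; have : (n - y) * y^-1 = n / y - 1 by field; rewrite gt_eqF.
        by move=> ->; lra.
      have a2 : - dl <= (y - n) * n^-1.
        have q1 : 0 < y / n by rewrite divr_gt0.
        have := @le_ln1Dx _ (y / n - 1); rewrite [1 + _]addrC subrK ln_div ?posrE//.
        have e3 : y / n - 1 = (y - n) * n^-1 by field; rewrite gt_eqF.
        rewrite /dl opprB -e3; apply; lra.
      have b1 := ler_norm (n - y); have b2 := ler_norm (- (n - y)); rewrite normrN in b2.
      have c1 := ler_wpM2r (ltW j0) b1; have c2 := ler_wpM2r (ltW i0) b2.
      have c3 := mulr_ge0 (normr_ge0 (n - y)) (ltW i0).
      have c4 := mulr_ge0 (normr_ge0 (n - y)) (ltW j0).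
      rewrite mulrDr ler_norml; apply/andP; split; lra.
    apply: (le_trans h1).
    have h2 : n^-1 + y^-1 <= (C + A) * M^-1.
      rewrite mulrDl; apply: lerD.
        rewrite -[leLHS]mul1r ler_pdivrMr// mulrAC ler_pdivlMr// mul1r.
        by apply: le_trans hl; rewrite -natr1 /M lerDl.
      by rewrite /y invf_div.
    have -> : C / A * (C + A) * M `^ (theta - 1) = C / A * M `^ theta * ((C + A) * M^-1).
      rewrite powRD ?(gt_eqF M0) ?implybT// powR_inv1 ?(ltW M0)//; ring.
    apply: ler_pM => //.
    by rewrite addr_ge0// invr_ge0 ltW.
  rewrite !cnM cY.
  have e4 : cn (cexp (- s * dl%:C) - 1) <= 3 * (cn s * `|dl|) * QS.
    apply: (le_trans (cexp_sub1_norm _)); rewrite cnM cnN cn_real.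
    rewrite ler_wpM2l ?mulr_ge0 ?cn_ge0// ge_max QS1 /= cReM cReN /= mulr0 subr0 -/sg.
    have -> : expR (- sg * dl) = (y / n) `^ sg.
      rewrite /powR gt_eqF ?divr_gt0// ln_div ?posrE//; congr expR; rewrite /dl; ring.
    apply: (@le_trans _ _ (Q `^ sg)).
      apply: ge0_ler_powR; rewrite ?nnegrE ?(le_trans ler01 Q1) ?divr_ge0 ?(ltW y0) ?(ltW n0) ?(ltW M0) ?(ltW A_gt0)//.
      rewrite /Q le_max; apply/orP; right.
      rewrite /y -mulrA -invfM ler_pdivrMr ?mulr_gt0//.
      have -> : C / A * (A * n) = C * n by field; rewrite gt_eqF.
      by apply: le_trans hl; rewrite -natr1 /M lerDl.
    by apply: ler_powR => //; rewrite le_max sS orbT.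
  have e5 : cn s * `|dl| <= S1 * (C / A * (C + A) * M `^ (theta - 1)).
    by apply: ler_pM => //; rewrite /S1; lra.
  rewrite mulrCA ler_wpM2l//.
  apply: (@le_trans _ _ (S1 * (3 * (S1 * (C / A * (C + A) * M `^ (theta - 1))) * QS))).
    apply: ler_pM; rewrite ?cn_ge0//; apply: (le_trans e4).
    rewrite ler_wpM2r ?(le_trans ler01 QS1)// ler_wpM2l//.
  apply: eq_ler; ring.
have T2 : cn ((s - 1) * Y * (1 - M * L1)%:C) <= y `^ (- sg) * (S1 ^+ 2 * M `^ (theta - 1)).
  rewrite !cnM cY cn_real mulrAC mulrC -mulrA ler_wpM2l//.
  have h1 : `|1 - M * L1| <= M^-1.
    have a1 : M * L1 <= 1 by have := ler_wpM2l (ltW M0) L1u; rewrite divff ?gt_eqF.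
    rewrite ger0_norm; last by lra.
    have a2 := ler_wpM2l (ltW M0) L1l.
    have a3 : 1 - M * (M + 1)^-1 = (M + 1)^-1 by field; rewrite gt_eqF//; lra.
    have a4 : (M + 1)^-1 <= M^-1 by rewrite lef_pV2 ?posrE//; lra.
    lra.
  apply: (@le_trans _ _ (S1 * M `^ (theta - 1))).
    by rewrite ler_pM ?cn_ge0// (le_trans h1).
  by rewrite ler_peMl// mulr_ge0//; lra.
have T3 : cn (M%:C * Y * (cexp w - 1 - w)) <= y `^ (- sg) * (8 * (S1 ^+ 2 * M `^ (theta - 1))).
  rewrite !cnM cY cn_real (gtr0_norm M0) [M * _]mulrC -mulrA ler_wpM2l//.
  have cw : cn w <= S1 * M^-1.
    by rewrite cnM cn_real (ger0_norm L10) ler_pM ?cn_ge0.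
  apply: (@le_trans _ _ (M * (4 * (S1 * M^-1) ^+ 2 * 2))).
    rewrite ler_wpM2l ?(ltW M0)//; apply: (le_trans (cexp_sub1x_norm _)).
    apply: ler_pM; [by pos|by rewrite le_max ler01| |].
      apply: ler_wpM2l => //; apply: lerXn2r; rewrite ?nnegrE ?cn_ge0//.
      exact: le_trans (cn_ge0 w) cw.
    rewrite ge_max ler1n /= cReM cReD cReN /= mulr0 subr0 -/sg.
    apply: (@le_trans _ _ (expR L1)).
      by rewrite ler_expR ler_piMl//; lra.
    rewrite lnK ?posrE ?addr_gt0 ?invr_gt0//.
    have : M^-1 <= 1 by rewrite invf_le1.
    lra.
  have -> : M * (4 * (S1 * M^-1) ^+ 2 * 2) = 8 * (S1 ^+ 2 * M^-1).
    by field; rewrite gt_eqF.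
  by rewrite ler_wpM2l// ler_wpM2l ?sqr_ge0.
apply: (le_trans (cnD _ _)); apply: (le_trans (lerD (cnD _ _) T3)).
apply: (le_trans (lerD (lerD T1 T2) (lexx _))).
have -> : M `^ (theta - complex.Re s - 1) = M `^ (- sg) * M `^ (theta - 1).
  by rewrite -powRD ?(gt_eqF M0) ?implybT//; congr (_ `^ _); rewrite /sg; ring.
have -> : Q2 * k1 * S1 ^+ 2 * (M `^ (- sg) * M `^ (theta - 1)) =
   (Q2 * M `^ (- sg)) * (k1 * S1 ^+ 2 * M `^ (theta - 1)) by ring.
apply: (@le_trans _ _ (y `^ (- sg) * (k1 * S1 ^+ 2 * M `^ (theta - 1)))).
  by apply: eq_ler; rewrite /k1; ring.
by rewrite ler_wpM2r//; pos.
Qed.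

Lemma zapp_cauchy (Smax : R) : exists2 E : R, 0 < E & forall B, well_behaved theta A K B ->
  forall s m l, (0 < m <= l)%N -> theta < complex.Re s <= Smax ->
  cn (zapp B l s - zapp B m s) <=
    E * (1 + cn s) ^+ 2 / (complex.Re s - theta) * m%:R `^ (theta - complex.Re s).
Proof.
have [E E0 HE] := zapp_step Smax.
exists (E * 2 `^ (1 + Num.max 0 Smax)); first by rewrite mulr_gt0 ?powR_gt0.
move=> B wb s m l /andP[m0 ml] hs; have [ts sS] := andP hs.
set eta := complex.Re s - theta; have eta0 : 0 < eta by rewrite subr_gt0.
pose F := E * (1 + cn s) ^+ 2 * (2 `^ (1 + eta) / eta).
have F0 : 0 <= F by rewrite /F; pos.
have key : cn (zapp B l s - zapp B m s) <= F * (m%:R `^ (- eta) - l%:R `^ (- eta)).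
  elim: l ml => [|l IH]; first by rewrite leqn0 => /eqP mz; rewrite mz in m0.
  rewrite leq_eqVlt => /orP[/eqP ->|ml]; first by rewrite !subrr cn0 mulr0.
  have {}IH := IH ml.
  have l0 : (0 < l)%N by exact: (leq_trans m0 ml).
  have st := HE B wb s l l0 hs.
  have -> : zapp B l.+1 s - zapp B m s = (zapp B l.+1 s - zapp B l s) + (zapp B l s - zapp B m s) by ring.
  apply: (le_trans (cnD _ _)).
  have l1 : 1 <= l%:R :> R by rewrite ler1n.
  have pt := powR_tail l1 eta0.
  rewrite (_ : theta - complex.Re s - 1 = - 1 - eta) in st; last by rewrite /eta; ring.
  have E1 : 0 <= E * (1 + cn s) ^+ 2 by pos.
  have h : E * (1 + cn s) ^+ 2 * l%:R `^ (- 1 - eta) <= F * (l%:R `^ (- eta) - l.+1%:R `^ (- eta)).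
    have -> : F * (l%:R `^ (- eta) - l.+1%:R `^ (- eta)) = E * (1 + cn s) ^+ 2 *
      (2 `^ (1 + eta) / eta * (l%:R `^ (- eta) - (l%:R + 1) `^ (- eta))).
      by rewrite /F natr1 !mulrA.
    exact: (ler_wpM2l E1 pt).
  apply: (le_trans (lerD st IH)); apply: (le_trans (lerD h (lexx _))).
  by rewrite -mulrDr [X in _ * X](_ : _ = m%:R `^ (- eta) - l.+1%:R `^ (- eta)) //; ring.
apply: (le_trans key); rewrite (_ : theta - complex.Re s = - eta); last by rewrite /eta; ring.
apply: (@le_trans _ _ (F * m%:R `^ (- eta))).
  by rewrite ler_wpM2l// gerBl powR_ge0.
rewrite ler_wpM2r ?powR_ge0// /F.
have -> : E * 2 `^ (1 + Num.max 0 Smax) * (1 + cn s) ^+ 2 / eta =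
   E * (1 + cn s) ^+ 2 * (2 `^ (1 + Num.max 0 Smax) / eta) by ring.
apply: ler_wpM2l; first by pos.
apply: ler_wpM2r; first by pos.
apply: ler_powR; first by rewrite ler1n.
by rewrite lerD2l le_max; apply/orP; right; rewrite /eta; move: theta_ge0; lra.
Qed.

(* [zg B s] is [(s - 1) * zeta s], extended to [s = 1]. *)
Definition zg B s : R[i] := xget 0 [set l | forall e : R, 0 < e ->
  exists N, forall m, (N <= m)%N -> cn (zapp B m s - l) <= e].

Lemma zg_approx (Smax : R) : exists2 E : R, 0 < E & forall B, well_behaved theta A K B ->
  forall s m, (0 < m)%N -> theta < complex.Re s <= Smax ->
  cn (zapp B m s - zg B s) <=
    E * (1 + cn s) ^+ 2 / (complex.Re s - theta) * m%:R `^ (theta - complex.Re s).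
Proof.
have [E E0 HE] := zapp_cauchy Smax; exists E => // B wb s m m0 hs.
have [ts sS] := andP hs.
pose F := E * (1 + cn s) ^+ 2 / (complex.Re s - theta).
have eta0 : 0 < complex.Re s - theta by rewrite subr_gt0.
have F0 : 0 <= F by rewrite /F; pos.
have F1 : 0 < F + 1 by lra.
pose c k := F * k%:R `^ (theta - complex.Re s).
have c0 k : 0 <= c k by rewrite mulr_ge0// powR_ge0.
have c_small e : 0 < e -> exists N, (0 < N)%N /\ forall m, (N <= m)%N -> c m <= e.
  move=> e0; have [|N [N0 HN]] := @powR_small R (complex.Re s - theta) (e / (F + 1)) eta0.
    by rewrite divr_gt0.
  exists N; split => // k /HN; rewrite opprB ler_pdivlMr// => h; rewrite /c.
  by have := powR_ge0 (k%:R : R) (theta - complex.Re s); lra.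
have [l Hl] : exists l, forall k, cn (zapp B k.+1 s - l) <= 2 * c k.+1.
  apply: (@complex_limit R (fun k => zapp B k.+1 s) (fun k => c k.+1)) => k j.
  have [kj|jk] := leqP k j.
    rewrite cn_sym; apply: (le_trans (HE B wb s k.+1 j.+1 _ hs)) => //.
    by rewrite lerDl.
  apply: (le_trans (HE B wb s j.+1 k.+1 _ hs)); first by rewrite /= ltnW.
  by rewrite lerDr.
have ex : exists l, forall e : R, 0 < e -> exists N, forall m, (N <= m)%N -> cn (zapp B m s - l) <= e.
  exists l => e e0; have [|N [N0 HN]] := c_small (e / 2); first by rewrite divr_gt0.
  exists N => -[|k] hk; first by move: (leq_trans N0 hk).
  by apply: (le_trans (Hl k)); have := HN _ hk; lra.
have zgP := @xgetPex _ (0 : R[i]) [set l | forall e : R, 0 < e ->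
  exists N, forall m, (N <= m)%N -> cn (zapp B m s - l) <= e] ex.
apply/ler_addgt0Pr => e e0; have [N HN] := zgP e e0.
(* Comparison with a far index recovers the Cauchy bound itself, without the factor 2 lost in
   [complex_limit]. *)
pose k := maxn N m.
have -> : zapp B m s - zg B s = (zapp B k s - zg B s) - (zapp B k s - zapp B m s) by ring.
apply: (le_trans (cnB _ _)); rewrite addrC; apply: lerD.
  by apply: HE => //; rewrite m0 leq_maxr.
by apply: HN; rewrite leq_maxl.
Qed.

Lemma cderivable_zg B s : well_behaved theta A K B -> theta < complex.Re s -> cderivable (zg B) s.
Proof.
move=> wb ts; pose r := (complex.Re s - theta) / 2.
have r0 : 0 < r by rewrite divr_gt0// subr_gt0.
apply: (@weierstrass R _ s r r0) => e e0.
have [E E0 HE] := zg_approx (complex.Re s + r).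
pose F := E * (1 + (cn s + r)) ^+ 2 / r.
have F0 : 0 <= F by rewrite /F; pos.
have F1 : 0 < F + 1 by lra.
have [|N [N0 HN]] := @powR_small R r (e / (F + 1)) r0; first by rewrite divr_gt0.
exists (zapp B N) => w hw; first exact: cderivable_zapp.
have h1 := le_lt_trans (ler_Re_cn _) hw.
rewrite cReD cReN ltr_norml in h1; have [h2 h3] := andP h1.
have tw : r < complex.Re w - theta by rewrite /r in h2 *; lra.
apply: (le_trans (HE B wb w N N0 _)); first by apply/andP; split; lra.
apply: (@le_trans _ _ (F * (e / (F + 1)))); last first.
  by rewrite mulrCA ler_piMr ?(ltW e0)// ler_pdivrMr//; lra.
have c0 := cn_ge0 w.
have cw : cn w <= cn s + r.
  have -> : w = s + (w - s) by ring.
  by apply: (le_trans (cnD _ _)); rewrite lerD2l ltW.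
apply: ler_pM; rewrite ?powR_ge0//.
- by apply: mulr_ge0; [pos|rewrite invr_ge0; lra].
- apply: ler_pM; [by pos|by rewrite invr_ge0; lra| |].
    by rewrite ler_wpM2l ?(ltW E0)// lerXn2r ?nnegrE; lra.
  by rewrite lef_pV2 ?posrE//; lra.
- apply: le_trans (HN N (leqnn _)); apply: ler_powR; first by rewrite ler1n.
  lra.
Qed.

Lemma dsum_cvg B s (e : R) : well_behaved theta A K B -> 1 < complex.Re s -> 0 < e ->
  exists N, forall m, (N <= m)%N -> cn (dsum B m s - zg B s / (s - 1)) <= e.
Proof.
move=> wb s1 e0.
have sn1 : s - 1 != 0.
  by rewrite subr_eq0; apply: contraTneq s1 => -> /=; rewrite ltxx.
have c0 : 0 < cn (s - 1) by rewrite cn_gt0.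
have ts : theta < complex.Re s by exact: lt_trans s1.
have [E E0 HE] := zg_approx (complex.Re s).
pose F := E * (1 + cn s) ^+ 2 / (complex.Re s - theta).
have eta0 : 0 < complex.Re s - theta by rewrite subr_gt0.
have eta1 : 0 < complex.Re s - 1 by rewrite subr_gt0.
have F0 : 0 <= F by rewrite /F; pos.
pose G := A * A `^ (complex.Re s - 1).
have G0 : 0 <= G by rewrite mulr_ge0 ?powR_ge0// ltW.
pose e1 := e * cn (s - 1) / (F + G + 1).
have FG : 0 < F + G + 1 by lra.
have e10 : 0 < e1 by rewrite divr_gt0// mulr_gt0.
have [N1 [N10 H1]] := powR_small eta0 e10.
have [N2 [N20 H2]] := powR_small eta1 e10.
exists (maxn N1 N2) => m; rewrite geq_max => /andP[h1 h2].
have m0 : (0 < m)%N by exact: leq_trans N10 h1.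
have mR : 0 < m%:R :> R by rewrite ltr0n.
have -> : dsum B m s - zg B s / (s - 1) =
   (zapp B m s - zg B s - A%:C * cpow (m%:R / A) (1 - s)) / (s - 1).
  by rewrite /zapp; field.
rewrite cnM cnV ler_pdivrMr//; apply: (le_trans (cnB _ _)).
have := HE B wb s m m0; rewrite ts lexx => /(_ isT) g1.
have g2 : cn (A%:C * cpow (m%:R / A) (1 - s)) = G * m%:R `^ (- (complex.Re s - 1)).
  rewrite cnM cn_real (gtr0_norm A_gt0) cn_cpow ?divr_gt0// cReD cReN /=.
  rewrite powRM ?invr_ge0 ?(ltW mR) ?(ltW A_gt0)// opprB /G -powR_inv1 ?(ltW A_gt0)// -powRrM.
  have -> : -1 * (1 - complex.Re s) = complex.Re s - 1 by ring.
  ring.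
rewrite g2; have g3 := H1 m h1; have g4 := H2 m h2; rewrite opprB in g3.
have g5 := ler_wpM2l F0 g3; have g6 := ler_wpM2l G0 g4.
rewrite -/F in g1.
have g7 : (F + G + 1) * e1 = e * cn (s - 1) by rewrite mulrC /e1 divfK// gt_eqF.
lra.
Qed.

(** [bzeta] is an arbitrary choice among continuations: [zg / (s - 1)] shows that one exists, and
    the identity theorem that all agree right of [theta], apart from 1. *)
Lemma bzetaE B s : well_behaved theta A K B -> theta < complex.Re s -> s != 1 ->
  bzeta theta B s = zg B s / (s - 1).
Proof.
move=> wb ts s1.
pose Z w := zg B w / (w - 1).
have dZ w : theta < complex.Re w -> w != 1 -> cderivable Z w.
  move=> tw w1; apply: cderivableM; first exact: cderivable_zg.
  apply: cderivableV; first by rewrite subr_eq0.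
  exact: cderivableB (cderivable_id _) (cderivable_cst _ _).
have zc : zeta_continuation theta B Z.
  split => [w w1|w]; last exact: dZ.
  apply/cvg_cnP => e e0.
  have [|N HN] := dsum_cvg wb w1 (e := e / 2); first by rewrite divr_gt0.
  exists N => // m /= Nm; rewrite big_mkord; apply: (le_lt_trans (HN m Nm)).
  by lra.
have [z1 z2] := @xgetPex _ (fun=> 0 : R[i]) [set Z | zeta_continuation theta B Z] (ex_intro _ Z zc).
rewrite -/(bzeta theta B) in z1 z2.
apply/eqP; rewrite -subr_eq0; apply/eqP.
apply: (@identity_half_plane R (fun w => bzeta theta B w - Z w) theta theta_lt1 _ _ s ts s1).
  by move=> w tw w1; apply: cderivableB; [exact: z2|exact: dZ].
move=> w w1; apply/eqP; rewrite -cn_eq0 -normr_le0 ger0_norm ?cn_ge0//.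
apply/ler_addgt0Pr => e e0; rewrite add0r.
have [|N HN] := dsum_cvg wb w1 (e := e / 2); first by rewrite divr_gt0.
have /cvg_cnP/(_ (e / 2)) := z1 w w1; rewrite divr_gt0// => /(_ isT)[N' _ HN'].
pose m := maxn N N'.
have h1 := HN m (leq_maxl _ _).
have := HN' m (leq_maxr _ _); rewrite /= big_mkord -/(dsum B m w) => h2.
have -> : bzeta theta B w - Z w = (dsum B m w - Z w) - (dsum B m w - bzeta theta B w) by ring.
by apply: (le_trans (cnB _ _)); lra.
Qed.

End Continuation.

(** * Dirichlet sums over the generalized integers *)

Section Estimates.
Variables (R : realType) (theta A K : R).
Hypotheses (theta_ge0 : 0 <= theta) (theta_lt1 : theta < 1) (A_gt0 : 0 < A).
Implicit Types (B : beurling R) (s : R[i]).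

Lemma cn_cpow_le u s (x : R) : 1 <= u -> x <= complex.Re s -> cn (cpow u (- s)) <= u `^ (- x).
Proof.
move=> u1 xs; rewrite cn_cpow; last exact: lt_le_trans u1.
by rewrite cReN; apply: ler_powR => //; rewrite lerN2.
Qed.

Section OneSystem.
Variables (B : beurling R) (C : R).
Hypotheses (C_ge1 : 1 <= C) (n_ge : forall k, k.+1%:R <= C * bint B k).
Let n := bint B.

Lemma bint_ge_div k : k.+1%:R / C <= n k.
Proof. by rewrite ler_pdivrMr ?(lt_le_trans ltr01)// mulrC. Qed.

Lemma harmonic_bound m : (0 < m)%N -> \sum_(k < m) (n k)^-1 <= C * (1 + ln m%:R).
Proof.
have C0 : 0 < C by exact: lt_le_trans C_ge1.
case: m => // m _; elim: m => [|m IH].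
  by rewrite big_ord_recr big_ord0 /= add0r ln1 addr0 mulr1 /n bint0 invr1.
rewrite big_ord_recr /=; apply: (le_trans (lerD IH (lexx _))).
have m0 : 0 < m.+1%:R :> R by [].
have h : (n m.+1)^-1 <= C * (m.+1%:R + 1)^-1.
  have := bint_ge_div m.+1; rewrite -natr1 => h.
  rewrite -[leRHS]invrK invfM invrK mulrC lef_pV2 ?posrE ?bint_gt0// divr_gt0//.
apply: (le_trans (lerD (lexx _) h)); rewrite -mulrDr ler_wpM2l ?(ltW C0)// -addrA lerD2l.
rewrite -lerBrDl; apply: (le_trans (ln1DV_ge m0)).
have -> : 1 + m.+1%:R^-1 = m.+2%:R / m.+1%:R :> R.
  by rewrite -[m.+2%:R]natr1; field; rewrite gt_eqF.
by rewrite ln_div ?posrE.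
Qed.

Lemma power_sum_bound (eta : R) m : 0 < eta ->
  \sum_(k < m) n k `^ (- 1 - eta) <= C `^ (1 + eta) * (1 + eta^-1).
Proof.
move=> e0; have C0 : 0 < C by exact: lt_le_trans C_ge1.
have h1 k : n k `^ (- 1 - eta) <= C `^ (1 + eta) * k.+1%:R `^ (- 1 - eta).
  have -> : - 1 - eta = - (1 + eta) by ring.
  rewrite !powRN -[leLHS]mul1r ler_pdivrMr ?powR_gt0 ?bint_gt0// mulrAC ler_pdivlMr ?powR_gt0//.
  rewrite mul1r -powRM ?(ltW C0) ?(ltW (bint_gt0 B k))//.
  by apply: ge0_ler_powR; rewrite ?nnegrE ?mulr_ge0 ?(ltW C0) ?(ltW (bint_gt0 B k))//; lra.
apply: (@le_trans _ _ (\sum_(k < m) C `^ (1 + eta) * k.+1%:R `^ (- 1 - eta))).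
  by apply: ler_sum => k _; exact: h1.
rewrite -big_distrr ler_wpM2l ?powR_ge0//=.
case: m => [|m]; first by rewrite big_ord0; pos.
suff : \sum_(k < m.+1) k.+1%:R `^ (- 1 - eta) <= 1 + (1 - m.+1%:R `^ (- eta)) / eta.
  move=> h; apply: (le_trans h); rewrite lerD2l -[leRHS]mul1r ler_wpM2r ?invr_ge0 ?(ltW e0)//.
elim: m => [|m IH]; first by rewrite big_ord_recr big_ord0 /= add0r !powR1 subrr mul0r addr0.
rewrite big_ord_recr /=; apply: (le_trans (lerD IH (lexx _))).
have m0 : 0 < m.+1%:R :> R by [].
have := powR_telescope m0 e0; rewrite natr1 => h.
apply: (le_trans (lerD (lexx _) h)).
by rewrite -addrA lerD2l -mulrDl [X in X / _](_ : _ = 1 - m.+2%:R `^ (- eta))//; ring.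
Qed.

Variable mob : nat -> R.
Hypothesis mob_le1 : forall l, `|mob l| <= 1.

Definition mollsum x s : R[i] := \sum_(l < x) (mob l)%:C * cpow (n l) (- s).

Lemma cderivable_mollsum x s : cderivable (mollsum x) s.
Proof.
apply: cderivable_sum => k _; apply: cderivableM; first exact: cderivable_cst.
by apply: cderivable_cpow; [exact: bint_gt0|exact: cderivableN (cderivable_id _)].
Qed.

Lemma mollsum_le x s (y : R) : y <= complex.Re s -> cn (mollsum x s) <= \sum_(l < x) n l `^ (- y).
Proof.
move=> ys; apply: (le_trans (cn_sum _ _ _)); apply: ler_sum => l _.
rewrite cnM cn_real -[leRHS]mul1r; apply: ler_pM; rewrite ?cn_ge0//.
by apply: cn_cpow_le => //; exact: bint_ge1.
Qed.

(** Rankin's trick: bounding [n l ^ (1 - a)] by [n x ^ (1 - a)] leaves the harmonic sum. *)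
Lemma mollsum_strip_le x s (a : R) : (0 < x)%N -> a <= complex.Re s -> a <= 1 ->
  cn (mollsum x s) <= n x `^ (1 - a) * (C * (1 + ln x%:R)).
Proof.
move=> x0 as_ a1; apply: (le_trans (mollsum_le x as_)).
apply: (@le_trans _ _ (\sum_(l < x) n x `^ (1 - a) * (n l)^-1)); last first.
  by rewrite -big_distrr ler_wpM2l ?powR_ge0//; exact: harmonic_bound.
apply: ler_sum => l _; have l0 := bint_gt0 B l.
have -> : n l `^ (- a) = n l `^ (1 - a) * (n l)^-1.
  rewrite -(powR_inv1 (ltW l0)) -powRD ?(gt_eqF l0) ?implybT//; congr (_ `^ _).
  ring.
rewrite ler_wpM2r ?invr_ge0 ?(ltW l0)//.
apply: ge0_ler_powR; rewrite ?nnegrE ?subr_ge0 ?(ltW l0) ?(ltW (bint_gt0 B _))//.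
by apply: bint_nondecreasing; exact: ltnW.
Qed.

(** As all indices are at least [x], a factor [n j ^ (- eta)] is worth a multiple of [x ^ (- eta)];
    the remaining sum converges absolutely and is bounded by the squared majorant. *)
Lemma tail_sum_right x Y (b : nat -> R) m s (eta : R) : 0 < eta -> (0 < x)%N ->
  1 + 2 * eta <= complex.Re s ->
  (forall phi : R -> R, (forall u, 0 < u -> 0 <= phi u) ->
     (forall u v, 0 < u -> 0 < v -> phi (u * v) = phi u * phi v) ->
     \sum_(x <= j < Y) `|b j| * phi (n j) <= (\sum_(k < m) phi (n k)) ^+ 2) ->
  cn (\sum_(x <= j < Y) (b j)%:C * cpow (n j) (- s)) <=
    C `^ eta * x%:R `^ (- eta) * (C `^ (1 + eta) * (1 + eta^-1)) ^+ 2.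
Proof.
move=> e0 x0 hs H; have C0 : 0 < C by exact: lt_le_trans C_ge1.
have xR : 0 < x%:R :> R by rewrite ltr0n.
pose phi (u : R) := u `^ (- 1 - eta).
have phi0 u : 0 < u -> 0 <= phi u by move=> _; exact: powR_ge0.
have phiM u v : 0 < u -> 0 < v -> phi (u * v) = phi u * phi v.
  by move=> u0 v0; rewrite /phi powRM// ltW.
apply: (@le_trans _ _ (\sum_(x <= j < Y) C `^ eta * x%:R `^ (- eta) * (`|b j| * phi (n j)))).
  apply: (le_trans (cn_sum _ _ _)); rewrite big_nat_cond [leRHS]big_nat_cond.
  apply: ler_sum => j /andP[/andP[xj _] _]; have j0 := bint_gt0 B j.
  rewrite cnM cn_real mulrCA ler_wpM2l//.
  apply: (le_trans (cn_cpow_le (bint_ge1 B j) hs)).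
  have -> : - (1 + 2 * eta) = - eta + (- 1 - eta) by ring.
  rewrite powRD ?(gt_eqF j0) ?implybT// ler_wpM2r ?powR_ge0//.
  rewrite !powRN -[leLHS]mul1r ler_pdivrMr ?powR_gt0// mulrAC ler_pdivlMr ?powR_gt0//.
  rewrite mul1r -powRM ?(ltW C0) ?(ltW j0)//.
  apply: ge0_ler_powR; rewrite ?nnegrE ?mulr_ge0 ?(ltW C0) ?(ltW j0) ?(ltW e0)//.
  by apply: le_trans (n_ge j); rewrite ler_nat ltnW.
rewrite -big_distrr ler_wpM2l ?mulr_ge0 ?powR_ge0//=.
apply: (le_trans (H phi phi0 phiM)); apply: lerXn2r; rewrite ?nnegrE.
- by apply: sumr_ge0 => k _; exact: powR_ge0.
- by apply: mulr_ge0; [exact: powR_ge0|pos].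
- exact: power_sum_bound.
Qed.

End OneSystem.

(** In the mollified identity with [x = m] large, the tail is at most 1/2 and the mollifier is
    bounded, so the partial sums, hence their limit, stay away from 0 uniformly in the system. *)
Lemma zeta_lower (eta : R) : 0 < eta -> exists2 c : R, 0 < c & forall B, well_behaved theta A K B ->
  forall s, 1 + 2 * eta <= complex.Re s -> c <= cn (zg A B s / (s - 1)).
Proof.
move=> e0; have [C C1 HC] := bint_asymptotics K theta_ge0 theta_lt1 A_gt0.
have C0 : 0 < C by exact: lt_le_trans C1.
pose S := C `^ (1 + eta) * (1 + eta^-1).
have S0 : 0 < S by rewrite /S; apply: mulr_gt0; [exact: powR_gt0|pos].
exists (4 * S)^-1; first by rewrite invr_gt0 mulr_gt0.
move=> B wb s hs; have [n_ge _] := HC B wb.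
have [mob [mob1 Hm]] := mollifier B.
have s1 : 1 < complex.Re s by lra.
have [|N1 [N10 H1]] := @powR_small R eta ((2 * (C `^ eta * S ^+ 2))^-1) e0.
  by pos.
have [|N2 H2] := dsum_cvg theta_ge0 theta_lt1 A_gt0 wb s1 (e := (4 * S)^-1).
  by rewrite invr_gt0 mulr_gt0.
pose m := maxn N1 N2.
have m0 : (0 < m)%N by rewrite leq_max N10.
have [|Y [b [b1 _ _ b4]]] := Hm m m; first by rewrite m0 leqnn.
have h1 := b1 (fun u => cpow u (- s)) (cpow1 _) (fun u v u0 v0 => cpowM _ u0 v0).
rewrite -/(dsum B m s) -/(mollsum B mob m s) in h1.
have h2 := tail_sum_right C1 n_ge e0 m0 hs b4; rewrite -/S in h2.
have h3 := H1 m (leq_maxl _ _); have h4 := H2 m (leq_maxr _ _).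
have h5 : cn (mollsum B mob m s) <= S.
  apply: (le_trans (mollsum_le B mob1 m (y := 1 + eta) _)); first by lra.
  by rewrite opprD; exact: power_sum_bound.
have h6 : cn (\sum_(m <= j < Y) (b j)%:C * cpow (bint B j) (- s)) <= 2^-1.
  apply: (le_trans h2); rewrite mulrAC.
  apply: (@le_trans _ _ (C `^ eta * S ^+ 2 * (2 * (C `^ eta * S ^+ 2))^-1)).
    by rewrite ler_wpM2l// mulr_ge0 ?powR_ge0 ?sqr_ge0.
  rewrite invfM mulrCA divff ?mulr1// gt_eqF// mulr_gt0 ?powR_gt0 ?exprn_gt0//.
have h7 : 2^-1 <= cn (dsum B m s) * S.
  apply: (@le_trans _ _ (cn (dsum B m s) * cn (mollsum B mob m s))); last first.
    by rewrite ler_wpM2l ?cn_ge0.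
  rewrite -cnM h1; apply: le_trans (cnDl _ _); rewrite cn1; lra.
have h8 : (2 * S)^-1 <= cn (dsum B m s) by rewrite invfM ler_pdivrMr.
have h9 := cnBl (dsum B m s) (dsum B m s - zg A B s / (s - 1)).
rewrite subKr in h9.
have : (2 * S)^-1 = (4 * S)^-1 + (4 * S)^-1.
  by field; rewrite gt_eqF.
lra.
Qed.

(** The approximation by [zapp] with the single term [m = 1] is already enough. *)
Lemma zg_upper (k0 : R) : 0 < k0 -> exists2 C : R, 1 <= C & forall B, well_behaved theta A K B ->
  forall s, theta + k0 <= complex.Re s <= 7 -> cn (zg A B s) <= C * (1 + cn s) ^+ 2.
Proof.
move=> k00; have [E E0 HE] := zg_approx K theta_ge0 theta_lt1 A_gt0 7.
pose A7 := Num.max 1 A `^ 7.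
have A71 : 1 <= A7 by rewrite -[leLHS](powRr0 (Num.max 1 A)) ler_powR// le_max lexx.
have Ek : 0 <= E / k0 by pos.
exists (1 + A7 + E / k0); first by lra.
move=> B wb s /andP[h1 h2]; set S1 := 1 + cn s.
have c0 := cn_ge0 s; have S11 : 1 <= S1 by rewrite /S1; lra.
have S2 : S1 <= S1 ^+ 2 by rewrite expr2 ler_peMl//; lra.
have sg : theta < complex.Re s by move: k00 h1; lra.
have := HE B wb s 1%N isT; rewrite sg h2 powR1 mulr1 => /(_ isT) g1.
have -> : zg A B s = zapp A B 1 s - (zapp A B 1 s - zg A B s) by ring.
apply: (le_trans (cnB _ _)); rewrite mulrDl; apply: lerD; last first.
  apply: (le_trans g1); rewrite mulrAC ler_wpM2r ?sqr_ge0//.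
  rewrite ler_wpM2l ?(ltW E0)// lef_pV2 ?posrE//; last by lra.
  by rewrite lerBrDl.
rewrite /zapp /dsum big_ord_recr big_ord0 /= add0r bint0 cpow1 mulr1 mulrDl mul1r.
apply: (le_trans (cnD _ _)); apply: lerD.
  by apply: le_trans S2; apply: (le_trans (cnB _ _)); rewrite cn1 addrC.
apply: (@le_trans _ _ (A7 * 1)); last by rewrite ler_wpM2l//; lra.
rewrite mulr1 cnM cn_real (gtr0_norm A_gt0) cn_cpow ?divr_gt0// cReD cReN /=.
rewrite mul1r -powR_inv1 ?(ltW A_gt0)// -powRrM -{1}[A]powRr1 ?(ltW A_gt0)//.
rewrite -powRD ?(gt_eqF A_gt0) ?implybT//.
have -> : 1 + -1 * (1 - complex.Re s) = complex.Re s by ring.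
have sg0 : 0 <= complex.Re s by exact: le_trans theta_ge0 (ltW sg).
apply: (@le_trans _ _ (Num.max 1 A `^ complex.Re s)).
  apply: ge0_ler_powR; rewrite ?nnegrE ?le_max ?ler01 ?(ltW A_gt0) ?lexx ?orbT//.
by apply: ler_powR => //; rewrite le_max lexx.
Qed.

(** The phases are [- h * ln n_j], small enough not to wrap around, and the cells are intervals of
    length [1 / (n * h)] in [ln n_j]. A cell near [u] holds [O(u / (n * h) + u ^ theta)] integers,
    the second term being the error in the counting hypothesis. *)
Lemma mean_value_dirichlet : exists2 C : R, 0 < C & forall B, well_behaved theta A K B ->
  forall (b : nat -> R) (x Y n : nat) (h sg t0 : R), (0 < x)%N -> (0 < n)%N -> 0 < h -> 1 <= n%:R * h ->
  (forall j, b j != 0 -> h * ln (bint B j) <= 1 / 2) ->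
  \sum_(i < n) cn (\sum_(x <= j < Y) (b j)%:C * cpow (bint B j) (- (sg +i* (t0 + i%:R * h)))) ^+ 2 <=
  C * n%:R * \sum_(x <= j < Y) b j ^+ 2 * bint B j `^ (- sg * 2) *
     (bint B j / (n%:R * h) + bint B j `^ theta).
Proof.
pose Cw := (2 * A + 2 * `|K|) * expR 1.
have Cw0 : 0 < Cw by apply: mulr_gt0; [pos|exact: expR_gt0].
exists (1024 * Cw); first by apply: (mulr_gt0 _ Cw0); rewrite ltr0n.
move=> B wb b x Y n h sg t0 x0 n0 h0 nh1 hb.
pose M := n%:R * h; pose nn := bint B.
have M0 : 0 < M by exact: lt_le_trans nh1.
have nn0 j : 0 < nn j := bint_gt0 B j.
pose act j := (x <= j)%N && (b j != 0).
pose c (j : 'I_Y) : R[i] := if act j then (b j)%:C * cpow (nn j) (- (sg +i* t0)) else 0.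
(* Inactive indices get phase 0, so that [h * lam j <= 1 / 2] holds for every index. *)
pose lam (j : nat) : R := if act j then ln (nn j) else 0.
have lam0 j : 0 <= lam j by rewrite /lam; case: ifP => // _; apply: ln_ge0; exact: bint_ge1.
have lamh j : h * lam j <= 1 / 2.
  by rewrite /lam; case: ifP => [/andP[_ /hb]//|_]; rewrite mulr0; lra.
pose t (j : 'I_Y) : R := - (h * lam j).
pose cl (j : nat) : nat := Num.truncn (lam j * M).
have clP j : (cl j)%:R <= lam j * M < (cl j).+1%:R.
  by rewrite truncn_itv// mulr_ge0// ltW.
pose Q := (\sum_(j < Y) cl j).+1.
have clQ (j : 'I_Y) : (cl j < Q)%N by rewrite ltnS (bigD1 j)//= leq_addr.
pose cell (j : 'I_Y) : 'I_Q := Ordinal (clQ j).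
have e1 i : \sum_(x <= j < Y) (b j)%:C * cpow (nn j) (- (sg +i* (t0 + i%:R * h))) =
   \sum_j c j * cexp (0 +i* t j) ^+ i.
  rewrite big_geq_mkord big_mkcond /=; apply: eq_bigr => j _.
  rewrite /c /t /lam; case aj : (act j); last first.
    rewrite mul0r; move: aj; rewrite /act; case: (x <= j)%N => //= /negbFE/eqP ->.
    by rewrite mul0r.
  have [-> bj] := andP aj; rewrite -mulrA; congr (_ * _).
  rewrite !cpowE// -cexpMn -cexpD; congr cexp.
  have -> : forall z : R[i], z *+ i = (i%:R)%:C * z.
    by move=> z; rewrite rmorph_nat mulr_natl.
  by apply: complex_eq; rewrite !(cReD, cImD, cReM, cImM, cReN, cImN) /=; ring.
rewrite (eq_bigr (fun i : 'I_n => cn (\sum_j c j * cexp (0 +i* t j) ^+ i) ^+ 2)); last first.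
  by move=> i _; rewrite e1.
pose W (j : 'I_Y) : R := Cw * (nn j / M + nn j `^ theta).
apply: (le_trans (@mean_value_phases R n Y Q c t cell W n0 _ _ _)).
- move=> p q; rewrite /t; have := lamh p; have := lamh q; have := lam0 p; have := lam0 q.
  by move=> /(mulr_ge0 (ltW h0)) g1 /(mulr_ge0 (ltW h0)) g2 g3 g4; rewrite ler_norml; apply/andP; split; lra.
- move=> p q; rewrite /t.
  have -> : n%:R * `|- (h * lam p) - - (h * lam q)| = `|lam p * M - lam q * M|.
    rewrite -[n%:R]ger0_norm ?ler0n// -normrM -normrN; congr (`| _ |); rewrite /M; ring.
  have /andP[a1 a2] := clP p; have /andP[b1 b2] := clP q; rewrite -natr1 in a2 b2; rewrite -natr1 in b2.
  rewrite /=; case: (leqP (cl p) (cl q)) => pq.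
    have /eqP -> : (cl p - cl q == 0)%N by rewrite subn_eq0.
    rewrite add0n natrB// lerBlDr -normrN opprB; have := ler_norm (lam q * M - lam p * M); lra.
  have /eqP -> : (cl q - cl p == 0)%N by rewrite subn_eq0 ltnW.
  rewrite addn0 natrB ?(ltnW pq)// lerBlDr; have := ler_norm (lam p * M - lam q * M); lra.
- move=> p cp.
  have actp : act p by move: cp; rewrite /c; case: (act p) => //; rewrite eqxx.
  have lamp : lam p = ln (nn p) by rewrite /lam actp.
  (* The cell is widened by one width on the left, to make the inequality there strict, and cut at
     1, where the counting hypothesis begins; the integers of active indices exceed 1 because
     [x > 0]. *)
  pose a := cl p; pose y' := expR (a.+1%:R / M); pose y0 := Num.max 1 (expR ((a%:R - 1) / M)).
  have M2 : 0 < M^-1 by rewrite invr_gt0.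
  have sub : (#|[pred q | (cell q == cell p) && (c q != 0%R)]| <= #|[pred q : 'I_Y | (y0 < nn q <= y')%R]|)%N.
    apply: subset_leq_card; apply/fintype.subsetP => q; rewrite !inE => /andP[/eqP[clq] cq].
    have actq : act q by move: cq; rewrite /c; case: (act q) => //; rewrite eqxx.
    have := clP q; rewrite clq -/a {1 2}/lam actq => /andP[g1 g2].
    have q1 : 1 < nn q by apply: bint_gt1; case/andP: actq => xq _; exact: leq_trans x0 xq.
    have l1 : (a%:R - 1) / M < ln (nn q) by rewrite ltr_pdivrMr//; lra.
    have l2 : ln (nn q) <= a.+1%:R / M by rewrite ler_pdivlMr// ltW.
    rewrite /y0 gt_max q1 /= -{1 2}[nn q]lnK ?posrE//.
    by rewrite ltr_expR l1 ler_expR l2.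
  apply: (@le_trans _ _ (#|[pred q : 'I_Y | (y0 < nn q <= y')%R]|%:R)); first by rewrite ler_nat.
  have am : (a%:R - 1) / M <= a.+1%:R / M by rewrite ler_pM2r// -natr1; lra.
  have yy : y0 <= y'.
    rewrite /y0 ge_max /y' ler_expR am andbT -[leLHS]expR0 ler_expR; pos.
  have y01 : 1 <= y0 by rewrite /y0 le_max lexx.
  apply: (@le_trans _ _ (A * (y' - y0) + 2 * K * y' `^ theta)); first exact (bint_interval_count theta_ge0 theta_lt1 A_gt0 wb Y y01 yy).
  have KK : `|K| = K by rewrite ger0_norm//; exact: (wb_K_ge0 wb).
  have y'0 : 0 < y' by exact: expR_gt0.
  have e0 : 0 < expR 1 :> R by exact: expR_gt0.
  have yn : y' <= expR 1 * nn p.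
    rewrite -[nn p]lnK ?posrE// -expRD ler_expR ler_pdivrMr// mulrDl mul1r.
    have := clP p; rewrite lamp -/a => /andP[g1 _]; rewrite -natr1; move: nh1; rewrite -/M; lra.
  have yd : y' - y0 <= y' * (2 / M).
    apply: (@le_trans _ _ (y' - expR ((a%:R - 1) / M))).
      by rewrite lerD2l lerN2 /y0 le_max lexx orbT.
    have -> : expR ((a%:R - 1) / M) = y' * expR (- (2 / M)).
      by rewrite /y' -expRD; congr expR; rewrite -natr1; ring.
    rewrite -{1}[y']mulr1 -mulrBr ler_wpM2l ?(ltW y'0)//.
    by have := expR_ge1Dx (- (2 / M)); lra.
  have yt : y' `^ theta <= expR 1 * nn p `^ theta.
    apply: (@le_trans _ _ ((expR 1 * nn p) `^ theta)).
      by apply: ge0_ler_powR => //; rewrite ?nnegrE ?(ltW y'0)// mulr_ge0// ltW.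
    rewrite powRM ?(ltW e0) ?(ltW (nn0 p))// ler_wpM2r ?powR_ge0//.
    by apply: ler_powR_1 (ltW theta_lt1); rewrite -[leLHS]expR0 ler_expR.
  have f1 : A * (y' - y0) <= 2 * A * expR 1 * (nn p / M).
    apply: (@le_trans _ _ (A * (expR 1 * nn p * (2 / M)))).
      apply: ler_wpM2l; first exact: ltW.
      by apply: (le_trans yd); apply: ler_wpM2r => //; pos.
    by apply: eq_ler; ring.
  have f2 : 2 * K * y' `^ theta <= 2 * `|K| * expR 1 * nn p `^ theta.
    by rewrite KK -[leRHS]mulrA ler_wpM2l// -KK; pos.
  apply: (le_trans (lerD f1 f2)); rewrite /W /Cw.
  have f3 : 0 <= 2 * A * expR 1 * nn p `^ theta by pos.
  have f4 : 0 <= 2 * `|K| * expR 1 * (nn p / M).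
    by apply: mulr_ge0; [pos|apply: divr_ge0; apply: ltW].
  by lra.
have -> : \sum_p W p * cn (c p) ^+ 2 = Cw * \sum_(x <= j < Y) b j ^+ 2 * nn j `^ (- sg * 2) *
     (nn j / M + nn j `^ theta).
  rewrite big_geq_mkord [in RHS]big_mkcond big_distrr /=; apply: eq_bigr => j _.
  rewrite /c; case aj : (act j); last first.
    rewrite cn0 expr0n mulr0; move: aj; rewrite /act; case: (x <= j)%N => /=; last by rewrite mulr0.
    by move=> /negbFE/eqP ->; rewrite expr0n !mul0r mulr0.
  have [-> bj] := andP aj.
  rewrite cnM cn_real cn_cpow// cReN /= exprMn real_normK ?num_real//.
  rewrite powRrM (powR_mulrn 2) ?powR_ge0// /W; ring.
by apply: eq_ler; rewrite mulrA; congr (_ * _); rewrite mulrAC.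
Qed.

End Estimates.

(** * The mollified zeta function *)

Section Core.
Variables (R : realType) (theta A K : R).
Hypotheses (theta_ge0 : 0 <= theta) (theta_lt1 : theta < 1) (A_gt0 : 0 < A).
Implicit Types (B : beurling R) (s : R[i]).

Local Tactic Notation "lra_from" ne_hyp_list(h) :=
  clear - theta_ge0 theta_lt1 A_gt0 K h; lra.

(** Bounds [ln m / ln T] for the final choice, where [m] is at most [2 * T ^ (b / (1 - theta))] with
    [b <= 5 / 2]. *)
Definition length_exponent : R := 3 / (1 - theta) + 1.
(** Bounds [k ^ (e / ln T)] for [k <= m] and [e <= 6]: the cost of moving an exponent by
    [O(1 / ln T)]. *)
Definition shift_factor : R := expR (6 * length_exponent).

(** The bound on [ln T] gives [3 / ln T <= (1 - theta) / 12], so that the strip stays right of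
    [(1 + theta) / 2] after being widened by [3 / ln T]; the lower bound on [al] says
    [mu >= 2 / 3]. *)
Definition admissible (T al : R) (x m : nat) :=
  [/\ 36 / (1 - theta) + 12 <= ln T, theta + 2 / 3 * (1 - theta) <= al <= 1,
      (0 < x <= m)%N & ln m%:R <= length_exponent * ln T].

Lemma admissible_facts T al x m : admissible T al x m ->
  [/\ 12 <= ln T, 12 <= T, theta + (1 - theta) / 2 <= al - 3 / ln T,
      (1 - theta) / 6 <= 2 * (al - 3 / ln T) - 1 - theta & 3 / ln T <= 1 / 4].
Proof.
move=> [h1 /andP[h2 h3] _ _]; move: theta_lt1 theta_ge0 => t1 t0.
have u0 : 0 < 1 - theta by lra.
have a36 : 0 <= 36 / (1 - theta) by pos.
set L := ln T in h1 *.
have L12 : 12 <= L by lra.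
have L0 : 0 < L by lra.
have LL : 3 / L <= (1 - theta) / 12.
  have : 36 <= L * (1 - theta) by rewrite -ler_pdivrMr//; lra.
  by rewrite ler_pdivrMr//; lra.
have T12 : 12 <= T.
  have T0 : 0 < T.
    rewrite ltNge; apply/negP => T0; have : L <= 0 by apply: ln_le0; lra.
    lra.
  by have := ln_sublinear T0; rewrite -/L; lra.
split => //; lra.
Qed.

Lemma length_exponent_ge4 : 4 <= length_exponent.
Proof.
have u0 : 0 < 1 - theta by rewrite subr_gt0.
have : 3 <= 3 / (1 - theta) by rewrite ler_pdivlMr//; move: theta_ge0; lra.
by rewrite /length_exponent; lra.
Qed.

Lemma shift_factor_ge1 : 1 <= shift_factor.
Proof. by rewrite -[leLHS]expR0 ler_expR; have := length_exponent_ge4; lra. Qed.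

Lemma pow_shift T al x m k (y e : R) : admissible T al x m -> (0 < k <= m)%N ->
  0 <= e <= 6 -> k%:R `^ (y + e / ln T) <= shift_factor * k%:R `^ y.
Proof.
move=> ad /andP[k0 km] /andP[e0 e6]; have [L12 _ _ _ _] := admissible_facts ad.
have [_ _ _ lm] := ad.
have kR : 0 < k%:R :> R by rewrite ltr0n.
rewrite powRD ?(gt_eqF kR) ?implybT// mulrC ler_wpM2r ?powR_ge0//.
rewrite /powR gt_eqF// /shift_factor ler_expR mulrAC ler_pdivrMr; last by lra.
have lk : ln k%:R <= length_exponent * ln T.
  by apply: le_trans lm; rewrite ler_ln ?posrE ?ltr0n ?(leq_trans k0)// ler_nat.
have lk0 : 0 <= ln (k%:R : R) by apply: ln_ge0; rewrite ler1n.
apply: (@le_trans _ _ (6 * (length_exponent * ln T))); last by rewrite mulrA.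
by apply: ler_pM.
Qed.

(** By [zapp], the difference [zeta - D] is [A * (m / A) ^ (1 - s) / (s - 1)] up to an error of
    order [T * m ^ (theta - al)]. The condition with [kap] makes the error harmless against the
    mollifier; the main term needs height of order [(m * x) ^ (1 - al) * ln T], which is the origin
    of [U]. Each is allotted 1/4. *)
Lemma mollified_error : exists kap K2 : R, [/\ 0 < kap, 0 < K2 &
  forall B, well_behaved theta A K B -> forall (T al U : R) (x m : nat) (mob : nat -> R),
  admissible T al x m -> (forall l, `|mob l| <= 1) ->
  T * m%:R `^ (theta - al) * x%:R `^ (1 - al) * ln T <= kap ->
  8 + K2 * (m%:R * x%:R) `^ (1 - al) * ln T <= U ->
  forall s, al - 3 / ln T <= complex.Re s <= 7 -> U - 4 <= `|complex.Im s| <= T + 4 ->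
  cn ((zg A B s / (s - 1) - dsum B m s) * mollsum B mob x s) <= 1 / 2].
Proof.
have [C C1 HC] := bint_asymptotics K theta_ge0 theta_lt1 A_gt0.
have [E E0 HE] := zg_approx K theta_ge0 theta_lt1 A_gt0 7.
have C0 : 0 < C by lra.
have c14 := length_exponent_ge4; have G1 := shift_factor_ge1.
have c10 : 0 < length_exponent by lra.
have G0 : 0 < shift_factor by lra.
have [k0 k0E] : exists k0 : R, k0 = (1 - theta) / 2 by eexists.
have k00 : 0 < k0 by rewrite k0E divr_gt0// subr_gt0.
have [A7 A7E] : exists A7 : R, A7 = Num.max 1 A `^ 7 by eexists.
have A71 : 1 <= A7 by rewrite A7E -[leLHS](powRr0 (Num.max 1 A)) ler_powR// le_max lexx.
have [KM KME] : exists KM : R, KM = C * shift_factor * (C * (1 + length_exponent)) by eexists.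
have KM0 : 0 < KM by rewrite KME; pos.
pose K1 := E * 4 / k0 * shift_factor * KM.
pose K2' := A7 * shift_factor * KM.
have K10 : 0 < K1 by rewrite /K1; pos.
have A70 : 0 < A7 by lra.
have K20 : 0 < K2' by rewrite /K2'; pos.
exists (4 * K1)^-1, (4 * K2'); split; [by pos|by pos|].
move=> B wb T al U x m mob ad mob1 hkap hU s /andP[s1 s7] /andP[i1 i2].
have [L12 T12 al1 al2 al3] := admissible_facts ad.
have [_ /andP[_ alle] /andP[x0 xm] lm] := ad.
have [n_ge n_le] := HC B wb.
have m0 : (0 < m)%N by exact: leq_trans x0 xm.
have mR : 0 < m%:R :> R by rewrite ltr0n.
have xR : 0 < x%:R :> R by rewrite ltr0n.
have mR1 : 1 <= m%:R :> R by rewrite ler1n.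
have xR1 : 1 <= x%:R :> R by rewrite ler1n.
set L := ln T in L12 al1 al2 al3 hkap hU s1 lm *.
have L0 : 0 < L by lra.
set a' := al - 3 / L in al1 al2 s1.
have L3 : 0 < 3 / L by pos.
have a'1 : a' <= 1 by rewrite /a'; lra_from alle L3.
have mx1 : 0 <= (m%:R * x%:R) `^ (1 - al) :> R by exact: powR_ge0.
have U8 : 8 <= U.
  by apply: le_trans hU; rewrite lerDl; pos.
have i4 : 4 <= `|complex.Im s| by lra_from i1 U8.
have cs1 : `|complex.Im s| <= cn (s - 1).
  apply: le_trans (ler_Im_cn _); by rewrite cImD cImN /= subr0.
have cs4 : 4 <= cn (s - 1) by lra_from cs1 i4.
have cs0 : 0 < cn (s - 1) by lra_from cs4.
have sn1 : s - 1 != 0 by rewrite -cn_gt0.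
have a'0 : 0 <= a' by move: theta_ge0 theta_lt1; lra_from al1.
have cs : cn s <= T + 11.
  apply: (le_trans (ler_cn_ReIm _)); rewrite ger0_norm; last by lra_from s1 a'0.
  by lra_from s7 i2.
have cs2 : 1 + cn s <= 2 * cn (s - 1).
  have -> : cn s = cn (s - 1 + 1) by rewrite subrK.
  by have := cnD (s - 1) 1; rewrite cn1; lra_from cs4.
have gM : cn (mollsum B mob x s) <= KM * x%:R `^ (1 - al) * L.
  apply: (le_trans (mollsum_strip_le C1 n_ge mob1 x0 s1 a'1)).
  have h1 : bint B x `^ (1 - a') <= C * (shift_factor * x%:R `^ (1 - al)).
    apply: (@le_trans _ _ ((C * x%:R) `^ (1 - a'))).
      apply: ge0_ler_powR; rewrite ?nnegrE ?subr_ge0 ?(ltW (bint_gt0 B x))//; first by pos.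
      by have [] := n_le x x0.
    rewrite powRM ?(ltW C0) ?(ltW xR)//; apply: ler_pM; rewrite ?powR_ge0//.
      by apply: ler_powR_1 => //; lra_from a'1 a'0.
    have -> : 1 - a' = (1 - al) + 3 / L by rewrite /a'; ring.
    by apply: (pow_shift _ ad); [rewrite x0 xm|apply/andP; split; lra_from theta_ge0].
  have h2 : 1 + ln x%:R <= (1 + length_exponent) * L.
    have : ln x%:R <= ln (m%:R : R) by rewrite ler_ln ?posrE// ler_nat.
    rewrite mulrDl mul1r; lra_from lm L12.
  apply: (@le_trans _ _ (C * (shift_factor * x%:R `^ (1 - al)) * (C * ((1 + length_exponent) * L)))).
    apply: ler_pM; rewrite ?powR_ge0//.
      apply: mulr_ge0; first exact: ltW.
      by apply: addr_ge0 => //; apply: ln_ge0.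
    by rewrite ler_wpM2l ?(ltW C0).
  by rewrite KME; apply: eq_ler; ring.
have gD : cn (zg A B s / (s - 1) - dsum B m s) <=
   E * 4 / k0 * shift_factor * (T * m%:R `^ (theta - al)) + A7 * shift_factor * (m%:R `^ (1 - al) / (U - 4)).
  have -> : zg A B s / (s - 1) - dsum B m s =
    (A%:C * cpow (m%:R / A) (1 - s) - (zapp A B m s - zg A B s)) / (s - 1).
    by rewrite /zapp; field.
  rewrite cnM cnV.
  have ts : theta < complex.Re s by move: theta_lt1; lra_from al1 s1.
  have := HE B wb s m m0; rewrite ts s7 => /(_ isT) g1.
  have g2 : cn (A%:C * cpow (m%:R / A) (1 - s)) <= A7 * (shift_factor * m%:R `^ (1 - al)).
    rewrite cnM cn_real (gtr0_norm A_gt0) cn_cpow ?divr_gt0// cReD cReN /=.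
    rewrite powRM ?invr_ge0 ?(ltW mR) ?(ltW A_gt0)// -powR_inv1 ?(ltW A_gt0)// -powRrM.
    have -> : A * (m%:R `^ (1 - complex.Re s) * A `^ (-1 * (1 - complex.Re s))) =
      A `^ complex.Re s * m%:R `^ (1 - complex.Re s).
      have -> : A `^ complex.Re s = A * A `^ (-1 * (1 - complex.Re s)).
        rewrite -{2}[A]powRr1 ?(ltW A_gt0)// -powRD ?(gt_eqF A_gt0) ?implybT//.
        by congr (_ `^ _); ring.
      ring.
    apply: ler_pM; rewrite ?powR_ge0//.
      rewrite A7E; apply: (@le_trans _ _ (Num.max 1 A `^ complex.Re s)).
        apply: ge0_ler_powR; rewrite ?nnegrE ?le_max ?ler01 ?(ltW A_gt0) ?lexx ?orbT//; lra_from s1 a'0.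
      by apply: ler_powR => //; rewrite le_max lexx.
    apply: (@le_trans _ _ (m%:R `^ (1 - a'))); first by apply: ler_powR => //; lra_from s1.
    have -> : 1 - a' = (1 - al) + 3 / L by rewrite /a'; ring.
    by apply: (pow_shift _ ad); [rewrite m0 leqnn|apply/andP; split; lra_from theta_ge0].
  apply: (@le_trans _ _ ((A7 * (shift_factor * m%:R `^ (1 - al)) +
     E * (1 + cn s) ^+ 2 / k0 * (shift_factor * m%:R `^ (theta - al))) / cn (s - 1))).
    rewrite ler_wpM2r ?invr_ge0 ?(ltW cs0)//; apply: (le_trans (cnB _ _)); apply: lerD => //.
    apply: (le_trans g1); apply: ler_pM; rewrite ?powR_ge0//.
    - by apply: mulr_ge0; [pos|rewrite invr_ge0 subr_ge0 ltW].
    - apply: ler_wpM2l; first by pos.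
      rewrite lef_pV2 ?posrE ?subr_gt0// lerBrDl k0E; lra_from al1 s1.
    - apply: (@le_trans _ _ (m%:R `^ (theta - a'))); first by apply: ler_powR => //; lra_from s1.
      have -> : theta - a' = (theta - al) + 3 / L by rewrite /a'; ring.
      by apply: (pow_shift _ ad); [rewrite m0 leqnn|apply/andP; split; lra_from theta_ge0].
  rewrite mulrDl addrC; apply: lerD.
    have h1 : (1 + cn s) ^+ 2 / cn (s - 1) <= 4 * T.
      rewrite ler_pdivrMr// expr2.
      apply: (@le_trans _ _ ((2 * T) * (2 * cn (s - 1)))); last by apply: eq_ler; ring.
      by apply: ler_pM; rewrite ?addr_ge0 ?cn_ge0//; lra_from cs cs2 T12.
    have -> : E * (1 + cn s) ^+ 2 / k0 * (shift_factor * m%:R `^ (theta - al)) / cn (s - 1) =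
      E / k0 * shift_factor * m%:R `^ (theta - al) * ((1 + cn s) ^+ 2 / cn (s - 1)) by ring.
    apply: (@le_trans _ _ (E / k0 * shift_factor * m%:R `^ (theta - al) * (4 * T))).
      by apply: ler_wpM2l => //; pos.
    by apply: eq_ler; ring.
  have -> : A7 * (shift_factor * m%:R `^ (1 - al)) / cn (s - 1) = A7 * shift_factor * (m%:R `^ (1 - al) / cn (s - 1)) by ring.
  apply: ler_wpM2l; first by pos.
  apply: ler_wpM2l; first by pos.
  by rewrite lef_pV2 ?posrE//; lra_from cs1 i1 U8 i4.
rewrite cnM.
apply: (@le_trans _ _ ((E * 4 / k0 * shift_factor * (T * m%:R `^ (theta - al)) + A7 * shift_factor * (m%:R `^ (1 - al) / (U - 4)))
   * (KM * x%:R `^ (1 - al) * L))).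
  by apply: ler_pM; rewrite ?cn_ge0.
rewrite mulrDl.
have q1 : E * 4 / k0 * shift_factor * (T * m%:R `^ (theta - al)) * (KM * x%:R `^ (1 - al) * L) <= 1 / 4.
  have -> : E * 4 / k0 * shift_factor * (T * m%:R `^ (theta - al)) * (KM * x%:R `^ (1 - al) * L) =
    K1 * (T * m%:R `^ (theta - al) * x%:R `^ (1 - al) * L) by rewrite /K1; ring.
  apply: (@le_trans _ _ (K1 * (4 * K1)^-1)); first by apply: ler_wpM2l => //; exact: ltW.
  by rewrite invfM mulrCA divff ?gt_eqF// mulr1 mul1r.
have q2 : A7 * shift_factor * (m%:R `^ (1 - al) / (U - 4)) * (KM * x%:R `^ (1 - al) * L) <= 1 / 4.
  have U4 : 0 < U - 4 by lra_from U8.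
  have -> : A7 * shift_factor * (m%:R `^ (1 - al) / (U - 4)) * (KM * x%:R `^ (1 - al) * L) =
    K2' * (m%:R * x%:R) `^ (1 - al) * L / (U - 4).
    by rewrite powRM ?(ltW mR) ?(ltW xR)// /K2'; ring.
  rewrite ler_pdivrMr//; lra_from hU.
by lra_from q1 q2.
Qed.

End Core.

(** * Detection of zeros *)

Lemma card_le_diameter n (P : pred 'I_n) (N : nat) :
  (forall i j, P i -> P j -> (j <= i + N)%N) -> (#|P| <= N.+1)%N.
Proof.
move=> H; case: (pickP P) => [i1 Pi1|P0]; last by rewrite eq_card0.
have [i0 Pi0 Hmin] := @arg_minnP _ i1 P (fun i => nat_of_ord i) Pi1.
have -> : #|P| = size (map val (enum P)) by rewrite size_map -cardE.
have -> : N.+1 = size (iota i0 N.+1) by rewrite size_iota.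
apply: uniq_leq_size; first by rewrite map_inj_uniq ?enum_uniq//; exact: val_inj.
move=> k /mapP[j]; rewrite mem_enum => Pj ->; rewrite mem_iota.
by rewrite (Hmin j Pj) /= addnS ltnS; exact: H.
Qed.

(* [1 - (F / Q) ^ 2] for [F = D M - 1] and [Q = 1 + (z - D) M], since [z M = Q + F]. *)
Section ZeroDetector.
Variables (R : realType) (z D M : R[i]).

Definition detector : R[i] :=
  z * (M * (1 + (z - D) * M - (D * M - 1)) / (1 + (z - D) * M) ^+ 2).

Hypothesis small : cn ((z - D) * M) <= 1 / 2.

Lemma detector_den : 1 / 2 <= cn (1 + (z - D) * M).
Proof.
by have := cnDl 1 ((z - D) * M); rewrite cn1; move: small; lra.
Qed.

Lemma detector_den_neq0 : 1 + (z - D) * M != 0.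
Proof. by rewrite -cn_gt0; have := detector_den; lra. Qed.

Lemma detectorE : detector = 1 - ((D * M - 1) / (1 + (z - D) * M)) ^+ 2.
Proof. by have := detector_den_neq0 => q0; rewrite /detector; field. Qed.

Lemma detector_sq : cn (((D * M - 1) / (1 + (z - D) * M)) ^+ 2) <= 4 * cn (D * M - 1) ^+ 2.
Proof.
have := detector_den => q; have q0 : 0 < cn (1 + (z - D) * M) by lra.
rewrite cnX cnM cnV exprMn mulrC ler_wpM2r ?sqr_ge0// exprVn -[leRHS]invrK.
by rewrite lef_pV2 ?posrE ?exprn_gt0// ?invr_gt0//; nra.
Qed.

Lemma detector_le : cn detector <= expR (4 * cn (D * M - 1) ^+ 2).
Proof.
rewrite detectorE; apply: (le_trans (cnB _ _)); rewrite cn1.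
by apply: le_trans (expR_ge1Dx _); rewrite lerD2l detector_sq.
Qed.

(** The smallness of [F] turns [1 - y] into an exponential, so that centres and circles are both
    handled by sums of [|F| ^ 2]. *)
Lemma detector_ge : cn (D * M - 1) <= 1 / 8 ->
  expR (- (8 * cn (D * M - 1) ^+ 2)) <= cn detector.
Proof.
move=> F8; have F0 := cn_ge0 (D * M - 1).
set y := 4 * cn (D * M - 1) ^+ 2.
have y0 : 0 <= y by rewrite /y; pos.
have y1 : y <= 1 / 2 by rewrite /y; nra.
have -> : 8 * cn (D * M - 1) ^+ 2 = 2 * y by rewrite /y; ring.
apply: (@le_trans _ _ (1 - y)).
  have e1 := expR_ge1Dx (2 * y).
  have e0 := expR_gt0 (2 * y).
  by rewrite expRN -[leLHS]mul1r ler_pdivrMr//; nra.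
rewrite detectorE; have := cnBl 1 (((D * M - 1) / (1 + (z - D) * M)) ^+ 2).
by rewrite cn1; have := detector_sq; rewrite -/y; lra.
Qed.

End ZeroDetector.

(** * Mean value of the Dirichlet polynomial [F], and the discs near the pole *)

Section Core2.
Variables (R : realType) (theta A K : R).
Hypotheses (theta_ge0 : 0 <= theta) (theta_lt1 : theta < 1) (A_gt0 : 0 < A).
Implicit Types (B : beurling R) (s : R[i]).

Local Tactic Notation "lra_from" ne_hyp_list(h) :=
  clear - theta_ge0 theta_lt1 A_gt0 K h;
  have := theta_ge0; have := theta_lt1; lra.

(** Both weights are written as a bound times [1 / n_j], to meet the estimate for the sum of
    [b j ^ 2 / n_j]. The first bound is a nonnegative power of [n_j] and uses [n_j <= n_m * n_x];
    the second is a nonpositive power and uses [j >= x]. *)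
Lemma tail_weight B (C a sg : R) (x m j : nat) : 1 <= C ->
  (forall k, k.+1%:R <= C * bint B k) -> (forall k, (0 < k)%N -> bint B k <= C * k%:R) ->
  0 <= a <= 1 -> 0 <= 2 * a - 1 - theta -> a <= sg -> (0 < x <= j)%N -> (0 < m)%N ->
  bint B j <= bint B m * bint B x ->
  bint B j `^ (- sg * 2) * bint B j <=
     C ^+ 4 * ((m%:R * x%:R) `^ (2 * (1 - a))) * (bint B j)^-1 /\
  bint B j `^ (- sg * 2) * bint B j `^ theta <=
     C * x%:R `^ (1 + theta - 2 * a) * (bint B j)^-1.
Proof.
move=> C1 n_ge n_le /andP[a0 a1] a2 asg /andP[x0 xj] m0 nj.
have C0 : 0 < C by lra_from C1.
have n1 := bint_ge1 B j; have n0 := bint_gt0 B j.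
have nn0 : bint B j == 0 = false by rewrite gt_eqF.
have mR : 0 < m%:R :> R by rewrite ltr0n.
have xR : 0 < x%:R :> R by rewrite ltr0n.
rewrite -!powR_inv1 ?(ltW n0)//.
have shrink : bint B j `^ (- sg * 2) <= bint B j `^ (- a * 2).
  by apply: ler_powR => //; lra_from asg.
split.
  apply: (@le_trans _ _ (bint B j `^ (- a * 2) * bint B j)).
    by rewrite ler_wpM2r ?(ltW n0).
  have -> : bint B j `^ (- a * 2) * bint B j = bint B j `^ (2 * (1 - a)) * bint B j `^ (-1).
    rewrite -{2}[bint B j]powRr1 ?(ltW n0)// -!powRD ?nn0 ?implybT//.
    by congr (_ `^ _); ring.
  rewrite ler_wpM2r ?powR_ge0//.
  apply: (@le_trans _ _ ((C ^+ 2 * (m%:R * x%:R)) `^ (2 * (1 - a)))).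
    apply: ge0_ler_powR; rewrite ?nnegrE ?(ltW n0)//; first by lra_from a1.
      by pos.
    apply: (le_trans nj); have -> : C ^+ 2 * (m%:R * x%:R) = (C * m%:R) * (C * x%:R) by ring.
    by apply: ler_pM; rewrite ?(ltW (bint_gt0 _ _)) ?n_le.
  have C20 : 0 <= C ^+ 2 by exact: sqr_ge0.
  rewrite powRM ?(mulr_ge0 (ltW mR) (ltW xR))//.
  rewrite ler_wpM2r ?powR_ge0//.
  apply: (@le_trans _ _ ((C ^+ 2) `^ 2%:R)).
    by apply: ler_powR; [rewrite expr_ge1 ?(ltW C0)|lra_from a0].
  by rewrite powR_mulrn// -exprM.
apply: (@le_trans _ _ (bint B j `^ (- a * 2) * bint B j `^ theta)).
  by rewrite ler_wpM2r ?powR_ge0.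
have -> : bint B j `^ (- a * 2) * bint B j `^ theta =
    bint B j `^ (1 + theta - 2 * a) * bint B j `^ (-1).
  by rewrite -!powRD ?nn0 ?implybT//; congr (_ `^ _); ring.
rewrite ler_wpM2r ?powR_ge0//.
set p := 2 * a - 1 - theta in a2.
have -> : 1 + theta - 2 * a = - p by rewrite /p; ring.
rewrite !powRN -[leRHS]invrK lef_pV2 ?posrE; last 2 first.
- by apply: powR_gt0.
- by rewrite invr_gt0; apply: mulr_gt0 => //; rewrite invr_gt0; apply: powR_gt0.
rewrite invfM invrK mulrC ler_pdivrMr//.
apply: (@le_trans _ _ ((C * bint B j) `^ p)).
  apply: ge0_ler_powR; rewrite ?nnegrE ?ler0n//; first by pos.
  by apply: le_trans (n_ge j); rewrite ler_nat; apply: leq_trans xj _.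
rewrite powRM ?(ltW C0) ?(ltW n0)// mulrC ler_wpM2l ?powR_ge0//.
by apply: ler_powR_1 => //; rewrite /p; lra_from a1.
Qed.

(** The size of the sum of [|F| ^ 2] up to logarithms: the first term comes from the length [m * x]
    of the polynomial, the second from the error in counting integers in short intervals. *)
Definition mv_size (T al : R) (x m : nat) : R :=
  (m%:R * x%:R) `^ (2 * (1 - al)) + T * x%:R `^ (1 + theta - 2 * al).

(** The grid step [1 / (C1 * ln T)] keeps the phases below 1/2. Of the five logarithms, four come
    from the fourth power of the harmonic sum and one from the number of grid points. *)
Lemma tail_mean_value : exists C1 K4 : R, [/\ 1 <= C1, 0 < K4 &
  forall B, well_behaved theta A K B ->
  forall (T al : R) (x m : nat) (b : nat -> R) (Y n : nat) (sg t0 : R),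
  admissible theta T al x m ->
  \sum_(x <= j < Y) b j ^+ 2 / bint B j <= (\sum_(k < m) (bint B k)^-1) ^+ 4 ->
  (forall j, b j != 0 -> bint B j <= bint B m * bint B x) ->
  al - 3 / ln T <= sg -> 2 * T <= n%:R * (C1 * ln T)^-1 <= 3 * T ->
  \sum_(i < n) cn (\sum_(x <= j < Y) (b j)%:C *
      cpow (bint B j) (- (sg +i* (t0 + i%:R * (C1 * ln T)^-1)))) ^+ 2 <=
    K4 * ln T ^+ 5 * mv_size T al x m].
Proof.
have [C C1 HC] := bint_asymptotics K theta_ge0 theta_lt1 A_gt0.
have [E E0 HE] := mean_value_dirichlet K theta_ge0 theta_lt1 A_gt0.
have C0 : 0 < C by lra_from C1.
have c14 := length_exponent_ge4 theta_ge0 theta_lt1; have G1 := shift_factor_ge1 theta_ge0 theta_lt1.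
have c10 : 0 < length_exponent theta by lra_from c14.
have G0 : 0 < shift_factor theta by lra_from G1.
have lnC : 0 <= ln C by exact: ln_ge0.
pose Ch := 2 * (2 * ln C + 2 * length_exponent theta) + 1.
have Ch1 : 1 <= Ch by rewrite /Ch; lra_from lnC c10.
have Ch0 : 0 < Ch by lra_from Ch1.
pose W := C ^+ 4 * (3 * shift_factor theta ^+ 2).
have W0 : 0 < W by rewrite /W; pos.
have c110 : 0 < 1 + length_exponent theta by lra_from c10.
exists Ch, (E * Ch * W * (C * (1 + length_exponent theta)) ^+ 4); split => //.
  by pos.
move=> B wb T al x m b Y n sg t0 ad hb2 hb3 hsg hn.
have [L12 T12 al1 al2 al3] := admissible_facts theta_ge0 theta_lt1 ad.
have [_ /andP[_ alle] /andP[x0 xm] lm] := ad.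
have [n_ge n_le'] := HC B wb.
have n_le k : (0 < k)%N -> bint B k <= C * k%:R by move=> /n_le' [].
have m0 : (0 < m)%N by exact: leq_trans x0 xm.
have mR : 0 < m%:R :> R by rewrite ltr0n.
have xR : 0 < x%:R :> R by rewrite ltr0n.
set L := ln T in L12 al1 al2 al3 lm hsg hn *.
have L0 : 0 < L by lra_from L12.
set a := al - 3 / L in al1 al2 hsg.
have L3 : 0 < 3 / L by pos.
have a1 : a <= 1 by rewrite /a; lra_from alle L3.
have a0 : 0 <= a by lra_from al1.
have lxm : ln x%:R <= ln (m%:R : R) by rewrite ler_ln ?posrE// ler_nat.
pose h := (Ch * L)^-1.
have h0 : 0 < h by rewrite /h; pos.
have nh : 2 * T <= n%:R * h by case/andP: hn.
have nh3 : n%:R * h <= 3 * T by case/andP: hn.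
have n0 : (0 < n)%N.
  by rewrite lt0n; apply/eqP => n0; move: nh; rewrite n0 mul0r; lra_from T12.
have nh0 : 0 < n%:R * h by lra_from nh T12.
apply: (le_trans (HE B wb b x Y n h sg t0 x0 n0 h0 _ _)); first by lra_from nh T12.
  move=> j bj; rewrite /h mulrC ler_pdivrMr; last by pos.
  have := hb3 j bj => nj.
  have : ln (bint B j) <= ln (C * m%:R * (C * x%:R)).
    rewrite ler_ln ?posrE ?bint_gt0//; last by pos.
    by apply: (le_trans nj); apply: ler_pM; rewrite ?(ltW (bint_gt0 _ _)) ?n_le.
  rewrite !lnM ?posrE//; try by pos.
  have : ln C <= ln C * L by rewrite ler_peMr//; lra_from L12.
  rewrite /Ch => q1 q2; apply: (le_trans q2).
  have -> : 1 / 2 * ((2 * (2 * ln C + 2 * length_exponent theta) + 1) * L) =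
    2 * (ln C * L) + 2 * (length_exponent theta * L) + L / 2 by field.
  by lra_from q1 lm lxm L0.
pose Z1 := C ^+ 4 * ((m%:R * x%:R) `^ (2 * (1 - a))).
pose Z2 := C * x%:R `^ (1 + theta - 2 * a).
have Z10 : 0 <= Z1 by rewrite /Z1; pos.
have Z20 : 0 <= Z2 by rewrite /Z2; pos.
have step : \sum_(x <= j < Y) b j ^+ 2 * bint B j `^ (- sg * 2) *
     (bint B j / (n%:R * h) + bint B j `^ theta) <=
   (Z1 / (n%:R * h) + Z2) * (\sum_(k < m) (bint B k)^-1) ^+ 4.
  apply: (@le_trans _ _ ((Z1 / (n%:R * h) + Z2) * \sum_(x <= j < Y) b j ^+ 2 / bint B j)); last first.
    apply: ler_wpM2l => //; apply: addr_ge0 => //; apply: divr_ge0 => //; exact: ltW.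
  rewrite mulr_sumr; apply: ler_sum_nat => j /andP[xj _].
  have [->|bj] := eqVneq (b j) 0; first by rewrite expr0n /= !mul0r mulr0.
  have [w1 w2] : bint B j `^ (- sg * 2) * bint B j <= Z1 * (bint B j)^-1 /\
     bint B j `^ (- sg * 2) * bint B j `^ theta <= Z2 * (bint B j)^-1.
    apply: (tail_weight (B := B)); rewrite ?a0 ?a1 ?x0 ?xj ?hb3//.
    by lra_from al2.
  have -> : b j ^+ 2 * bint B j `^ (- sg * 2) * (bint B j / (n%:R * h) + bint B j `^ theta) =
     b j ^+ 2 * ((bint B j `^ (- sg * 2) * bint B j) / (n%:R * h) + bint B j `^ (- sg * 2) * bint B j `^ theta).
    by ring.
  have -> : (Z1 / (n%:R * h) + Z2) * (b j ^+ 2 / bint B j) =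
     b j ^+ 2 * (Z1 * (bint B j)^-1 / (n%:R * h) + Z2 * (bint B j)^-1) by ring.
  apply: ler_wpM2l; first exact: sqr_ge0.
  by apply: lerD => //; rewrite ler_wpM2r// invr_ge0 ltW.
have harm : (\sum_(k < m) (bint B k)^-1) ^+ 4 <= (C * (1 + length_exponent theta)) ^+ 4 * L ^+ 4.
  rewrite -exprMn lerXn2r ?nnegrE//.
  - by apply: sumr_ge0 => k _; rewrite invr_ge0 ltW// bint_gt0.
  - by pos.
  - apply: (le_trans (harmonic_bound C1 n_ge m0)); rewrite -mulrA ler_wpM2l ?(ltW C0)//.
    by rewrite mulrDl mul1r; lra_from lm L12.
have size1 : Z1 <= C ^+ 4 * shift_factor theta ^+ 2 * (m%:R * x%:R) `^ (2 * (1 - al)).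
  rewrite /Z1 -mulrA; apply: ler_wpM2l; first by pos.
  rewrite !powRM ?(ltW mR) ?(ltW xR)//.
  have -> : 2 * (1 - a) = 2 * (1 - al) + 6 / L by rewrite /a; field; rewrite gt_eqF.
  have -> : shift_factor theta ^+ 2 * (m%:R `^ (2 * (1 - al)) * x%:R `^ (2 * (1 - al))) =
     shift_factor theta * m%:R `^ (2 * (1 - al)) * (shift_factor theta * x%:R `^ (2 * (1 - al))) by ring.
  by apply: ler_pM; rewrite ?powR_ge0//; apply: (pow_shift theta_ge0 theta_lt1 _ ad);
    rewrite ?m0 ?x0 ?xm ?leqnn ?lexx ?ler0n.
have size2 : Z2 <= C ^+ 4 * shift_factor theta ^+ 2 * x%:R `^ (1 + theta - 2 * al).
  rewrite /Z2 -[leRHS]mulrA; apply: ler_pM; rewrite ?powR_ge0 ?(ltW C0)//.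
    by rewrite -[leLHS]expr1; apply: ler_weXn2l.
  have -> : 1 + theta - 2 * a = (1 + theta - 2 * al) + 6 / L by rewrite /a; field; rewrite gt_eqF.
  apply: (@le_trans _ _ (shift_factor theta * x%:R `^ (1 + theta - 2 * al))).
    by apply: (pow_shift theta_ge0 theta_lt1 _ ad); rewrite ?x0 ?xm ?lexx ?ler0n.
  by rewrite ler_wpM2r ?powR_ge0// -[leLHS]expr1; apply: ler_weXn2l.
have size : n%:R * (Z1 / (n%:R * h) + Z2) <= Ch * W * L * mv_size T al x m.
  have -> : n%:R * (Z1 / (n%:R * h) + Z2) = Z1 / h + n%:R * h / h * Z2.
    have hn0 : h != 0 by rewrite gt_eqF.
    have nn0 : n%:R != 0 :> R by rewrite pnatr_eq0 -lt0n.
    by field; rewrite hn0 nn0.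
  have -> : h^-1 = Ch * L by rewrite /h invrK.
  have CL0 : 0 <= Ch * L by pos.
  have V1 : 0 <= (m%:R * x%:R) `^ (2 * (1 - al)) :> R by exact: powR_ge0.
  have V2 : 0 <= x%:R `^ (1 + theta - 2 * al) :> R by exact: powR_ge0.
  have T0 : 0 <= T by lra_from T12.
  have CG : 0 <= C ^+ 4 * shift_factor theta ^+ 2 by pos.
  apply: (@le_trans _ _ (C ^+ 4 * shift_factor theta ^+ 2 * (m%:R * x%:R) `^ (2 * (1 - al)) * (Ch * L) +
     3 * T * (Ch * L) * (C ^+ 4 * shift_factor theta ^+ 2 * x%:R `^ (1 + theta - 2 * al)))).
    apply: lerD; first by rewrite ler_wpM2r.
    apply: ler_pM => //.
      by apply: mulr_ge0 => //; exact: ltW.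
    by rewrite ler_wpM2r.
  have -> : Ch * W * L * mv_size T al x m =
    3 * (C ^+ 4 * shift_factor theta ^+ 2 * (m%:R * x%:R) `^ (2 * (1 - al)) * (Ch * L)) +
     3 * T * (Ch * L) * (C ^+ 4 * shift_factor theta ^+ 2 * x%:R `^ (1 + theta - 2 * al)).
    by rewrite /mv_size /W; ring.
  rewrite lerD2r ler_peMl ?ler1n//; pos.
have mv0 : 0 <= mv_size T al x m.
  by rewrite /mv_size; apply: addr_ge0; [pos|apply: mulr_ge0; [lra_from T12|pos]].
rewrite -mulrA; apply: (@le_trans _ _ (E * ((Ch * W * L * mv_size T al x m) * ((C * (1 + length_exponent theta)) ^+ 4 * L ^+ 4)))).
  apply: ler_wpM2l; first exact: ltW.
  apply: (@le_trans _ _ (n%:R * ((Z1 / (n%:R * h) + Z2) * (\sum_(k < m) (bint B k)^-1) ^+ 4))).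
    by rewrite ler_wpM2l.
  rewrite mulrA; apply: ler_pM => //.
    apply: mulr_ge0 => //; apply: addr_ge0 => //; apply: divr_ge0 => //; exact: ltW.
  by apply: exprn_ge0; apply: sumr_ge0 => k _; rewrite invr_ge0 ltW// bint_gt0.
by apply: eq_ler; ring.
Qed.

Lemma disk_strip T al x m (t r : R) s : admissible theta T al x m -> r <= 3 - al + 3 / ln T ->
  cn (s - (3 +i* t)) <= r ->
  [/\ al - 3 / ln T <= complex.Re s, complex.Re s <= 7,
      `|t| - 4 <= `|complex.Im s| & `|complex.Im s| <= `|t| + 4].
Proof.
move=> ad hr hs; have [_ _ al1 _ al3] := admissible_facts theta_ge0 theta_lt1 ad.
have := ler_Re_cn (s - (3 +i* t)); have := ler_Im_cn (s - (3 +i* t)).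
rewrite !(cReD, cImD, cReN, cImN) /= => i1 i2.
have r4 : r <= 4 by lra_from hr al1 al3.
have := lerB_dist (complex.Im s) t; have := lerB_dist t (complex.Im s).
rewrite (distrC t) => q1 q2.
move: i2; rewrite ler_norml => /andP[i3 i4].
by split; lra_from i3 i4 i1 hs hr r4 al1 al3 q1 q2.
Qed.

(* Near the pole only the crude bounds on [(s - 1) zeta] are available. *)
Lemma low_ratio : exists2 K3 : R, 0 < K3 & forall B, well_behaved theta A K B ->
  forall (T al t : R) (x m : nat) w, admissible theta T al x m -> `|t| <= T ->
  cn w <= 3 - al + 3 / ln T ->
  zg A B (3 +i* t) != 0 /\
  cn (zg A B (3 +i* t + w)) <= expR (K3 * ln T) * cn (zg A B (3 +i* t)).
Proof.
have k00 : 0 < (1 - theta) / 2 by lra_from theta_ge0.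
have [Cu Cu1 HCu] := zg_upper K theta_ge0 theta_lt1 A_gt0 k00.
have [c0 c00 Hc0] := zeta_lower K theta_ge0 theta_lt1 A_gt0 (@ltr01 R).
have Cu0 : 0 < Cu by lra_from Cu1.
exists (`|ln (2 * Cu / c0)| + 2); first by have := normr_ge0 (ln (2 * Cu / c0)); lra_from k00.
move=> B wb T al t x m w ad tT wr.
have [L12 T12 al1 _ al3] := admissible_facts theta_ge0 theta_lt1 ad.
have low : 2 * c0 <= cn (zg A B (3 +i* t)).
  have := Hc0 B wb (3 +i* t); rewrite /= mulr1 => /(_ _) h1.
  have {}h1 : c0 <= cn (zg A B (3 +i* t) / (3 +i* t - 1)) by apply: h1; lra_from T12.
  have d2 : 2 <= cn (3 +i* t - 1).
    have := ler_Re_cn (3 +i* t - 1); rewrite cReD cReN /=.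
    by have := ler_norm (3 - 1 : R); lra_from T12.
  have d0 : 0 < cn (3 +i* t - 1) by lra_from d2.
  move: h1; rewrite cnM cnV ler_pdivlMr// => h1.
  by apply: le_trans h1; rewrite mulrC; apply: ler_wpM2l => //; exact: ltW.
have z0 : 0 < cn (zg A B (3 +i* t)) by lra_from low c00.
split; first by rewrite -cn_gt0.
have wr' : cn (3 +i* t + w - (3 +i* t)) <= 3 - al + 3 / ln T by rewrite addrAC subrr add0r.
have [q1 q2 _ q4] := disk_strip ad (lexx _) wr'.
set s := 3 +i* t + w in q1 q2 q4 *.
have up : cn (zg A B s) <= Cu * (1 + cn s) ^+ 2.
  by apply: HCu => //; rewrite q2 andbT; lra_from q1 al1.
have cs : cn s <= T + 11.
  apply: (le_trans (ler_cn_ReIm _)); rewrite ger0_norm; last by lra_from q1 al1.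
  by lra_from q2 q4 tT.
have T0 : 0 < T by lra_from T12.
apply: (le_trans up); apply: (@le_trans _ _ (Cu * (2 * T) ^+ 2)).
  apply: ler_wpM2l; first exact: ltW.
  rewrite lerXn2r ?nnegrE; [by []|by pos|by pos|by lra_from cs T12].
apply: (@le_trans _ _ (2 * Cu / c0 * T ^+ 2 * (2 * c0))).
  apply: eq_ler.
  have c0n : c0 != 0 by rewrite gt_eqF.
  by field.
apply: ler_pM => //; [by pos|by pos|].
have Q0 : 0 < 2 * Cu / c0 by pos.
have -> : 2 * Cu / c0 * T ^+ 2 = expR (ln (2 * Cu / c0) + (ln T + ln T)).
  by rewrite expRD (expRD (ln T)) !lnK ?posrE// expr2.
rewrite ler_expR.
have := ler_norm (ln (2 * Cu / c0)) => n1; have n2 := normr_ge0 (ln (2 * Cu / c0)).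
have : `|ln (2 * Cu / c0)| <= `|ln (2 * Cu / c0)| * ln T by rewrite ler_peMr//; lra_from L12.
by move=> n3; lra_from n1 n3.
Qed.

End Core2.

(** * Counting zeros *)

Section Density.
Variables (R : realType) (theta A K : R).
Hypotheses (theta_ge0 : 0 <= theta) (theta_lt1 : theta < 1) (A_gt0 : 0 < A).
Implicit Types (B : beurling R) (s : R[i]).

Local Tactic Notation "lra_from" ne_hyp_list(h) :=
  clear - theta_ge0 theta_lt1 A_gt0 K h;
  have := theta_ge0; have := theta_lt1; lra.

Lemma cderivable_detector_cofactor (z D M : R[i] -> R[i]) s :
  cderivable z s -> cderivable D s -> cderivable M s ->
  cn ((z s - D s) * M s) <= 1 / 2 ->
  cderivable (fun w => M w * (1 + (z w - D w) * M w - (D w * M w - 1)) /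
    (1 + (z w - D w) * M w) ^+ 2) s.
Proof.
move=> dz dD dM sm.
have q0 := detector_den_neq0 sm.
have dQ : cderivable (fun w => 1 + (z w - D w) * M w) s.
  exact (cderivableD (cderivable_cst 1 s) (cderivableM (cderivableB dz dD) dM)).
have dF : cderivable (fun w => D w * M w - 1) s.
  exact (cderivableB (cderivableM dD dM) (cderivable_cst 1 s)).
have dX := @cderivableX R _ 2%N _ dQ.
have qX : (1 + (z s - D s) * M s) ^+ 2 != 0 by rewrite expf_neq0.
have dV := @cderivableV R (fun w => (1 + (z w - D w) * M w) ^+ 2) s qX dX.
exact (cderivableM (cderivableM dM (cderivableB dQ dF)) dV).
Qed.

(** Origin of the threshold on [x]: for [eta = 1] the bound on the tail is [4 * C ^ 5 / x]. *)
Lemma tail_at_center B (C : R) (x m Y : nat) (b : nat -> R) s : 1 <= C ->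
  (forall k, k.+1%:R <= C * bint B k) -> (0 < x)%N -> 32 * C ^+ 5 <= x%:R ->
  (forall phi : R -> R, (forall u, 0 < u -> 0 <= phi u) ->
     (forall u v, 0 < u -> 0 < v -> phi (u * v) = phi u * phi v) ->
     \sum_(x <= j < Y) `|b j| * phi (bint B j) <= (\sum_(k < m) phi (bint B k)) ^+ 2) ->
  3 <= complex.Re s ->
  cn (\sum_(x <= j < Y) (b j)%:C * cpow (bint B j) (- s)) <= 1 / 8.
Proof.
move=> C1 n_ge x0 hx hb s3.
have C0 : 0 < C by lra_from C1.
have xR : 0 < x%:R :> R by rewrite ltr0n.
have s3' : 1 + 2 * 1 <= complex.Re s by lra_from s3.
apply: (le_trans (tail_sum_right C1 n_ge ltr01 x0 s3' hb)).
have -> : (1 + 1 : R) = 2%:R by rewrite -natr1.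
rewrite powR_mulrn ?(ltW C0)// invr1 powRr1 ?(ltW C0)// powR_inv1 ?(ltW xR)//.
have -> : C / x%:R * (C ^+ 2 * (1 + 1)) ^+ 2 = 4 * C ^+ 5 / x%:R by ring.
by rewrite ler_pdivrMr//; lra_from hx.
Qed.

(** As [r1 <= 4], each zero contributes at least [1 / (5 * L)] to the logarithm of the power. *)
Lemma count_from_power (L r1 S : R) (N : nat) : 1 <= L -> 0 < r1 <= 4 ->
  ((r1 + 1 / L) / r1) ^+ N <= expR S -> N%:R <= 5 * L * S.
Proof.
move=> L1 /andP[r0 r4] h.
have L0 : 0 < L by lra_from L1.
pose v := (5 * L)^-1.
have v0 : 0 < v by rewrite /v; pos.
have v5 : v <= 1 / 5.
  by rewrite /v div1r lef_pV2 ?posrE//; [lra_from L1|pos].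
have Lv : L^-1 = 5 * v by rewrite /v; field; rewrite gt_eqF.
have step : expR v <= (r1 + 1 / L) / r1.
  rewrite ler_pdivlMr// div1r Lv.
  have e1 := expR_ge1Dx (- v); rewrite expRN in e1.
  have e0 := expR_gt0 v.
  have e2 : (1 - v) * expR v <= 1 by rewrite -ler_pdivlMr// div1r.
  have e3 : expR v <= 1 + 5 / 4 * v by nra.
  apply: (@le_trans _ _ ((1 + 5 / 4 * v) * r1)); first by rewrite ler_wpM2r ?(ltW r0).
  by nra.
have : expR (v * N%:R) <= expR S.
  by rewrite expRM_natr; apply: le_trans h; rewrite lerXn2r ?nnegrE// ?expR_ge0//; apply: le_trans step; exact: expR_ge0.
by rewrite ler_expR /v mulrC ler_pdivrMr; [rewrite mulrC|pos].
Qed.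

(** The discs below height [U] number at most a multiple of [U * L], each at the crude cost
    [K3 * L]. They are absorbed because [U] is of order [(m * x) ^ (1 - al) * L] at most, while
    [mv_size] contains the square of that power of [m * x]. *)
Lemma size_bound (K2 K3 K4 Ch L T al U : R) (x m : nat) :
  0 < K2 -> 0 < K3 -> 0 < K4 -> 1 <= Ch -> 1 <= L -> 0 <= T -> al <= 1 -> (0 < x)%N -> (0 < m)%N ->
  U = 8 + K2 * (m%:R * x%:R) `^ (1 - al) * L ->
  5 * L * ((2 * U * (Ch * L) + 1) * (K3 * L) + 12 * (K4 * L ^+ 5 * mv_size theta T al x m)) <=
  5 * ((2 * (8 + K2) * Ch + 2) * K3 + 12 * K4) * L ^+ 6 * mv_size theta T al x m.
Proof.
move=> K20 K30 K40 Ch1 L1 T0 al1 x0 m0 UE.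
set V := mv_size theta T al x m.
have mx1 : 1 <= m%:R * x%:R :> R by rewrite -natrM ler1n muln_gt0 m0 x0.
set Y1 := (m%:R * x%:R) `^ (1 - al) in UE.
have Y11 : 1 <= Y1 by rewrite /Y1 -[leLHS](powRr0 (m%:R * x%:R)); apply: ler_powR => //; lra_from al1.
have YV : Y1 ^+ 2 <= V.
  rewrite /V /mv_size (mulrC 2) powRrM powR_mulrn ?powR_ge0// -/Y1 lerDl.
  by apply: mulr_ge0 => //; exact: powR_ge0.
have Y1V : Y1 <= V by apply: le_trans YV; rewrite expr2 ler_peMr//; lra_from Y11.
have V1 : 1 <= V by lra_from Y11 Y1V.
have V0 : 0 < V by lra_from V1.
have L0 : 0 < L by lra_from L1.
have Ch0 : 0 < Ch by lra_from Ch1.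
have UV : U <= (8 + K2) * (L * V).
  have LV : 1 <= L * V by rewrite -[leLHS]mulr1; apply: ler_pM.
  have : K2 * Y1 * L <= K2 * (L * V).
    by rewrite -mulrA ler_wpM2l ?(ltW K20)// mulrC ler_wpM2l ?(ltW L0).
  by rewrite UE mulrDl; lra_from LV.
have b1 : 2 * U * (Ch * L) + 1 <= (2 * (8 + K2) * Ch + 2) * (L ^+ 2 * V).
  have LV : 1 <= L ^+ 2 * V by rewrite -[leLHS]mulr1; apply: ler_pM => //; rewrite expr_ge1 ?(ltW L0).
  have : 2 * U * (Ch * L) <= 2 * ((8 + K2) * (L * V)) * (Ch * L).
    by apply: ler_wpM2r; [pos|lra_from UV].
  have -> : 2 * ((8 + K2) * (L * V)) * (Ch * L) = 2 * (8 + K2) * Ch * (L ^+ 2 * V) by ring.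
  by rewrite mulrDl; lra_from LV.
have b2 : (2 * U * (Ch * L) + 1) * (K3 * L) <= (2 * (8 + K2) * Ch + 2) * K3 * (L ^+ 5 * V).
  apply: (@le_trans _ _ ((2 * (8 + K2) * Ch + 2) * (L ^+ 2 * V) * (K3 * L))).
    by apply: ler_wpM2r => //; pos.
  have -> : (2 * (8 + K2) * Ch + 2) * (L ^+ 2 * V) * (K3 * L) =
     (2 * (8 + K2) * Ch + 2) * K3 * (L ^+ 3 * V) by ring.
  apply: ler_wpM2l; first by pos.
  by apply: ler_wpM2r; [exact: ltW|apply: ler_weXn2l].
apply: (@le_trans _ _ (5 * L * ((2 * (8 + K2) * Ch + 2) * K3 * (L ^+ 5 * V) + 12 * (K4 * L ^+ 5 * V)))).
  by apply: ler_wpM2l; [pos|rewrite lerD2r].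
by apply: eq_ler; ring.
Qed.

Section HighDisks.
Variables (B : beurling R) (T al U : R) (x m : nat) (mob : nat -> R).
Hypotheses (wb : well_behaved theta A K B) (ad : admissible theta T al x m) (U_ge8 : 8 <= U).
Hypothesis small : forall s, al - 3 / ln T <= complex.Re s <= 7 ->
  U - 4 <= `|complex.Im s| <= T + 4 ->
  cn ((zg A B s / (s - 1) - dsum B m s) * mollsum B mob x s) <= 1 / 2.

Definition zdetector s := detector (zg A B s / (s - 1)) (dsum B m s) (mollsum B mob x s).

Variable t : R.
Hypothesis tT : U <= `|t| <= T.

Local Tactic Notation "lra_from" ne_hyp_list(h) :=
  clear - theta_ge0 theta_lt1 A_gt0 K wb ad U_ge8 small mob tT h;
  have := theta_ge0; have := theta_lt1; lra.

Lemma high_disk s : cn (s - (3 +i* t)) < 3 - al + 3 / ln T ->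
  [/\ theta < complex.Re s, s - 1 != 0 &
      cn ((zg A B s / (s - 1) - dsum B m s) * mollsum B mob x s) <= 1 / 2].
Proof.
move=> /ltW hs; have [q1 q2 q3 q4] := disk_strip theta_ge0 theta_lt1 ad (lexx _) hs.
have [L12 T12 al1 _ _] := admissible_facts theta_ge0 theta_lt1 ad.
have /andP[t1 t2] := tT.
split; first by lra_from q1 al1.
  apply/eqP => s1; have : complex.Im (s - 1) = 0 by rewrite s1.
  rewrite cImD cImN /= subr0 => i0; move: q3; rewrite i0 normr0.
  by have := U_ge8; lra_from t1.
by apply: small; apply/andP; split => //; lra_from q3 q4 t1 t2.
Qed.

Lemma cderivable_zdetector_cofactor s : cn (s - (3 +i* t)) < 3 - al + 3 / ln T ->
  cderivable (fun w => (w - 1)^-1 * (mollsum B mob x w * (1 + (zg A B w / (w - 1) - dsum B m w) *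
    mollsum B mob x w - (dsum B m w * mollsum B mob x w - 1)) /
    (1 + (zg A B w / (w - 1) - dsum B m w) * mollsum B mob x w) ^+ 2)) s.
Proof.
move=> /high_disk[ts s1 sm].
have dg := cderivable_zg theta_ge0 theta_lt1 A_gt0 wb ts.
have ds1 : cderivable (fun w => w - 1) s.
  exact (cderivableB (cderivable_id s) (cderivable_cst 1 s)).
have dv := @cderivableV R (fun w => w - 1) s s1 ds1.
have dz := cderivableM dg dv.
exact (cderivableM dv (cderivable_detector_cofactor dz (@cderivable_dsum R B m s)
  (@cderivable_mollsum R B mob x s) sm)).
Qed.

Lemma zdetectorE s : zdetector s = zg A B s * ((s - 1)^-1 * (mollsum B mob x s *
    (1 + (zg A B s / (s - 1) - dsum B m s) *
    mollsum B mob x s - (dsum B m s * mollsum B mob x s - 1)) /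
    (1 + (zg A B s / (s - 1) - dsum B m s) * mollsum B mob x s) ^+ 2)).
Proof. by rewrite /zdetector /detector -!mulrA. Qed.

Lemma cderivable_zdetector s : cn (s - (3 +i* t)) < 3 - al + 3 / ln T ->
  cderivable zdetector s.
Proof.
move=> hs; have [ts _ _] := high_disk hs.
have dg := cderivable_zg theta_ge0 theta_lt1 A_gt0 wb ts.
exact (cderivable_ext (cderivableM dg (cderivable_zdetector_cofactor hs))
  (fun w => esym (zdetectorE w))).
Qed.

Lemma vanishes_to_zdetector rho k : cn (rho - (3 +i* t)) < 3 - al + 3 / ln T ->
  vanishes_to (zg A B) rho k -> vanishes_to zdetector rho k.
Proof.
move=> hr hv.
set c := 3 +i* t in hr.
have e0 : 0 < 3 - al + 3 / ln T - cn (rho - c) by rewrite subr_gt0.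
have near w : cn (w - rho) < 3 - al + 3 / ln T - cn (rho - c) -> cn (w - c) < 3 - al + 3 / ln T.
  move=> hw; have -> : w - c = (w - rho) + (rho - c) by rewrite addrA subrK.
  by apply: le_lt_trans (cnD _ _) _; rewrite -ltrBrDr.
apply: (vanishes_to_near e0 (f := fun w => zg A B w * _) (fun w _ => esym (zdetectorE w))).
apply: (vanishes_toM e0 _ hv) => w hw.
exact (cderivable_zdetector_cofactor (near w hw)).
Qed.

Lemma high_ratio w : cn w < 3 - al + 3 / ln T ->
  cn (dsum B m (3 +i* t) * mollsum B mob x (3 +i* t) - 1) <= 1 / 8 ->
  cn (zdetector (3 +i* t + w)) <=
    expR (4 * cn (dsum B m (3 +i* t + w) * mollsum B mob x (3 +i* t + w) - 1) ^+ 2 +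
      8 * cn (dsum B m (3 +i* t) * mollsum B mob x (3 +i* t) - 1) ^+ 2) *
    cn (zdetector (3 +i* t)).
Proof.
move=> hw hF.
have h1 : cn (3 +i* t + w - (3 +i* t)) < 3 - al + 3 / ln T by rewrite addrAC subrr add0r.
have [L12 T12 al1 _ al3] := admissible_facts theta_ge0 theta_lt1 ad.
have [_ /andP[_ alle] _ _] := ad.
have h0 : cn (3 +i* t - (3 +i* t)) < 3 - al + 3 / ln T.
  by rewrite subrr cn0; have := cn_ge0 w; lra_from hw.
have [_ _ s1] := high_disk h1; have [_ _ s0] := high_disk h0.
have d1 := detector_le s1; have d0 := detector_ge s0 hF.
apply: (le_trans d1); rewrite expRD -mulrA ler_peMr ?expR_ge0//.
apply: (@le_trans _ _ (expR (8 * cn (dsum B m (3 +i* t) * mollsum B mob x (3 +i* t) - 1) ^+ 2) *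
  expR (- (8 * cn (dsum B m (3 +i* t) * mollsum B mob x (3 +i* t) - 1) ^+ 2)))).
  by rewrite -expRD subrr expR0.
by apply: ler_wpM2l; [exact: expR_ge0|exact: d0].
Qed.

Lemma high_center_neq0 :
  cn (dsum B m (3 +i* t) * mollsum B mob x (3 +i* t) - 1) <= 1 / 8 ->
  zdetector (3 +i* t) != 0.
Proof.
move=> hF.
have [L12 T12 al1 _ al3] := admissible_facts theta_ge0 theta_lt1 ad.
have [_ /andP[_ alle] _ _] := ad.
have L0 : 0 < ln T by lra_from L12.
have L3 : 0 < 3 / ln T by pos.
have h0 : cn (3 +i* t - (3 +i* t)) < 3 - al + 3 / ln T.
  by rewrite subrr cn0; lra_from alle L3.
have [_ _ s0] := high_disk h0.
by rewrite -cn_gt0; apply: lt_le_trans (detector_ge s0 hF); exact: expR_gt0.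
Qed.

End HighDisks.

Lemma low_count (n : nat) (t0 h U : R) : 0 < h -> 0 <= U ->
  (\sum_(i < n | `|t0 + i%:R * h| < U) 1 : R) <= 2 * U / h + 1.
Proof.
move=> h0 U0; rewrite sumr_const.
have UU : 0 <= 2 * U / h by apply: divr_ge0; [lra_from U0|exact: ltW].
have /andP[N1 _] := truncn_itv UU.
set N := Num.truncn (2 * U / h) in N1.
apply: (@le_trans _ _ (N.+1%:R)); last by rewrite -natr1 lerD2r.
rewrite ler_nat; pose P (i : 'I_n) := `|t0 + i%:R * h| < U.
have diam i j : P i -> P j -> (j <= i + N)%N.
  rewrite /P !ltr_norml => /andP[i1 i2] /andP[j1 j2].
  case: (leqP j i) => [ji|ij]; first exact: leq_trans ji (leq_addr _ _).
  rewrite -leq_subLR /N truncn_ge_nat// ler_pdivlMr// natrB ?(ltnW ij)//.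
  by rewrite mulrBl; lra_from i1 j2.
exact (card_le_diameter diam).
Qed.

Lemma density_core : exists C0 kap X0 : R, [/\ 0 < C0, 0 < kap &
  forall B, well_behaved theta A K B ->
  forall (T al : R) (x m : nat) (zs : seq (R[i] * nat)),
  admissible theta T al x m ->
  T * m%:R `^ (theta - al) * x%:R `^ (1 - al) * ln T <= kap -> X0 <= x%:R ->
  uniq (map fst zs) ->
  (forall p, p \in zs -> [/\ al <= complex.Re p.1 <= 1, `|complex.Im p.1| <= T &
     vanishes_to (zg A B) p.1 p.2]) ->
  (\sum_(p <- zs) p.2)%:R <= C0 * ln T ^+ 6 * mv_size theta T al x m].
Proof.
have [C C1 HC] := bint_asymptotics K theta_ge0 theta_lt1 A_gt0.
have [Ch [K4 [Ch1 K40 Hmv]]] := tail_mean_value K theta_ge0 theta_lt1 A_gt0.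
have [kap [K2 [kap0 K20 Herr]]] := mollified_error K theta_ge0 theta_lt1 A_gt0.
have [K3 K30 Hlow] := low_ratio K theta_ge0 theta_lt1 A_gt0.
exists (5 * ((2 * (8 + K2) * Ch + 2) * K3 + 12 * K4)), kap, (32 * C ^+ 5).
have Ch0 : 0 < Ch by lra_from Ch1.
split => //; first by pos.
move=> B wb T al x m zs ad hkap hX uzs hzs.
have [L12 T12 al1 al2 al3] := admissible_facts theta_ge0 theta_lt1 ad.
have [_ /andP[al4 alle] xxm lm] := ad.
have [x0 xm] := andP xxm.
have [n_ge n_le] := HC B wb.
have m0 : (0 < m)%N by exact: leq_trans x0 xm.
have [mob [mob1 /(_ m x xxm) [Y [b [b1 b2 b3 b4]]]]] := mollifier B.
pose tail s : R[i] := \sum_(x <= j < Y) (b j)%:C * cpow (bint B j) (- s).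
have FE s : dsum B m s * mollsum B mob x s - 1 = tail s.
  have := b1 (fun u => cpow u (- s)) (cpow1 (- s)) (fun u v u0 v0 => cpowM (- s) u0 v0).
  by rewrite -/(dsum B m s) -/(mollsum B mob x s) -/(tail s) => ->; rewrite addrAC subrr add0r.
set L := ln T in L12 al1 al2 al3 lm hkap *.
have L0 : 0 < L by lra_from L12.
have L1 : 1 <= L by lra_from L12.
have T0 : 0 < T by lra_from T12.
have [U UE] : exists U, U = 8 + K2 * (m%:R * x%:R) `^ (1 - al) * L by eexists.
have U8 : 8 <= U by rewrite UE lerDl; pos.
pose h := (Ch * L)^-1.
have h0 : 0 < h by rewrite /h; pos.
have hL : h <= 1 / L.
  rewrite /h div1r lef_pV2 ?posrE//; last by pos.
  by rewrite ler_peMl// ltW.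
have iL : 1 / L <= 1 / 12.
  by rewrite !div1r lef_pV2 ?posrE//; lra_from L12.
have L3 : 3 / L = 3 * (1 / L) by rewrite mul1r.
(* [N] is the last index with [t i <= T], so the grid fills [[-T, T]] without leaving it. *)
pose N := Num.truncn (2 * T / h); pose n := N.+1.
have Th : 0 <= 2 * T / h by apply: divr_ge0; [lra_from T0|exact: ltW].
have /andP[N1 N2] := truncn_itv Th; rewrite -/N in N1 N2.
have nh : 2 * T <= n%:R * h <= 3 * T.
  apply/andP; split; first by rewrite -ler_pdivrMr// ltW.
  rewrite /n -natr1 mulrDl mul1r; move: N1; rewrite ler_pdivlMr// => N1.
  by lra_from N1 hL iL T12.
pose t (i : nat) : R := - T + i%:R * h.
pose c (i : nat) : R[i] := 3 +i* t i.
have tT (i : 'I_n) : `|t i| <= T.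
  have i1 : i%:R * h <= 2 * T.
    rewrite -ler_pdivlMr//; apply: le_trans N1; rewrite ler_nat -ltnS; exact: ltn_ord.
  have i0 : 0 <= i%:R * h by apply: mulr_ge0; [exact: ler0n|exact: ltW].
  by rewrite ler_norml /t; apply/andP; split; lra_from i0 i1.
pose lo (i : nat) := `|t i| < U.
have tU (i : 'I_n) : lo i = false -> U <= `|t i| <= T by move=> /negbT; rewrite -leNgt tT andbT.
(* The low discs use the function cleared of its pole, the others the detector; one product serves
   both. *)
pose f (i : 'I_n) : R[i] -> R[i] := if lo i then zg A B else zdetector B x m mob.
(* A zero lies within [3 - al] horizontally and [h <= 1 / L] vertically of its centre, whence [r1].
   One further [1 / L] creates the ratio in Jensen's inequality, and another leaves room for the
   open domain. *)
pose r1 := 3 - al + 1 / L; pose r := r1 + 1 / L; pose r' := 3 - al + 3 / L.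
have iL0 : 0 < 1 / L by pos.
have rr' : r < r' by rewrite /r /r1 /r' L3; lra_from iL0.
have small := Herr B wb T al U x m mob ad mob1 hkap.
rewrite -/L -UE in small; have {}small := small (lexx _).
have Fc i : cn (tail (c i)) <= 1 / 8.
  have s3 : 3 <= complex.Re (c i) by rewrite /c /=.
  exact (tail_at_center C1 n_ge x0 hX b4 s3).
have Fc' i : cn (dsum B m (c i) * mollsum B mob x (c i) - 1) <= 1 / 8 by rewrite FE.
pose Sj (i : nat) w : R := if lo i then K3 * L else
  4 * cn (tail (c i + w)) ^+ 2 + 8 * cn (tail (c i)) ^+ 2.
have ratio (i : 'I_n) w : cn w = r -> cn (f i (c i + w)) <= expR (Sj i w) * cn (f i (c i)).
  move=> wr; have wr' : cn w < r' by rewrite wr.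
  rewrite /f /Sj; case li : (lo i).
    by have [_] := Hlow B wb T al (t i) x m w ad (tT i) (ltW wr').
  have := high_ratio ad U8 small (tU i li) wr' (Fc' i).
  by rewrite !FE.
(* Translation by [u] sends the centres to another vertical grid, so the mean value applies with
   [u = w] on the circle and with [u = 0] at the centres. *)
have mvw (u : R[i]) : al - 3 / L <= 3 + complex.Re u ->
    \sum_(i < n) cn (tail (c i + u)) ^+ 2 <= K4 * L ^+ 5 * mv_size theta T al x m.
  move=> hu.
  have := Hmv B wb T al x m b Y n (3 + complex.Re u) (- T + complex.Im u) ad b2 b3 hu nh.
  rewrite -/L -/h; apply: le_trans; apply: eq_ler.
  apply: eq_bigr => i _; congr (cn _ ^+ 2); apply: eq_bigr => j _; congr (_ * cpow _ (- _)).
  by apply: complex_eq; rewrite !(cReD, cImD) /= /t; ring.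
set V := mv_size theta T al x m in mvw *.
pose S : R := (2 * U * (Ch * L) + 1) * (K3 * L) + 12 * (K4 * L ^+ 5 * V).
have sumS w : cn w = r -> \sum_(i < n) Sj i w <= S.
  move=> wr.
  have w1 : al - 3 / L <= 3 + complex.Re w.
    have := ler_Re_cn w; rewrite wr ler_norml => /andP[q1 _].
    by move: rr'; rewrite /r'; lra_from q1.
  have w2 : al - 3 / L <= 3 + complex.Re (0 : R[i]) by rewrite /=; lra_from alle L3 iL0.
  have m1 := mvw w w1; have m2 := mvw 0 w2.
  have m2' : \sum_(i < n) cn (tail (c i)) ^+ 2 <= K4 * L ^+ 5 * V.
    by apply: le_trans m2; apply: eq_ler; apply: eq_bigr => i _; rewrite addr0.
  apply: (@le_trans _ _ (\sum_(i < n) ((if lo i then 1 else 0) * (K3 * L) +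
     (4 * cn (tail (c i + w)) ^+ 2 + 8 * cn (tail (c i)) ^+ 2)))).
    apply: ler_sum => i _; rewrite /Sj; case: (lo i); last by rewrite mul0r add0r.
    by rewrite mul1r lerDl; pos.
  rewrite big_split /= -mulr_suml -big_mkcond /= big_split /= -!mulr_sumr /S.
  apply: lerD; last by lra_from m1 m2'.
  apply: ler_wpM2r; first by pos.
  have U0 : 0 <= U by lra_from U8.
  apply: (le_trans (low_count n (- T) h0 U0)).
  by rewrite /h invrK.
have VV : 0 <= V by rewrite /V /mv_size; apply: addr_ge0; [pos|apply: mulr_ge0; [exact: ltW|pos]].
(* Each zero goes to the grid point at or just below its ordinate. *)
pose idx (p : R[i] * nat) : 'I_n := inord (Num.truncn ((complex.Im p.1 + T) / h)).
have idxP p : p \in zs -> t (idx p) <= complex.Im p.1 < t (idx p) + h.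
  move=> /hzs[_]; rewrite ler_norml => /andP[p1 p2] _.
  have q0 : 0 <= (complex.Im p.1 + T) / h by apply: divr_ge0; [lra_from p1|exact: ltW].
  have q1 : (Num.truncn ((complex.Im p.1 + T) / h) < n)%N.
    rewrite ltnS /N; apply: le_truncn; apply: ler_wpM2r; first by rewrite invr_ge0 ltW.
    by lra_from p2.
  have /andP[q2 q3] := truncn_itv q0.
  rewrite /t /idx inordK//; move: q2 q3; rewrite ler_pdivlMr// ltr_pdivrMr// -natr1 => q2 q3.
  by apply/andP; split; lra_from q2 q3.
pose zsj (i : 'I_n) := [seq p <- zs | idx p == i].
have dist p : p \in zs -> cn (p.1 - c (idx p)) <= r1.
  move=> pz; have [/andP[p1 p2] _ _] := hzs p pz; have /andP[p3 p4] := idxP p pz.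
  apply: (le_trans (ler_cn_ReIm _)); rewrite !(cReD, cImD, cReN, cImN) /=.
  rewrite ler0_norm ?ger0_norm; [|by lra_from p3|by lra_from p2].
  by rewrite /r1; lra_from p1 p3 p4 hL.
have r10 : 0 < r1 <= 4 by apply/andP; split; rewrite /r1; [lra_from alle iL0|lra_from al1 L3 iL iL0].
have total : (\sum_(i < n) \sum_(p <- zsj i) p.2 = \sum_(p <- zs) p.2)%N.
  rewrite (eq_bigr (fun i => \sum_(p <- zs | idx p == i) p.2)%N); last first.
    by move=> i _; rewrite /zsj big_filter.
  rewrite (exchange_big_dep predT)//=; apply: eq_bigr => p _.
  by rewrite (big_pred1 (idx p)).
have key : (r / r1) ^+ (\sum_(i < n) \sum_(p <- zsj i) p.2) <= expR S.
  apply: (@jensen_product R n f (fun i => c i) r r' r1 S zsj) => //.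
  - by case/andP: r10.
  - by rewrite /r lerDl ltW.
  - move=> i w hw; rewrite /f; case li : (lo i).
      have [q1 _ _ _] := disk_strip theta_ge0 theta_lt1 ad (lexx _) (ltW hw).
      have ts : theta < complex.Re w by rewrite -/L in q1; lra_from q1 al1.
      exact (cderivable_zg theta_ge0 theta_lt1 A_gt0 wb ts).
    exact (cderivable_zdetector wb ad U8 small (tU i li) hw).
  - move=> i; rewrite /f; case li : (lo i).
      have w0 : cn (0 : R[i]) <= 3 - al + 3 / ln T by rewrite cn0 -/L; lra_from alle L3 iL0.
      by have [] := Hlow B wb T al (t i) x m 0 ad (tT i) w0.
    exact (high_center_neq0 ad U8 small (tU i li) (Fc' i)).
  - move=> i; rewrite /zsj; apply: (@subseq_uniq _ _ (map fst zs)) => //.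
    by apply: map_subseq; exact: filter_subseq.
  - move=> i p; rewrite /zsj mem_filter => /andP[/eqP ip pz].
    have [/andP[p1 p2] p3 p4] := hzs p pz.
    have d1 : cn (p.1 - c i) <= r1 by rewrite -ip; exact: dist.
    split => //.
      apply/eqP => pc; have : complex.Re p.1 = 3 by rewrite pc.
      by lra_from p2.
    rewrite /f; case li : (lo i) => //.
    apply: (vanishes_to_zdetector wb ad U8 small (tU i li) _ p4).
    apply: (le_lt_trans d1); apply: lt_trans rr'; by rewrite /r ltrDl.
  - move=> w wr; apply: (@le_trans _ _ (\prod_(i < n) (expR (Sj i w) * cn (f i (c i))))).
      by apply: ler_prod => i _; rewrite cn_ge0 ratio.
    rewrite big_split /= -expR_sum; apply: ler_wpM2r; last by rewrite ler_expR sumS.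
    by apply: prodr_ge0 => i _; exact: cn_ge0.
rewrite total in key.
apply: (le_trans (count_from_power L1 r10 key)).
exact (size_bound K20 K30 K40 Ch1 L1 (ltW T0) alle x0 m0 UE).
Qed.

End Density.

(** * Choice of the parameters *)

Section Exponents.
Variable R : realType.

Lemma round_up (X : R) : 1 <= X -> exists2 k : nat, k = (Num.truncn X).+1 & X <= k%:R <= 2 * X.
Proof.
move=> X1; exists (Num.truncn X).+1 => //.
have /andP[h1 h2] := @truncn_itv R X (le_trans ler01 X1).
by rewrite (ltW h2) /= -natr1; lra.
Qed.

(** [a] solves [2 * (1 - mu) * (1 + a) / mu = 1 - a * (2 * mu - 1)], which balances the two terms of
    [mv_size]; the common value is [cmu mu * (1 - mu)]. *)
Lemma exponent_facts (mu : R) : 2 / 3 <= mu <= 1 ->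
  let D := 2 * mu ^+ 2 - 3 * mu + 2 in let a := (3 * mu - 2) / D in
  [/\ 0 < D, D <= 1, 3 * mu - 2 <= a, a <= 1 &
      1 + a = cmu mu * mu / 2 /\ 1 - a * (2 * mu - 1) = cmu mu * (1 - mu)].
Proof.
move=> /andP[h1 h2] D a.
have D0 : 0 < D by rewrite /D; nra.
have D1 : D <= 1 by rewrite /D; nra.
have Dn : D != 0 by rewrite gt_eqF.
split => //.
- rewrite /a ler_pdivlMr// ler_piMr//; lra.
- by rewrite /a ler_pdivrMr// mul1r /D; nra.
- by split; rewrite /a /cmu -/D; apply: (mulIf Dn); rewrite /D in Dn *; field.
Qed.

End Exponents.

(** * The lengths as powers of [T], and the passage from finite lists of zeros to [zero_count] *)

Section Final.
Variables (R : realType) (theta A K : R).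
Hypotheses (theta_ge0 : 0 <= theta) (theta_lt1 : theta < 1) (A_gt0 : 0 < A).
Implicit Types (B : beurling R) (s : R[i]).

Local Tactic Notation "lra_from" ne_hyp_list(h) :=
  clear - theta_ge0 theta_lt1 A_gt0 K h;
  have := theta_ge0; have := theta_lt1; lra.

(* With [X = T ^ (a / (1 - theta))] and [Z = T ^ (b / (1 - theta))], the choice of [b] makes
   [T Z ^ (theta - al) X ^ (1 - al) = T ^ (- e)], and the choice of [a] balances
   [(Z X) ^ (2 (1 - al))] against [T X ^ (1 + theta - 2 al)]. *)
Lemma choose_lengths (kap X0 eps delta : R) : 0 < kap -> 0 < eps -> 0 < delta ->
  exists T0 : R, forall T mu, T0 <= T -> 2 / 3 + delta <= mu <= 1 ->
  exists x m, let al := (1 - mu) * theta + mu in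
    [/\ admissible theta T al x m,
        T * m%:R `^ (theta - al) * x%:R `^ (1 - al) * ln T <= kap, X0 <= x%:R &
        mv_size theta T al x m <= 17 * T `^ ((cmu mu + eps) * (1 - mu))].
Proof.
move=> kap0 eps0 delta0.
(* A third of [eps] suffices because [mu >= 2 / 3] makes the loss [2 * e / mu] at most [3 * e]; the
   cap at 1/3 yields [b <= 5 / 2]. *)
pose e := Num.min eps 1 / 3.
have e0 : 0 < e by rewrite /e divr_gt0// lt_min eps0 ltr01.
have e1 : e <= 1 / 3 by rewrite /e ler_pM2r ?invr_gt0// ge_min lexx orbT.
have ee : 3 * e <= eps.
  have -> : 3 * e = Num.min eps 1 by rewrite /e; field.
  by rewrite ge_min lexx.
(* The first two summands give admissibility, the third the condition with [kap], the last
   [X0 <= x]. *)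
pose Lmin := 36 / (1 - theta) + 12 + 8 / (e ^+ 2 * kap) + `|X0| / (3 * delta).
have u0 : 0 < 1 - theta by lra_from theta_lt1.
exists (expR Lmin) => T mu TT /andP[mu1 mu2].
have q1 : 0 <= 36 / (1 - theta) by pos.
have q2 : 0 <= 8 / (e ^+ 2 * kap) by pos.
have q3 : 0 <= `|X0| / (3 * delta) by pos.
have T0 : 0 < T by apply: lt_le_trans TT; exact: expR_gt0.
have LL : Lmin <= ln T by rewrite -[leLHS]expRK ler_ln ?posrE ?expR_gt0.
set L := ln T in LL.
have L1 : 36 / (1 - theta) + 12 <= L by move: LL; rewrite /Lmin; lra_from q2 q3.
have L2 : 8 / (e ^+ 2 * kap) <= L by move: LL; rewrite /Lmin; lra_from q1 q3.
have L3 : `|X0| / (3 * delta) <= L by move: LL; rewrite /Lmin; lra_from q1 q2.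
have L12 : 12 <= L by lra_from L1 q1.
have L0 : 0 < L by lra_from L12.
have T1 : 1 <= T.
  by rewrite -[leRHS](lnK (_ : T \is Num.pos)) ?posrE// -/L -[leLHS]expR0 ler_expR ltW.
have Tn : T == 0 = false by rewrite gt_eqF.
have powE y : T `^ y = expR (y * L) by rewrite /powR Tn.
have mur : 2 / 3 <= mu <= 1 by apply/andP; split => //; lra_from mu1 delta0.
have [] := exponent_facts mur.
set D := 2 * mu ^+ 2 - 3 * mu + 2; set a := (3 * mu - 2) / D => D0 D1 a0 a1 [a2 a3].
have mu0 : 0 < mu by lra_from mu1 delta0.
have mun : mu != 0 by rewrite gt_eqF.
have a00 : 3 * delta <= a by lra_from a0 mu1.
have apos : 0 < a by lra_from a00 delta0.
pose b := (1 + e + a * (1 - mu)) / mu.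
have bmu : b * mu = 1 + e + a * (1 - mu) by rewrite /b divfK.
have amu : 0 <= a * (1 - mu) by apply: mulr_ge0; [exact: ltW|lra_from mu2].
have amu' : a * (1 - mu) <= 1 / 3.
  apply: (@le_trans _ _ (1 * (1 / 3))); last by rewrite mul1r.
  by apply: ler_pM; [exact: ltW|lra_from mu2|exact: a1|lra_from mu1 delta0].
have b1 : 1 <= b by rewrite /b ler_pdivlMr// mul1r; lra_from mu2 e0 amu.
have b2 : b <= 5 / 2 by rewrite /b ler_pdivrMr//; lra_from e1 amu' mu1 delta0.
have ab : 2 * (a + b) <= cmu mu + eps.
  have -> : 2 * (a + b) = cmu mu + 2 * e / mu.
    have -> : cmu mu = 2 * (1 + a) / mu by rewrite a2; field.
    by rewrite /b; field.
  have : 2 * e / mu <= 3 * e.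
    rewrite ler_pdivrMr//; have : 2 / 3 * e <= mu * e by rewrite ler_wpM2r ?(ltW e0)//; lra_from mu1 delta0.
    lra.
  by lra_from ee.
pose X := T `^ (a / (1 - theta)); pose Z := T `^ (b / (1 - theta)).
have ua : a <= a / (1 - theta).
  rewrite ler_pdivlMr// ler_piMr ?(ltW apos)//; lra_from theta_ge0.
have X1 : 1 <= X by rewrite /X -[leLHS](powRr0 T); apply: ler_powR => //; lra_from ua apos.
have XZ : X <= Z.
  by rewrite /X /Z; apply: ler_powR => //; rewrite ler_pM2r ?invr_gt0//; lra_from a1 b1.
have Z1 := le_trans X1 XZ.
have [x xE /andP[x1 x2]] := round_up X1; have [m mE /andP[m1 m2]] := round_up Z1.
have Xp : 0 < X by lra_from X1. have Zp : 0 < Z by lra_from Z1.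
have xR : 0 < x%:R :> R by lra_from x1 Xp.
have mR : 0 < m%:R :> R by lra_from m1 Zp.
exists x, m => al.
have alE1 : al - theta = mu * (1 - theta) by rewrite /al; ring.
have alE2 : 1 - al = (1 - mu) * (1 - theta) by rewrite /al; ring.
have al0 : 0 <= 1 - al by rewrite alE2; apply: mulr_ge0; [lra_from mu2|exact: ltW].
have alm : theta + 2 / 3 * (1 - theta) <= al.
  have : 2 / 3 * (1 - theta) <= mu * (1 - theta) by rewrite ler_wpM2r ?(ltW u0)//; lra_from mu1 delta0.
  by move=> g; lra_from g alE1.
have al1 : 1 - al <= 1 by lra_from alm.
have un : 1 - theta != 0 by rewrite gt_eqF.
have Xpow y : X `^ (y * (1 - theta)) = T `^ (a * y).
  by rewrite /X -powRrM; congr (_ `^ _); field.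
have Zpow y : Z `^ (y * (1 - theta)) = T `^ (b * y).
  by rewrite /Z -powRrM; congr (_ `^ _); field.
have xpow1 : x%:R `^ (1 - al) <= 2 * T `^ (a * (1 - mu)).
  apply: (@le_trans _ _ ((2 * X) `^ (1 - al))).
    by apply: ge0_ler_powR => //; rewrite ?nnegrE ?(ltW xR)//; lra_from Xp.
  rewrite powRM ?(ltW Xp)// -Xpow -alE2 ler_wpM2r ?powR_ge0//.
  by apply: ler_powR_1 => //; rewrite ler1n.
have mpow1 : m%:R `^ (theta - al) <= T `^ (- (b * mu)).
  have -> : theta - al = - (mu * (1 - theta)) by rewrite -alE1; ring.
  rewrite !powRN -Zpow lef_pV2 ?posrE ?powR_gt0//.
  apply: ge0_ler_powR; rewrite ?nnegrE ?(ltW mR) ?(ltW Zp)//.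
  by apply: mulr_ge0; exact: ltW.
split.
- split => //.
  + by apply/andP; split => //; lra_from al0.
  + rewrite xE mE /= ltnS; exact: le_truncn.
  + have : ln m%:R <= ln (2 * Z) by rewrite ler_ln ?posrE//; lra_from Zp.
    rewrite lnM ?posrE// /Z ln_powR -/L /length_exponent.
    have l2 : ln (2 : R) < 2 by apply: ln_sublinear.
    have : b / (1 - theta) * L <= 5 / 2 / (1 - theta) * L.
      by apply: ler_wpM2r; [exact: ltW|rewrite ler_pM2r ?invr_gt0].
    have : 0 <= L / (1 - theta) by apply: divr_ge0; exact: ltW.
    have -> : (3 / (1 - theta) + 1) * L = 3 * (L / (1 - theta)) + L by field.
    have -> : 5 / 2 / (1 - theta) * L = 5 / 2 * (L / (1 - theta)) by field.
    by move=> g1 g2 g3; lra_from l2 g1 g2 g3 L12.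
- apply: (@le_trans _ _ (T * T `^ (- (b * mu)) * (2 * T `^ (a * (1 - mu))) * L)).
    apply: ler_wpM2r; first exact: ltW.
    apply: ler_pM; [by pos|by pos|by rewrite ler_wpM2l ?(ltW T0)|exact: xpow1].
  have -> : T * T `^ (- (b * mu)) * (2 * T `^ (a * (1 - mu))) * L = 2 * L * T `^ (- e).
    rewrite -{1}[T]powRr1 ?(ltW T0)//.
    have -> : - e = 1 + - (b * mu) + a * (1 - mu) by rewrite bmu; ring.
    by rewrite !powRD ?Tn ?implybT//; ring.
  rewrite powE mulNr expRN ler_pdivrMr ?expR_gt0//.
  (* A quadratic lower bound for the exponential absorbs the factor [L] and the constant [kap]. *)
  have big : (e * L / 2) ^+ 2 <= expR (e * L).
    have -> : e * L = e * L / 2 + e * L / 2 by field.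
    rewrite expRD -expr2 lerXn2r ?nnegrE ?expR_ge0//; first by pos.
    have -> : (e * L / 2 + e * L / 2) / 2 = e * L / 2 by field.
    by apply: le_trans (expR_ge1Dx _); lra_from L0.
  apply: (@le_trans _ _ (kap * (e * L / 2) ^+ 2)); last by rewrite ler_wpM2l ?(ltW kap0).
  move: L2; rewrite ler_pdivrMr; last by pos.
  move=> L2; have : 8 * L <= L * (e ^+ 2 * kap) * L by rewrite ler_wpM2r ?(ltW L0).
  have -> : kap * (e * L / 2) ^+ 2 = L * (e ^+ 2 * kap) * L / 4 by field.
  by move=> g; lra_from g.
- apply: (le_trans (ler_norm X0)); apply: le_trans x1; rewrite /X powE.
  apply: (@le_trans _ _ (3 * delta * L)).
    by move: L3; rewrite ler_pdivrMr; [rewrite mulrC|pos].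
  apply: (@le_trans _ _ (a / (1 - theta) * L)).
    by rewrite ler_wpM2r ?(ltW L0)//; lra_from ua a00.
  by apply: le_trans (expR_ge1Dx _); lra_from L0.
(* Rounding both lengths up costs at most [4 ^ 2], the exponent [2 * (1 - al)] being at most 2; the
   second term has constant 1. *)
- rewrite /mv_size.
  have -> : 17 * T `^ ((cmu mu + eps) * (1 - mu)) =
     16 * T `^ ((cmu mu + eps) * (1 - mu)) + T `^ ((cmu mu + eps) * (1 - mu)) by ring.
  apply: lerD.
    apply: (@le_trans _ _ ((4 * (Z * X)) `^ (2 * (1 - al)))).
      apply: ge0_ler_powR; rewrite ?nnegrE; [by lra_from al0|by pos|by pos|].
      have -> : 4 * (Z * X) = (2 * Z) * (2 * X) by ring.
      by apply: ler_pM => //; exact: ltW.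
    have ZX0 : 0 <= Z * X by pos.
    rewrite powRM//; apply: ler_pM; rewrite ?powR_ge0//.
      apply: (@le_trans _ _ ((4 : R) `^ 2%:R)).
        by apply: ler_powR; [rewrite ler1n|lra_from al1].
      by rewrite powR_mulrn// expr2 -natrM.
    rewrite powRM ?(ltW Zp) ?(ltW Xp)// alE2 mulrA Zpow Xpow -powRD ?Tn ?implybT//.
    apply: ler_powR => //.
    have -> : b * (2 * (1 - mu)) + a * (2 * (1 - mu)) = 2 * (a + b) * (1 - mu) by ring.
    by apply: ler_wpM2r => //; lra_from mu2.
  have -> : 1 + theta - 2 * al = - ((2 * mu - 1) * (1 - theta)) by rewrite /al; ring.
  apply: (@le_trans _ _ (T * T `^ (- (a * (2 * mu - 1))))).
    apply: ler_wpM2l; first exact: ltW.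
    rewrite !powRN -Xpow lef_pV2 ?posrE ?powR_gt0//.
    apply: ge0_ler_powR; rewrite ?nnegrE ?(ltW xR) ?(ltW Xp)//.
    by apply: mulr_ge0; [lra_from mu1 delta0|exact: ltW].
  rewrite -{1}[T]powRr1 ?(ltW T0)// -powRD ?Tn ?implybT// a3.
  apply: ler_powR => //; apply: ler_wpM2r; first by lra_from mu2.
  by lra_from eps0.
Qed.

Lemma zeta_neq0_right B s : well_behaved theta A K B -> 1 < complex.Re s ->
  bzeta theta B s != 0.
Proof.
move=> wb s1.
have eta0 : 0 < (complex.Re s - 1) / 2 by lra_from s1.
have [c c0 Hc] := zeta_lower K theta_ge0 theta_lt1 A_gt0 eta0.
have sn : s != 1 by apply/eqP => E; move: s1; rewrite E /= ltxx.
rewrite (bzetaE theta_ge0 theta_lt1 A_gt0 wb _ sn); last by lra_from s1.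
by rewrite -cn_gt0; apply: (lt_le_trans c0); apply: Hc => //; lra_from s1.
Qed.

Lemma vanishes_to_bzeta B rho m : well_behaved theta A K B -> theta < complex.Re rho -> rho != 1 ->
  (exists g : R[i] -> R[i], \forall s \near (rho : R[i]^o),
     cderivable g s /\ bzeta theta B s = (s - rho) ^+ m * g s) ->
  vanishes_to (zg A B) rho m.
Proof.
move=> wb trho rho1 [g /near_cnP[e e0 He]].
have hv : vanishes_to (bzeta theta B) rho m by exists e, g.
have r1 : 0 < cn (rho - 1) by rewrite cn_gt0 subr_eq0.
pose e' := Num.min (complex.Re rho - theta) (cn (rho - 1)).
have e'0 : 0 < e' by rewrite /e' lt_min subr_gt0 trho r1.
apply: (vanishes_to_near e'0 (f := fun w => bzeta theta B w * (w - 1))); last first.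
  apply: (vanishes_toM e'0 _ hv) => w _.
  exact (cderivableB (cderivable_id w) (cderivable_cst 1 w)).
move=> w; rewrite /e' lt_min => /andP[w1 w2].
have wn : w - 1 != 0.
  rewrite -cn_gt0; have := cnBl (rho - 1) (rho - w).
  have -> : rho - 1 - (rho - w) = w - 1 by ring.
  by rewrite (cn_sym rho w); lra_from w2.
have tw : theta < complex.Re w.
  have := ler_Re_cn (w - rho); rewrite cReD cReN ler_norml => /andP[g1 _].
  by lra_from g1 w1.
by rewrite (bzetaE theta_ge0 theta_lt1 A_gt0 wb tw) ?divfK// -subr_eq0.
Qed.

(** The hypothesis for one-element lists bounds each multiplicity, so a largest one exists at every
    zero and dominates [vanishing_order]; the sum over all zeros is a supremum over finite sets, to
    which the hypothesis applies again. *)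
Lemma zero_count_le B (al T M : R) : well_behaved theta A K B -> theta < al ->
  (forall zs : seq (R[i] * nat), uniq (map fst zs) ->
     (forall p, p \in zs -> [/\ al <= complex.Re p.1 <= 1, `|complex.Im p.1| <= T &
        vanishes_to (zg A B) p.1 p.2]) -> (\sum_(p <- zs) p.2)%:R <= M) ->
  (zero_count theta B al T <= M%:E)%E.
Proof.
move=> wb tal HM.
have M0 : 0 <= M by have := HM [::] isT (fun p => (fun pz => False_ind _ (notF pz))); rewrite big_nil.
pose Zs := [set rho : R[i] | [/\ bzeta theta B rho = 0, rho != 1,
      al <= complex.Re rho & `|complex.Im rho| <= T]].
have ord rho : exists k : nat, Zs rho ->
    vanishes_to (zg A B) rho k /\ (vanishing_order (bzeta theta B) rho <= k%:R%:E)%E.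
  have [|nz] := pselect (Zs rho); last by exists 0%N.
  move=> [z0 rho1 al1 T1].
  have rle : complex.Re rho <= 1.
    by rewrite leNgt; apply/negP => /(zeta_neq0_right wb); rewrite z0 eqxx.
  have trho : theta < complex.Re rho by exact: lt_le_trans al1.
  pose P m := `[< vanishes_to (zg A B) rho m >].
  have Pub m : P m -> (m <= Num.truncn M)%N.
    move=> /asboolP hv; rewrite truncn_ge_nat//.
    have := HM [:: (rho, m)] isT; rewrite big_cons big_nil addn0; apply.
    by move=> p; rewrite inE => /eqP -> /=; split => //; rewrite al1.
  have P0 : exists m, P m.
    exists 0%N; apply/asboolP; exists (complex.Re rho - theta), (zg A B).
    split; first by rewrite subr_gt0.
    move=> w hw; rewrite expr0 mul1r; split; last by [].
    have tw : theta < complex.Re w.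
      have := ler_Re_cn (w - rho); rewrite cReD cReN ler_norml => /andP[g1 _].
      by lra_from g1 hw.
    exact (cderivable_zg theta_ge0 theta_lt1 A_gt0 wb tw).
  have [k /asboolP Pk kmax] := ex_maxnP P0 Pub.
  exists k => _; split; first exact: Pk.
  apply: ge_ereal_sup => _ [m hm <-]; rewrite lee_fin ler_nat; apply: kmax.
  by apply/asboolP; exact: vanishes_to_bzeta hm.
have [k Hk] := choice ord.
rewrite /zero_count -/Zs; apply: ge_ereal_sup => _ [F [finF FZ] <-].
rewrite fsbig_finite//=.
have inF rho : rho \in fset_set F -> Zs rho by rewrite in_fset_set// inE => /FZ.
apply: (@le_trans _ _ (\sum_(rho <- fset_set F) (k rho)%:R%:E)%E).
  by rewrite big_seq [leRHS]big_seq; apply: lee_sum => rho /inF/Hk[].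
rewrite sumEFin lee_fin -natr_sum.
have := HM [seq (rho, k rho) | rho <- fset_set F].
rewrite big_map /=; apply.
  by rewrite -map_comp map_id_in ?fset_uniq.
move=> p /mapP[rho /inF rF ->] /=; have [hv _] := Hk rho rF.
have [z0 rho1 al1 T1] := rF; split => //; rewrite al1 /=.
by rewrite leNgt; apply/negP => /(zeta_neq0_right wb); rewrite z0 eqxx.
Qed.

End Final.

Theorem theorem1p2 (R : realType) (theta A K : R)
    (theta_ge0 : 0 <= theta) (theta_lt1 : theta < 1) (A_gt0 : 0 < A) :
  exists2 C : R, 0 < C &
    forall eps delta : R, 0 < eps -> 0 < delta ->
    exists T0 : R,
      forall B : beurling R, well_behaved theta A K B ->
      forall T mu : R, T0 <= T -> 2 / 3 + delta <= mu ->
        (zero_count theta B ((1 - mu) * theta + mu) T <=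
           (C * T `^ ((cmu mu + eps) * (1 - mu)) * ln T ^+ 9)%:E)%E.
Proof.
have [C0 [kap [X0 [C00 kap0 H]]]] := density_core K theta_ge0 theta_lt1 A_gt0.
exists (C0 * 17); first by pos.
move=> eps delta eps0 delta0.
have [T0 HT] := choose_lengths theta_ge0 theta_lt1 X0 kap0 eps0 delta0.
(* The bound [T >= 1] makes [ln T] nonnegative also for [mu > 1], where the choice of lengths gives
   no information. *)
exists (Num.max T0 1) => B wb T mu; rewrite ge_max => /andP[TT T1] mu1.
have L0 : 0 <= ln T by exact: ln_ge0.
have mu0 : 2 / 3 < mu by lra.
have tal : theta < (1 - mu) * theta + mu.
  have -> : (1 - mu) * theta + mu = theta + mu * (1 - theta) by ring.
  by rewrite ltrDl mulr_gt0//; lra.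
apply: (zero_count_le theta_ge0 theta_lt1 A_gt0 wb tal) => zs uzs hzs.
(* For [mu > 1] the region lies right of the line of real part 1, so there is no zero to count. *)
have [mu2|mu2] := leP mu 1; last first.
  have -> : (\sum_(p <- zs) p.2 = 0)%N.
    rewrite big1_seq// => p /andP[_ /hzs[/andP[p1 p2] _ _]]; exfalso.
    have : 0 < (mu - 1) * (1 - theta) by apply: mulr_gt0; lra.
    lra.
  by rewrite mulr0n; pos.
have mur : 2 / 3 + delta <= mu <= 1 by rewrite mu1.
have [x [m [ad hk hX hV]]] := HT T mu TT mur.
apply: (le_trans (H B wb T _ x m zs ad hk hX uzs hzs)).
have [L12 _ _ _ _] := admissible_facts theta_ge0 theta_lt1 ad.
apply: (@le_trans _ _ (C0 * ln T ^+ 6 * (17 * T `^ ((cmu mu + eps) * (1 - mu))))).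
  by apply: ler_wpM2l => //; pos.
have -> : C0 * ln T ^+ 6 * (17 * T `^ ((cmu mu + eps) * (1 - mu))) =
  C0 * 17 * T `^ ((cmu mu + eps) * (1 - mu)) * ln T ^+ 6 by ring.
apply: ler_wpM2l; first by pos.
by apply: ler_weXn2l => //; lra.
Qed.
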